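(* Let $G$ be a profinite group such that $c_*(G)$ is finite. Then $G$ is virtually pronilpotent-by-(Sylow-finite)-by-abelian; that is, there is an open subgroup $K$ of $G$ and normal subgroups $N \leq A$ of $K$ such that $N$ is pronilpotent, $A/N$ is Sylow-finite, and $K/A$ is abelian.
   Context: Profinite groups are regarded as topological groups: subgroups are required to be closed, homomorphisms continuous, and generation means topological generation. For a profinite group $G$ and a prime $p$, $d_p(G)$ denotes the size of a minimum (topological) generating set for a $p$-Sylow subgroup of $G$. For a finitely generated pro-$p$ group $S$ with Frattini subgroup $\Phi(S)$, the elementary abelian group $S/\Phi(S)$ has a finite $\mathrm{Aut}(S)$-invariant series in which each factor is irreducible as an $\mathrm{Aut}(S)$-module; $c(S)$ denotes the maximum rank (dimension over $\mathbb{F}_p$) of the factors, which is well defined by the Jordan–Hölder theorem. If $G$ has a finitely generated $p$-Sylow subgroup $S$, put $c_p(G) := c(S)$; otherwise put $c_p(G) := d_p(G)$ (which is infinite). $c_*(G)$ is the supremum of $c_p(G)$ over all primes $p$. A profinite group is Sylow-finite if each of its Sylow subgroups is contained in a finite normal subgroup. *)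

(* Defs.v *)
From HB Require Import structures.
From mathcomp Require Import all_boot all_order all_algebra all_fingroup.
From mathcomp Require Import all_solvable.
From mathcomp Require Import boolp classical_sets functions cardinality.
From mathcomp Require Import constructive_ereal topology.

Set Implicit Arguments.
Unset Strict Implicit.
Unset Printing Implicit Defensive.

Local Open Scope classical_set_scope.
Local Open Scope group_scope.
Local Open Scope card_scope.

HB.mixin Record Topological_isTopologicalGroup G of Topological G & monoid.Group G := {
  mulg_continuous : continuous (fun x : G * G => x.1 * x.2) ;
  invg_continuous : continuous (fun x : G => x^-1)
}.

#[short(type="topologicalGroupType")]
HB.structure Definition TopologicalGroup :=
  {G of Topological G & monoid.Group G & Topological_isTopologicalGroup G}.

Definition profinite (G : topologicalGroupType) : Prop :=
  [/\ compact [set: G], hausdorff_space G & totally_disconnected [set: G]].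

Definition subgroup (G : groupType) (H : set G) : Prop :=
  H 1 /\ forall x y, H x -> H y -> H (x * y^-1).

Definition normal_subgroup (G : groupType) (N H : set G) : Prop :=
  [/\ subgroup N, N `<=` H & forall x y, H x -> N y -> N (y ^ x)].

Definition closed_subgroup (G : topologicalGroupType) (H : set G) : Prop :=
  closed H /\ subgroup H.

Definition left_cosets (G : groupType) (U : set G) : set (set G) :=
  [set [set x * u | u in U] | x in [set: G]].

(* The restriction of [f] to [H] is a surjective homomorphism onto [Q] with
   kernel [N], so that [Q] is a copy of the abstract group H / N; the values of
   [f] outside [H] are irrelevant. *)
Definition quotient_map (G Q : groupType) (H N : set G) (f : G -> Q) : Prop :=
  [/\ forall x y, H x -> H y -> f (x * y) = f x * f y,
      f @` H = [set: Q] &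
      H `&` f @^-1` [set 1] = N].

(* The topological group H / N satisfies the (isomorphism-invariant) property
   [P].  The condition on open sets says that [Q] carries the quotient topology
   of the subspace topology of [H]. *)
Definition quotient_satisfies (G : topologicalGroupType) (H N : set G)
    (P : topologicalGroupType -> Prop) : Prop :=
  exists (Q : topologicalGroupType) (f : G -> Q),
    [/\ quotient_map H N f,
        forall O : set Q, open O <-> open (f @^-1` O : set (subspace H)) &
        P Q].

(* For a closed subgroup [H]: every quotient of [H] by an open normal subgroup
   is a (finite) group in the isomorphism-closed class [C]. *)
Definition pro_class (C : finGroupType -> Prop) (G : topologicalGroupType)
    (H : set G) : Prop :=
  forall U : set G, normal_subgroup U H -> open (U : set (subspace H)) ->
  exists (Q : finGroupType) (f : G -> Q), quotient_map H U f /\ C Q.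

Definition pro_p (p : nat) (G : topologicalGroupType) (H : set G) : Prop :=
  pro_class (fun Q => is_true (p.-group [set: Q]%G)) H.

Definition pronilpotent (G : topologicalGroupType) (H : set G) : Prop :=
  pro_class (fun Q => is_true (nilpotent [set: Q]%G)) H.

(* The index of [S] in the profinite group [G] is the least common multiple, as
   a supernatural number, of the indices of the open subgroups containing [S];
   the last clause says that it is prime to [p]. *)
Definition sylow_subgroup (p : nat) (G : topologicalGroupType) (S : set G) :
    Prop :=
  [/\ closed_subgroup S, pro_p p S &
      forall (U : set G) (n : nat), subgroup U -> open U -> S `<=` U ->
        left_cosets U #= `I_n -> ~~ (p %| n)].

Definition generates (G : topologicalGroupType) (X S : set G) : Prop :=
  smallest (@closed_subgroup G) X = S.

Definition generated_by_size (G : topologicalGroupType) (S : set G) (n : nat) :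
    Prop :=
  exists X : set G, X #= `I_n /\ generates X S.

Definition finitely_generated (G : topologicalGroupType) (S : set G) : Prop :=
  exists n, generated_by_size S n.

Definition maximal_subgroup (G : topologicalGroupType) (M S : set G) : Prop :=
  [/\ closed_subgroup M, M `<` S &
      forall L, closed_subgroup L -> M `<=` L -> L `<` S -> L = M].

Definition frattini (G : topologicalGroupType) (S : set G) : set G :=
  S `&` \bigcap_(M in [set M | maximal_subgroup M S]) M.

(* Topological automorphisms of a closed subgroup [S], given by functions on the
   ambient group whose values outside [S] are irrelevant.  When [S] is compact
   Hausdorff, the inverse is automatically continuous. *)
Definition automorphism (G : topologicalGroupType) (S : set G) (a : G -> G) :
    Prop :=
  [/\ set_bij S S a, forall x y, S x -> S y -> a (x * y) = a x * a y &
      {within S, continuous a}].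

(* For [f] exhibiting [E] as a characteristic quotient of [S]: the subgroup [V]
   of [E] is stable under the action of Aut(S) on [E]. *)
Definition aut_invariant (G : topologicalGroupType) (S : set G)
    (E : finGroupType) (f : G -> E) (V : {group E}) : Prop :=
  forall a, automorphism S a -> forall x, S x -> f x \in V -> f (a x) \in V.

Definition aut_irreducible (G : topologicalGroupType) (S : set G)
    (E : finGroupType) (f : G -> E) (W V : {group E}) : Prop :=
  W \proper V /\
  forall L : {group E}, aut_invariant S f L -> W \subset L -> L \subset V ->
    L = W \/ L = V.

(* [r] is the maximum rank of the factors V (i+1) / V i of an Aut(S)-composition
   series 1 = V 0 < ... < V m = E of E = S / Phi(S). *)
Definition is_c_of (G : topologicalGroupType) (S : set G) (r : nat) : Prop :=
  exists (E : finGroupType) (f : G -> E) (m : nat) (V : nat -> {group E}),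
    [/\ quotient_map S (frattini S) f,
        V 0%N = 1%G /\ V m = [set: E]%G,
        forall i, (i <= m)%N -> aut_invariant S f (V i),
        forall i, (i < m)%N -> aut_irreducible S f (V i) (V i.+1) &
        r = (\max_(i < m) 'r(V i.+1 / V i))%N].

(* By the Jordan-Hoelder theorem, at most one [r] satisfies [is_c_of S r]. *)
Definition c_of (G : topologicalGroupType) (S : set G) : nat :=
  xget 0%N [set r | is_c_of S r].

(* Values in {0, 1, 2, ...} \cup {+oo} are taken in [\bar int], which is where the
   library provides an order; all infinite cardinals are identified with +oo. *)
Definition d_p (p : nat) (G : topologicalGroupType) : \bar int :=
  infimum +oo%E
    [set (Posz n)%:E%E | n in
      [set n | exists S : set G, sylow_subgroup p S /\ generated_by_size S n]].

Definition c_p (p : nat) (G : topologicalGroupType) : \bar int :=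
  if pselect (exists S : set G, sylow_subgroup p S /\ finitely_generated S)
    is left exS
  then (Posz (c_of (projT1 (cid exS))))%:E%E
  else d_p p G.

Definition c_star (G : topologicalGroupType) : \bar int :=
  supremum 0%:E%E [set c_p p G | p in [set p | prime p]].

Definition Sylow_finite (Q : topologicalGroupType) : Prop :=
  forall (p : nat) (S : set Q), prime p -> sylow_subgroup p S ->
  exists M : set Q, [/\ normal_subgroup M [set: Q], finite_set M & S `<=` M].

Definition abelian_group (Q : topologicalGroupType) : Prop :=
  forall x y : Q, commute x y.

(* Main.v *)
(* Let [f] range over the continuous homomorphisms from [G] to finite groups.

   For a prime [p] with finitely generated Sylow subgroup [S], the orders of
   [f S / Phi(f S)] are bounded. If [f0] attains the maximum, then Tate's theorem
   shows that [f (ker f0)] is p-nilpotent for every [f]. Let [K0] be an open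
   normal subgroup whose images are p-nilpotent for all [p <= R], where [R]
   bounds [c_*(G)]. An image [X0] of [K0] is an extension of a subgroup [O] with
   only prime divisors [> R] by a nilpotent group, and for large [l] the Sylow
   l-subgroup [S] of [X0] lies in [O]. The composition series that defines
   [c(S)] provides an [N_G(S)]-invariant series of [S / Phi(S)] with factors of
   rank at most [R]. A linear group of degree [n <= R] which is an extension of
   a normal subgroup with prime divisors [> R] by a nilpotent group has an
   abelian subgroup of index at most [(n ^ n) ^ 2] containing the normal
   subgroup: a normal abelian subgroup has at most [n] weights, so its
   centraliser has index at most [n ^ n]. As the Sylow subgroups of [G] are
   finitely generated, [K0] contains an open subgroup [K] whose images lie in
   all subgroups of index at most [(R ^ R) ^ 2] of the images of [K0]. With
   [X = f K], the derived group of [N_X(S)] then acts trivially on the factors of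
   the series, so that its l'-elements centralise [S].

   A Frattini argument shows next that for a prime [q] and almost all primes [p],
   the q-elements of [X'] lie in [O_{p',p}(X)]. Let [N] and [A] be the inverse
   limits of the subgroups ['F(X)] and [X' 'F(X)]. Since ['F(X)] is the
   intersection of the [O_{p',p}(X)], whose inverse images contain open subgroups
   of [K], the Sylow q-subgroups of [A / N] lie in a finite normal subgroup. *)

Require Import Defs.
From HB Require Import structures.
From mathcomp Require Import all_boot all_order all_algebra all_fingroup.
From mathcomp Require Import all_solvable separable cyclotomic closed_field.
From mathcomp Require Import mxrepresentation mxabelem.

Set Implicit Arguments.
Unset Strict Implicit.
Unset Printing Implicit Defensive.

Import GRing.Theory.
Local Open Scope group_scope.

(** * Normal p-complements *)

Section PNilpotent.

Variable p : nat.

Definition p_nilpotent (gT : finGroupType) (M : {group gT}) :=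
  p.-group (M / 'O_p^'(M)).

Lemma p_nilpotentI (gT : finGroupType) (L M : {group gT}) :
  L <| M -> p^'.-group L -> p.-group (M / L) -> p_nilpotent M.
Proof.
move=> nsLM p'L pML; rewrite /p_nilpotent.
have sLO : L \subset 'O_p^'(M) by apply: pcore_max.
have nLM := normal_norm nsLM.
have nOM : M \subset 'N('O_p^'(M)) := gFnorm _ _.
rewrite /pgroup card_quotient // -indexgI.
rewrite /pgroup card_quotient // in pML.
apply: pnat_dvd pML; rewrite -(setIidPr (pcore_sub p^' M)) in sLO *.
by rewrite indexgI; apply: indexgS; apply: subset_trans sLO (subsetIr _ _).
Qed.

Lemma p_nilpotentS (gT : finGroupType) (L M : {group gT}) :
  L \subset M -> p_nilpotent M -> p_nilpotent L.
Proof.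
move=> sLM pM; have nOM : M \subset 'N('O_p^'(M)) := gFnorm _ _.
have nOL := subset_trans sLM nOM.
apply: (@p_nilpotentI _ (L :&: 'O_p^'(M))%G).
- by rewrite /normal subsetIl normsI ?normG.
- by apply: pgroupS (subsetIr _ _) (pcore_pgroup _ _).
rewrite /= setIC (isog_pgroup _ (second_isog nOL)).
by apply: pgroupS pM; apply: quotientS.
Qed.

Lemma p_nilpotent_morphim (gT rT : finGroupType) (D M : {group gT})
    (f : {morphism D >-> rT}) :
  M \subset D -> p_nilpotent M -> p_nilpotent (f @* M).
Proof.
move=> sMD pM; have nsO : 'O_p^'(M) <| M := gFnormal _ _.
have sOM := normal_sub nsO.
apply: (@p_nilpotentI _ (f @* 'O_p^'(M))%G).
- exact: morphim_normal.
- by apply: morphim_pgroup; apply: pcore_pgroup.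
move: pM; rewrite /p_nilpotent /pgroup !card_quotient ?normal_norm //.
  by apply: pnat_dvd; apply: index_morphim; rewrite subIset // sMD.
exact: morphim_normal.
Qed.

Lemma p_nilpotent_pcore2 (gT : finGroupType) (X : {group gT}) :
  p_nilpotent 'O_{p^', p}(X).
Proof.
have sub : 'O_p^'(X) \subset 'O_{p^', p}(X).
  by rewrite -(pseries1 p^'); apply: (pseries_sub_catl [:: p^' : nat_pred] [:: p : nat_pred]).
apply: (@p_nilpotentI _ 'O_p^'(X)%G); rewrite ?pcore_pgroup //.
  by apply: normalS sub _ (pcore_normal _ _); apply: gFsub.
by rewrite /= quotient_pseries2 pcore_pgroup.
Qed.

(** The subgroup ['O_p^'(M)] is characteristic in [M], so it lies in ['O_p^'(X)], and the image of
    [M] in [X / 'O_p^'(X)] is a normal p-group. With [p_nilpotent_pcore2] this makes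
    ['O_{p^', p}(X)] the largest normal p-nilpotent subgroup. *)
Lemma p_nilpotent_normal (gT : finGroupType) (M X : {group gT}) :
  M <| X -> p_nilpotent M -> M \subset 'O_{p^', p}(X).
Proof.
move=> nsMX pM.
have nOX : X \subset 'N('O_p^'(X)) := gFnorm _ _.
have nOM := subset_trans (normal_sub nsMX) nOX.
have sOO : 'O_p^'(M) \subset 'O_p^'(X).
  by apply: pcore_max; rewrite ?pcore_pgroup ?gFnormal_trans.
have sub : 'O_p^'(X) \subset 'O_{p^', p}(X).
  by rewrite -(pseries1 p^'); apply: (pseries_sub_catl [:: p^' : nat_pred] [:: p : nat_pred]).
rewrite -(quotientSGK nOM sub) quotient_pseries2.
apply: pcore_max; last exact: quotient_normal.
rewrite /pgroup card_quotient //.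
move: pM; rewrite /p_nilpotent /pgroup card_quotient ?gFnorm //.
by apply: pnat_dvd; apply: indexgS.
Qed.

End PNilpotent.

(** As ['O_pi^'(M)] is the intersection of the ['O_p^'(M)] with [p] in [pi], the quotient embeds in
    a product of p-groups. In terms of the definition of [nilpotent]: a subgroup contained in its
    commutator with the whole group dies in each of these p-groups, hence is trivial. *)
Lemma nilpotent_quo_pcore (gT : finGroupType) (pi : nat_pred) (M : {group gT}) :
  (forall p, p \in pi -> p_nilpotent p M) -> nilpotent (M / 'O_pi^'(M)).
Proof.
move=> pnM; set O := 'O_pi^'(M).
have nOM : M \subset 'N(O) := gFnorm _ _.
apply/forall_inP=> Gb; rewrite subsetI => /andP[sGM sGG].
have [G defG sOG sGM'] := inv_quotientS (pcore_normal _ _) sGM.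
have nOG := subset_trans sGM' nOM.
rewrite defG -subG1 quotient_sub1 //= -bigcap_p'core subsetI sGM'; apply/bigcapsP=> p pip.
have sOO : O \subset 'O_p^'(M).
  by rewrite /O -bigcap_p'core subIset // orbC (bigcap_min p).
have nsO : 'O_p^'(M) / O <| M / O by rewrite quotient_normal ?pcore_normal.
have pG : p.-group ((M / O) / ('O_p^'(M) / O)).
  have nO : O <| M := pcore_normal _ _.
  rewrite (isog_pgroup _ (third_isog sOO nO (pcore_normal _ _))).
  exact: pnM.
have /forall_inP/(_ (Gb / ('O_p^'(M) / O))%G) := pgroup_nil pG.
have nGb := subset_trans sGM (normal_norm nsO).
rewrite subsetI quotientS //= -quotientR ?(normal_norm nsO) // quotientS //.
move=> /(_ isT); rewrite -subG1 quotient_sub1 // defG quotientSGK //.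
Qed.

Lemma nilpotent_p_nilpotent (gT : finGroupType) (M : {group gT}) :
  (forall p, prime p -> p_nilpotent p M) -> nilpotent M.
Proof.
move=> pnM; have := @nilpotent_quo_pcore _ [pred p | prime p] M pnM.
suff -> : 'O_[pred p | prime p]^'(M) = 1.
  by rewrite -(isog_nil (quotient1_isog M)).
apply/eqP; rewrite trivg_card1 eqn_leq cardG_gt0 andbT leqNgt.
apply/negP=> /pdivP[p pr_p]; have /pgroupP oO := pcore_pgroup [pred p | prime p]^' M.
by move=> /(oO _ pr_p); rewrite !inE pr_p.
Qed.

Lemma p_nilpotent_nil (gT : finGroupType) (p : nat) (M : {group gT}) :
  nilpotent M -> p_nilpotent p M.
Proof.
move=> nilM; have [_ defM _ _] := dprodP (nilpotent_pcoreC p nilM).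
apply: (@p_nilpotentI _ _ 'O_p^'(M)%G); rewrite ?pcore_normal ?pcore_pgroup //.
have -> : M / 'O_p^'(M) = 'O_p(M) / 'O_p^'(M) by rewrite -[RHS]quotientMidr defM.
exact/quotient_pgroup/pcore_pgroup.
Qed.

Lemma p_nilpotent_p'group (gT : finGroupType) (p : nat) (M : {group gT}) :
  p^'.-group M -> p_nilpotent p M.
Proof.
move=> p'M; apply: (p_nilpotentI (normal_refl M) p'M).
by rewrite trivg_quotient pgroup1.
Qed.

(** The intersection of the ['O_{p^', p}(X)] is normal and p-nilpotent for every prime, hence
    nilpotent. Primes above [#|X|] do not divide the order, so the finite intersection [T]
    suffices. *)
Lemma Fitting_pcore2 (gT : finGroupType) (X : {group gT}) x :
  x \in 'F(X) <-> x \in X /\ forall p, prime p -> x \in 'O_{p^', p}(X).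
Proof.
split=> [Fx|[Xx Ox]].
  split; first exact: subsetP (Fitting_sub X) x Fx.
  move=> p p_pr; apply: subsetP Fx.
  by apply: p_nilpotent_normal (Fitting_normal X) _; exact/p_nilpotent_nil/Fitting_nil.
pose T := (X :&: \bigcap_(p < #|X|.+1 | prime p) 'O_{p^', p}(X))%G.
have Tx : x \in T.
  by rewrite in_setI Xx; apply/bigcapP=> p; exact: Ox.
apply: subsetP Tx; apply: Fitting_max.
  rewrite /normal subsetIl; apply: normsI (normG X) _.
  by apply: norms_bigcap; apply/bigcapsP => p _; exact: gFnorm.
apply: nilpotent_p_nilpotent => p p_pr; have [lt_p|le_p] := ltnP p #|X|.+1.
  apply: p_nilpotentS (p_nilpotent_pcore2 p X); apply: subset_trans (subsetIr _ _) _.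
  exact: (bigcap_inf (Ordinal lt_p)).
apply: p_nilpotent_p'group; apply: (@pgroupS _ _ X); first exact: subsetIl.
rewrite /pgroup p'natE //; apply: contraL le_p => /(dvdn_leq (cardG_gt0 _)).
by rewrite -leqNgt.
Qed.

(* A central extension by a group of order [p] which splits over a Sylow
   subgroup splits over the whole group, by Gaschuetz. Applied to the pullback
   to [H] of the extension [S / D1] of [S / D = H / L], where [D1] has index
   [p] in [D], it provides a [p]-quotient of [H] of order [#|S : D1|]. *)
Lemma p_quotient_of_Frattini (gT : finGroupType) (p : nat)
    (H S L : {group gT}) :
  prime p -> p.-Sylow(H) S -> L <| H -> p.-group (H / L) ->
  L :&: S \subset 'Phi(S) -> L :&: S != 1 ->
  exists2 L0 : {group gT}, L0 <| H & p.-group (H / L0) /\ #|H : L| < #|H : L0|.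
Proof.
move=> p_pr sylS nsLH pHL sDPhi ntD.
have [sSH pS _] := and3P sylS; have [sLH nLH] := andP nsLH.
have nLS := subset_trans sSH nLH.
have defH : L * S = H.
  rewrite -quotientK // (pHall_id (quotient_pHall nLS sylS) pHL).
  by rewrite quotientGK.
set D := L :&: S in sDPhi ntD.
have nsDS : D <| S by rewrite /normal subsetIr normsI ?normG.
have pD : p.-group D := pgroupS (subsetIr _ _) pS.
have [_ p_dvd_D [k oD]] := pgroup_pdiv pD ntD.
have [D1 [sD1D nsD1S oD1]] : exists Q : {group gT},
    [/\ Q \subset D, Q <| S & #|Q| = (p ^ k)%N].
  by apply: (normal_pgroup pS nsDS); rewrite oD pfactorK // leqnSn.
have [sD1S nD1S] := andP nsD1S.
have nD1D : D \subset 'N(D1) := subset_trans (normal_sub nsDS) nD1S.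
have oZ : #|D / D1| = p.
  by rewrite card_quotient // -divgS // oD oD1 expnS mulnK // expn_gt0 prime_gt0.
(* The equation [H = L * S] identifies [H / L] with [S / D]. [E] is the fibre product of [H] and
   [S / D1] over this group, and [Z] below is the kernel of its first projection. *)
pose E := [set x : gT * coset_of D1 |
  [exists s in S, (x.2 == coset D1 s) && (x.1 * s^-1 \in L)]].
have EP h u : reflect (exists2 s, s \in S & u = coset D1 s /\ h * s^-1 \in L) ((h, u) \in E).
  rewrite inE; apply: (iffP exists_inP) => -[s Ss].
    by case/andP=> /eqP; exists s.
  by case=> /= -> Lh; exists s => //; rewrite eqxx.
have sLSH l s : l \in L -> s \in S -> l * s \in H.
  by move=> Ll Ss; rewrite -defH mem_mulg.
have gE : group_set E.
  apply/group_setP; split; first by apply/EP; exists 1; rewrite ?morph1 ?invg1 ?mulg1.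
  move=> [h u] [h' u'] /EP[s Ss [-> Lh]] /EP[s' Ss' [-> Lh']]; apply/EP.
  exists (s * s'); [exact: groupM | split].
    by rewrite morphM ?(subsetP nD1S).
  have Lhi : (h * s^-1)^-1 \in L by rewrite groupV.
  rewrite /= -(groupMr _ Lhi).
  suff -> : h * h' * (s * s')^-1 * (h * s^-1)^-1 = (h' * s'^-1) ^ h^-1.
    rewrite memJ_norm // (subsetP nLH) // groupV.
    by rewrite -(mulgKV s h) sLSH.
  by rewrite conjgE !invMg !invgK !mulgA mulgKV.
pose EG := Group gE.
pose Z := (@pair1g gT _ @* (D / D1))%G.
have ZP h u : reflect (h = 1 /\ u \in D / D1) ((h, u) \in Z).
  rewrite /= morphim_pair1g inE /= inE; apply: (iffP andP) => -[]; first by move=> /eqP.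
  by move=> -> ->; rewrite eqxx.
have oZ' : #|Z| = p by rewrite card_injm ?injm_pair1g ?subsetT.
(* The graph [Q] of the coset map is a complement to [Z] in the preimage [P] of [S] in [E]. The
   index of [P] is prime to [p], so the splitting passes from [P] to [E]. *)
pose q s := (s, coset D1 s).
have qM : {in S &, {morph q : x y / x * y}}.
  by move=> x y Sx Sy; rewrite /q morphM ?(subsetP nD1S).
pose Q := (Morphism qM @* S)%G.
have QP h u : reflect (h \in S /\ u = coset D1 h) ((h, u) \in Q).
  apply: (iffP morphimP) => [[s _ Ss [-> ->]]|[Sh ->]] //.
  by exists h.
have sQE : Q \subset EG.
  apply/subsetP=> -[h u] /QP[Sh ->]; apply/EP; exists h => //.
  by rewrite mulgV group1.
have sZE : Z \subset EG.
  apply/subsetP=> -[h u] /ZP[-> /morphimP[d Nd Dd ->]]; apply/EP.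
  exists d; first by case/setIP: Dd.
  by rewrite mul1g groupV; case/setIP: Dd.
have nsZE : Z <| EG.
  rewrite /normal sZE; apply/subsetP=> -[h u] /EP[s Ss [-> _]].
  rewrite inE; apply/subsetP=> _ /imsetP[[h' u'] /ZP[-> Du'] ->].
  have -> : (1, u') ^ (h, coset D1 s) = (1, u' ^ coset D1 s) :> gT * coset_of D1.
    by rewrite !conjgE; congr pair; rewrite /= mul1g mulVg.
  apply/ZP; split=> //; rewrite memJ_norm //.
  by rewrite (subsetP (quotient_norms D1 (normal_norm nsDS))) // mem_quotient.
have tiZQ : Z :&: Q = 1.
  apply/trivgP/subsetP=> -[h u] /setIP[/ZP[-> _] /QP[_ ->]].
  by rewrite morph1 inE.
have nZQ := subset_trans sQE (normal_norm nsZE).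
have oQ : #|Q| = #|S|.
  by rewrite card_injm //; apply/injmP=> x y _ _ [].
have fstE : fst @* EG = H.
  apply/eqP; rewrite eqEsubset; apply/andP; split; apply/subsetP=> h.
    case/morphimP=> -[h' u] _ /EP[s Ss [_ Lh]] -> /=.
    by rewrite -(mulgKV s h') sLSH.
  rewrite -defH => /mulsgP[l s Ll Ss ->]; apply/morphimP.
  exists (l * s, coset D1 s); [by rewrite inE | | by []].
  by apply/EP; exists s; rewrite ?mulgK.
have kerE (C : {group gT * coset_of D1}) : C \subset EG ->
    'ker_C (@fst gT (coset_of D1)) = C :&: Z.
  move=> sCE; apply/setP=> -[h u]; rewrite !(inE, in_setI).
  apply: andb_id2l => Cx; apply/eqP/ZP => /= [h1|[]//].
  split=> //; have /EP[s Ss [-> ]] := subsetP sCE _ Cx.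
  rewrite h1 mul1g groupV => Ls; rewrite mem_quotient //.
  by rewrite inE Ls.
have oE : #|EG| = (#|H| * p)%N.
  rewrite -fstE card_morphim setTI -indexgI kerE // (setIidPr sZE) -oZ' mulnC.
  by rewrite Lagrange.
have nsZP : Z * Q \subset EG by rewrite mul_subG.
pose P := (Z <*> Q)%G.
have defP : P = Z * Q :> {set _} by rewrite /= norm_joinEr.
have sPE : P \subset EG by rewrite defP.
have co : coprime #|Z| #|EG : P|.
  have oP : #|P| = (p * #|S|)%N by rewrite defP TI_cardMg // oZ' oQ.
  rewrite -divgS // oP oE mulnC divnMl ?prime_gt0 // oZ'.
  rewrite divgS // prime_coprime // -p'natE //.
  by case/and3P: sylS.
have : [splits EG, over Z].
  have abZ : abelian Z by rewrite cyclic_abelian // prime_cyclic // oZ'.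
  rewrite (Gaschutz_split nsZE (joing_subl _ _) sPE abZ co).
  by apply/splitsP; exists Q; apply/complP; split; rewrite ?defP.
case/splitsP=> C /complP[tiZC defE].
have sCE : C \subset EG by rewrite -defE mulG_subr.
have sndE : snd @* EG = S / D1.
  apply/setP=> u; apply/morphimP/morphimP.
    case=> -[h' u'] _ /EP[s Ss [-> _]] ->.
    by have Ns := subsetP nD1S s Ss; exists s.
  case=> s _ Ss ->; exists (s, coset D1 s) => //.
  by apply/EP; exists s; rewrite ?mulgV.
(* The image [D / D1] of [Z] lies in the Frattini subgroup of [S / D1], so the image of the
   complement [C] already generates [S / D1]. *)
have sndC : snd @* C = S / D1.
  have sndZ : snd @* Z \subset D / D1.
    by apply/subsetP=> _ /morphimP[[h u] _ /ZP[_ Du] ->].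
  rewrite -[LHS]genGid; apply: (@Phi_nongen _ (S / D1)%G).
  apply/eqP; rewrite eqEsubset join_subG Phi_sub /= -{1}sndE morphimS //=.
  rewrite -{1}sndE -defE morphimMl ?subsetT // mul_subG ?joing_subr //.
  apply: subset_trans (joing_subl _ _); apply: subset_trans sndZ _.
  by rewrite -(quotient_Phi pS) // quotientS.
have fstC : fst @* C = H.
  rewrite -fstE -defE morphimMl ?subsetT //.
  suff -> : fst @* Z = 1 by rewrite mul1g.
  apply/trivgP/subsetP=> _ /morphimP[[h u] _ /ZP[-> _] ->].
  by rewrite inE.
have injC : 'ker_C (@fst gT (coset_of D1)) = 1 by rewrite kerE // setIC.
(* The first projection maps [C] isomorphically onto [H]. Through it the second projection becomes a
   map from [H] onto [S / D1], with kernel the image of [K]. *)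
pose K := ('ker_C (@snd gT (coset_of D1)))%G.
have nsKC : K <| C := normalGI (subsetT _) (ker_normal _).
have card1 (B : {group gT * coset_of D1}) : B \subset C -> #|fst @* B| = #|B|.
  move=> sBC; rewrite card_morphim setTI -indexgI.
  suff -> : 'ker_B (@fst gT (coset_of D1)) = 1 by rewrite indexg1.
  by apply/trivgP; rewrite -injC setSI.
have sK1 : fst @* K \subset H by rewrite -fstC morphimS // normal_sub.
have idx : #|H : fst @* K| = #|S : D1|.
  have oH : #|H| = #|C| by rewrite -(card1 C) // fstC.
  rewrite -(divgS sK1) oH card1 ?normal_sub // divgS ?normal_sub //.
  by rewrite -(card_quotient nD1S) -sndC card_morphim setTI indexgI.
have oHL : #|H : L| = #|S : D|.
  rewrite -card_quotient // -(pHall_id (quotient_pHall nLS sylS) pHL).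
  by rewrite card_quotient // /D setIC indexgI.
exists (fst @* K)%G; first by rewrite -fstC morphim_normal.
have nsK1 : fst @* K <| H by rewrite -fstC morphim_normal.
split; first by rewrite /pgroup card_quotient ?normal_norm //= idx (pnat_dvd (dvdn_indexg _ _)).
rewrite /= idx oHL -(Lagrange_index (normal_sub nsDS) sD1D).
rewrite -(card_quotient nD1D) oZ.
by rewrite ltn_Pmulr ?prime_gt1 ?indexg_gt0.
Qed.

(** Normal subgroups of [H = M * S] with p-quotient are closed under intersection, so a minimal one,
    [L], lies in all the others. If [L] met [S] nontrivially, [p_quotient_of_Frattini] would give a
    p-quotient larger than [H / L]. Hence [L] is a p'-group, and it is a normal p-complement of
    [M]. *)
Lemma Tate_p_nilpotent (gT : finGroupType) (p : nat) (G S M : {group gT}) :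
  prime p -> p.-Sylow(G) S -> M <| G -> M :&: S \subset 'Phi(S) ->
  p_nilpotent p M.
Proof.
move=> p_pr sylS nsMG sMSPhi.
have [sSG pS _] := and3P sylS.
have nMS := subset_trans sSG (normal_norm nsMG).
pose H := (M <*> S)%G.
have sHG : H \subset G by rewrite join_subG normal_sub.
have sylSH : p.-Sylow(H) S := pHall_subl (joing_subr _ _) sHG sylS.
have nsMH : M <| H := normalS (joing_subl _ _) sHG nsMG.
have pHM : p.-group (H / M).
  by rewrite /= quotientYidl // quotient_pgroup.
pose P (L : {group gT}) := (L <| H) && p.-group (H / L).
have PM : P M by rewrite /P nsMH.
have [L /mingroupP[/andP[nsLH pHL] minL] sLM] := mingroup_exists PM.
have nsLM := normalS sLM (joing_subl _ _) nsLH.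
have minL' (L0 : {group gT}) : L0 <| H -> p.-group (H / L0) -> L \subset L0.
  move=> nsL0 pL0; apply/setIidPl; apply: (minL (L :&: L0)%G); rewrite ?subsetIl //.
  have nL0L : L \subset 'N(L0) := subset_trans (normal_sub nsLH) (normal_norm nsL0).
  have pHL' : p.-nat #|H : L| by rewrite -card_quotient ?normal_norm.
  have pLL0 : p.-nat #|L : L0|.
    by rewrite -card_quotient //; apply: pgroupS pL0; rewrite quotientS ?normal_sub.
  rewrite /P normalI //= /pgroup card_quotient ?normsI ?normal_norm //.
  by rewrite -(Lagrange_index (normal_sub nsLH) (subsetIl L L0)) pnatM indexgI pHL'.
have sDPhi : L :&: S \subset 'Phi(S) by apply: subset_trans sMSPhi; rewrite setSI.
have [D1|ntD] := eqVneq (L :&: S) 1; last first.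
  have [L0 nsL0 [pL0]] := p_quotient_of_Frattini p_pr sylSH nsLH pHL sDPhi ntD.
  by rewrite ltnNge dvdn_leq ?indexgS ?minL' ?indexg_gt0.
apply: (@p_nilpotentI _ _ L) => //.
  have := Sylow_setI_normal nsLH sylSH; rewrite D1 => /and3P[_ _].
  by rewrite indexg1.
by apply: pgroupS pHL; rewrite quotientS ?joing_subl.
Qed.

(** If the Frattini quotient of [S] does not shrink under [f], then the kernel meets [S] inside
    ['Phi(S)], and Tate's theorem applies. *)
Lemma p_nilpotent_ker (gT rT : finGroupType) (p : nat) (D S X : {group gT})
    (f : {morphism D >-> rT}) :
  prime p -> X \subset D -> p.-Sylow(X) S ->
  #|S : 'Phi(S)| <= #|f @* S : 'Phi(f @* S)| -> p_nilpotent p ('ker_X f)%G.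
Proof.
move=> p_pr sXD sylS le_idx; have [sSX pS _] := and3P sylS.
apply: (Tate_p_nilpotent p_pr sylS); first exact: normalGI sXD (ker_normal _).
have sSD := subset_trans sSX sXD.
rewrite /= setIAC (setIidPr sSX).
have nsPhiS : 'Phi(S) <| S := Phi_normal S.
have sPhiS := normal_sub nsPhiS.
move: le_idx; rewrite -(morphim_Phi f pS sSD).
rewrite -(index_morphim_ker f sPhiS sSD) => le1.
rewrite -indexg_eq1 eqn_leq indexg_gt0 andbT.
by move: le1; rewrite -[leqRHS]muln1 leq_pmul2l ?indexg_gt0.
Qed.

(** * Bounded linear groups *)

Lemma index_leq_card (gT : finGroupType) (T : finType) (G H : {group gT})
    (c : gT -> T) :
  H \subset G -> {in G &, forall x y, c x = c y -> x * y^-1 \in H} ->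
  #|G : H| <= #|[set c x | x in G]|.
Proof.
move=> sHG cP; rewrite /indexg -(card_in_imset (f := c \o repr)).
  apply/subset_leq_card/subsetP=> _ /imsetP[_ /rcosetsP[x Gx ->] ->] /=.
  apply: imset_f; have /rcosetP[h Hh ->] := mem_repr_rcoset H x.
  exact: groupM (subsetP sHG h Hh) Gx.
have repG x : x \in G -> repr (H :* x) \in G /\ H :* repr (H :* x) = H :* x.
  move=> Gx; split; last exact: rcoset_repr.
  have /rcosetP[h Hh ->] := mem_repr_rcoset H x.
  exact: groupM (subsetP sHG h Hh) Gx.
move=> _ _ /rcosetsP[x Gx ->] /rcosetsP[y Gy ->] /=.
have [[Gx' defx] [Gy' defy]] := (repG x Gx, repG y Gy).
move=> /(cP _ _ Gx' Gy') Hxy; rewrite -defx -defy.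
by apply: rcoset_eqP; rewrite mem_rcoset.
Qed.

Lemma index_setI_leq (gT : finGroupType) (G A B : {group gT}) :
  A \subset G -> B \subset G -> #|G : A :&: B| <= #|G : A| * #|G : B|.
Proof.
move=> sAG sBG.
have sABG : (A :&: B)%G \subset G by rewrite subIset ?sAG.
apply: (@leq_trans #|setX (rcosets A G) (rcosets B G)|); last by rewrite cardsX.
apply: leq_trans (index_leq_card (c := fun x => (A :* x, B :* x)) sABG _) _.
  move=> x y _ _ [eA eB]; rewrite inE -!mem_rcoset -eA -eB !rcoset_refl //.
by apply/subset_leq_card/subsetP=> _ /imsetP[x Gx ->]; rewrite inE /= !mem_rcosets !mulSGid ?Gx.
Qed.

Lemma index_bigcap_leq (gT : finGroupType) (G : {group gT}) n m
    (St : 'I_n -> {group gT}) :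
  (forall i, St i \subset G /\ #|G : St i| <= m) ->
  #|G : G :&: \bigcap_i St i| <= m ^ n.
Proof.
elim: n St => [|n IHn] St leSt; first by rewrite big_ord0 setIT indexgg.
have [s0G le0] := leSt ord0.
rewrite big_ord_recl setICA expnS.
apply: leq_trans (index_setI_leq s0G (B := (G :&: \bigcap_i St (lift ord0 i))%G) _) _.
  exact: subsetIl.
by rewrite leq_mul // IHn.
Qed.

(** * Weights of abelian normal subgroups *)

Section Weights.

Variables (F : closedFieldType) (gT : finGroupType) (L Z : {group gT}) (n : nat).
Variable rL : mx_representation F L n.
Hypotheses (F'Z : [pchar F]%R^'.-group Z) (nsZL : Z <| L) (abZ : abelian Z).

Let sZL := normal_sub nsZL.

(** The matrix of [z] is a root of [X^m - 1] with [m = #[z]] prime to the characteristic. This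
    polynomial is separable and splits, so the matrix is diagonalisable, and commuting
    diagonalisable matrices are so simultaneously. The rows of [P] are weight vectors, and [w z]
    lists the values of their weights at [z]. *)
Lemma codiagonalizable_abelian :
  exists2 P : 'M[F]_n, P \in unitmx &
    exists w : gT -> 'rV[F]_n,
      {in Z, forall z, P *m rL z = diag_mx (w z) *m P}%R.
Proof.
have [P Pu /allP PZ] : codiagonalizable [seq rL z | z in Z].
  apply/codiagonalizableP; split=> [_ _ /imageP[x Zx ->] /imageP[y Zy ->]|].
    rewrite /comm_mx -!repr_mxM ?(subsetP sZL) //.
    by rewrite (centsP abZ).
  move=> _ /imageP[z Zz ->].
  case: n rL => [|n'] rL'; first by rewrite thinmx0; apply: diagonalizable0.
  pose m := #[z]; have m_gt0 : 0 < m := order_gt0 z.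
  have Fm : (m%:R != 0 :> F)%R.
    by rewrite -pcharf'_nat; apply: mem_p_elt Zz.
  have [r def_r] := closed_field_poly_normal ('X^m - 1 : {poly F})%R.
  have monX : ('X^m - 1 : {poly F})%R \is monic.
    by have := monicXnsubC (1%R : F) m_gt0; rewrite polyC1.
  rewrite (eqP monX) scale1r in def_r.
  apply/diagonalizableP; exists r.
    by rewrite -separable_prod_XsubC -def_r separable_Xn_sub_1.
  apply: mxminpoly_min; rewrite -def_r rmorphB rmorphXn /= horner_mx_X rmorph1.
  by rewrite -repr_mxX ?(subsetP sZL) // expg_order repr_mx1 subrr.
exists P => //; exists (fun z => \row_j (P *m rL z *m invmx P) j j)%R => z Zz.
have /diagonalizable_forPex[d /(simmxP Pu) eqP] := PZ _ (image_f rL Zz).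
by rewrite eqP; congr (diag_mx _ *m _)%R; apply/rowP=> j; rewrite mxE mulmxK // mxE eqxx.
Qed.

(* [St i] is the stabiliser of the [i]-th weight of [Z], which lies in an
   [L]-orbit of at most [n] weights. *)
Lemma weight_stabilisers :
  exists St : 'I_n -> {group gT},
    (forall i, St i \subset L /\ #|L : St i| <= n) /\
    (forall g z, g \in L -> (forall i, g \in St i) -> z \in Z ->
       rL (z ^ g) = rL z).
Proof.
have [P Pu [w PZ]] := codiagonalizable_abelian.
have nZL := normal_norm nsZL.
have ZJ z g : z \in Z -> g \in L -> z ^ g \in Z.
  by move=> Zz Lg; rewrite memJ_norm // (subsetP nZL).
pose St i := [set g in L | [forall z in Z, w (z ^ g) 0%R i == w z 0%R i]].
have StP i g : reflect (g \in L /\ {in Z, forall z, w (z ^ g) 0%R i = w z 0%R i}) (g \in St i).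
  rewrite inE; apply: (iffP andP) => -[Lg].
    by move=> /eqfun_inP.
  by move=> wZ; split=> //; apply/eqfun_inP.
have gSt i : group_set (St i).
  apply/group_setP; split; first by apply/StP; split=> // z _; rewrite conjg1.
  move=> g h /StP[Lg wg] /StP[Lh wh]; apply/StP; split; first exact: groupM.
  by move=> z Zz; rewrite conjgM wh ?wg ?ZJ.
(* The translate by [g] of the i-th weight vector is a weight vector for the conjugate weight. Any
   of its nonzero coordinates in the basis [P] shows that this is one of the [n] weights. *)
have exj i g : g \in L -> exists j, {in Z, forall z, w z 0%R j = w (z ^ g^-1) 0%R i}.
  move=> Lg; pose v := (row i P *m rL g)%R; pose c := (v *m invmx P)%R.
  have vZ z : z \in Z -> (v *m rL z = w (z ^ g^-1)%g 0 i *: v)%R.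
    move=> Zz; have Lz := subsetP sZL z Zz.
    have Zzg : z ^ g^-1 \in Z by rewrite ZJ ?groupV.
    have defgz : g * z = (z ^ g^-1) * g by rewrite conjgE invgK -!mulgA mulVg mulg1.
    rewrite /v -mulmxA -repr_mxM // defgz repr_mxM ?(subsetP sZL _ Zzg) // mulmxA.
    by rewrite -row_mul PZ // row_mul row_diag_mx -scalemxAl -rowE -scalemxAl.
  have [j cj] : exists j, c 0%R j != 0%R.
    apply/existsP; apply: contraT; rewrite negb_exists => /forallP c0.
    have {}c0 : c = 0%R by apply/rowP=> j; rewrite [RHS]mxE; apply/eqP/negPn/c0.
    have v0 : v = 0%R by rewrite -(mulmxKV Pu v) -/c c0 mul0mx.
    have : row i P = 0%R by rewrite -[LHS](repr_mxK rL Lg) -/v v0 mul0mx.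
    move/(congr1 (mulmx^~ (invmx P))); rewrite mul0mx -row_mul mulmxV // row1.
    by move/rowP/(_ i); rewrite !mxE !eqxx => /eqP; rewrite oner_eq0.
  exists j => z Zz; apply: (mulIf cj); rewrite mulrC.
  have : (c *m diag_mx (w z) = w (z ^ g^-1)%g 0 i *: c)%R.
    rewrite /c scalemxAl -vZ // -!mulmxA; congr (_ *m _)%R.
    by rewrite -[(_ *m invmx P)%R]mul1mx -(mulVmx Pu) -!mulmxA (mulmxA P) PZ // mulmxK.
  by move/rowP/(_ j); rewrite mul_mx_diag !mxE.
(* The index of the conjugate weight separates the cosets of [St i], whence the bound [n]. On [L]
   the default [i] is never taken, by [exj]. *)
pose c i g := odflt i [pick j | [forall z in Z, w z 0%R j == w (z ^ g^-1)%g 0%R i]].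
have cP i g : g \in L -> {in Z, forall z, w z 0%R (c i g) = w (z ^ g^-1) 0%R i}.
  move=> Lg; rewrite /c; case: pickP => [j /eqfun_inP // | noj].
  by have [j /eqfun_inP] := exj i g Lg; rewrite noj.
exists (fun i => Group (gSt i)); split=> [i | g z Lg Stg Zz].
  have sStL : Group (gSt i) \subset L by apply/subsetP=> g /StP[].
  split=> //; rewrite -[leqRHS]card_ord.
  apply: leq_trans (index_leq_card (c := c i) sStL _) (max_card _).
  move=> x y Lx Ly cxy; apply/StP; split=> [|z Zz]; first by rewrite groupM ?groupV.
  have Zzx := ZJ z x Zz Lx.
  by have := cP i x Lx _ Zzx; rewrite cxy cP // -!conjgM mulgV conjg1.
have Zzg : z ^ g \in Z := ZJ z g Zz Lg.
suff ew : w (z ^ g) = w z.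
  have := PZ _ Zzg; rewrite ew -PZ // => /(congr1 (mulmx (invmx P))).
  by rewrite !mulKmx.
by apply/rowP=> i; have /StP[_ /(_ z Zz)] := Stg i.
Qed.

End Weights.

(** Take a maximal abelian normal subgroup [A]. If its centraliser were larger, its image in [G / A]
    would meet the centre nontrivially, and an element [x] of this intersection would make [A <*>
    <[x]>] a larger abelian normal subgroup. *)
Lemma nilpotent_self_centralising (gT : finGroupType) (G : {group gT}) :
  nilpotent G ->
  exists A : {group gT}, [/\ A <| G, abelian A & 'C_G(A) \subset A].
Proof.
move=> nilG; pose P (A : {group gT}) := (A <| G) && abelian A.
have P1 : P 1%G by rewrite /P normal1 abelian1.
have [A /maxgroupP[/andP[nsAG abA] maxA] _] := maxgroup_exists P1.
exists A; split=> //; apply: contraT => nCA.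
have nAG := normal_norm nsAG; have [sAG _] := andP nsAG.
have nsCG : 'C_G(A) <| G.
  by rewrite /normal subsetIl normsI ?normG // (subset_trans nAG) ?cent_norm.
have nAC := subset_trans (normal_sub nsCG) nAG.
have ntC : 'C_G(A) / A != 1 by rewrite -subG1 quotient_sub1.
have /trivgPn[xb] := meet_center_nil (quotient_nil A nilG) (quotient_normal A nsCG) ntC.
case/setIP=> /morphimP[x Nx Cx ->] Zx nt_x.
pose B := (A <*> <[x]>)%G.
have nAx : <[x]> \subset 'N(A) by rewrite cycle_subG.
have [Gx cAx] := setIP Cx.
have sBG : B \subset G by rewrite join_subG sAG cycle_subG.
have PB : P B.
  apply/andP; split.
    rewrite -(quotientGK nsAG) -(quotientGK (normalS (joing_subl A <[x]>) sBG nsAG)).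
    rewrite cosetpre_normal sub_center_normal //.
    by rewrite /= quotientYidl // quotient_cycle // cycle_subG.
  by rewrite abelianY abA cycle_abelian cycle_subG.
have /= defA := maxA B PB (joing_subl _ _).
case/negP: nt_x; apply/eqP/coset_id; rewrite -defA -cycle_subG joing_subr //.
Qed.

(** Both [Q] and [Q :^ u] are Sylow subgroups of the centraliser of [x ^ u], so some [c] in it makes
    [u * c] normalise [Q]. Then [u * c] centralises [Q], and [x = x ^ (u * c) = x ^ u]. *)
Lemma abelian_Sylow_fusion (gT : finGroupType) (q : nat) (Y Q : {group gT}) x u :
  q.-Sylow(Y) Q -> abelian Q -> 'N_Y(Q) \subset 'C(Q) ->
  x \in Q -> u \in Y -> x ^ u \in Q -> x ^ u = x.
Proof.
move=> sylQ abQ cNQ Qx Yu Qxu; have [sQY qQ _] := and3P sylQ.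
have sQC : Q \subset 'C_Y[x ^ u] by rewrite subsetI sQY sub_cent1 (subsetP abQ).
have sQuC : Q :^ u \subset 'C_Y[x ^ u].
  rewrite subsetI sub_cent1 -{1}(conjGid Yu) conjSg sQY /=.
  by rewrite centJ memJ_conjg (subsetP abQ).
have sCY : 'C_Y[x ^ u] \subset Y := subsetIl _ _.
have sylQC := pHall_subl sQC sCY sylQ.
have sylQuC : q.-Sylow('C_Y[x ^ u]) (Q :^ u)%G.
  by apply: pHall_subl sQuC sCY _; rewrite -{1}(conjGid Yu) pHallJ2.
have [c /setIP[Yc cxc] defQ] := Sylow_trans sylQuC sylQC.
have Nuc : u * c \in 'C(Q).
  by rewrite (subsetP cNQ) // inE groupM //= inE conjsgM -defQ.
have : x ^ (u * c) = x by apply/conjg_fixP/commgP; apply: commute_sym; apply: (centP Nuc).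
by rewrite conjgM (conjg_fixP (introT commgP (esym (cent1P cxc)))).
Qed.

(** Burnside's transfer argument: the transfer to [Q] kills an element [g] of [Q] in the derived
    group. By fusion, each factor of its cycle expansion is a power of [g] itself, and their product
    is [g] to the power [#|Y : Q|]. This index is prime to [q], so [g = 1]. *)
Lemma Sylow_central_der1 (gT : finGroupType) (q : nat) (Y Q : {group gT}) :
  q.-Sylow(Y) Q -> abelian Q -> 'N_Y(Q) \subset 'C(Q) -> q^'.-group Y^`(1).
Proof.
move=> sylQ abQ cNQ; have [sQY qQ q'YQ] := and3P sylQ.
suff tiQ : Q :&: Y^`(1) = 1.
  have := Sylow_setI_normal (der_normal 1 Y) sylQ.
  by rewrite setIC tiQ => /and3P[_ _]; rewrite indexg1.
have abA : abelian (idm Q @* Q) by rewrite morphim_idm.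
pose V := @transfer_morphism _ _ Y Q (idm_morphism Q) abA.
apply/trivgP/subsetP=> g /setIP[Qg Y'g]; have Yg := subsetP sQY g Qg.
have Vg : V g = 0%R.
  have /subsetP/(_ g Y'g)/mker // : Y^`(1) \subset 'ker V.
  rewrite derg1 gen_subG; apply/subsetP=> _ /imset2P[x y Yx Yy ->].
  by rewrite !inE groupR //= morphR //; apply/commgP/FinRing.zmod_mulgC.
pose X := transversal (rcosets Q Y :* <[g]>) Y.
have trX : is_transversal X (rcosets Q Y :* <[g]>) Y.
  by apply: transversalP; apply: rcosets_cycle_partition.
have := transfer_cycle_expansion sQY abA Yg trX.
rewrite -[transfer _ _ _]/(V g) Vg.
have sXY := transversal_sub trX.
have Ag : g \in idm Q @* Q by rewrite morphim_idm.
rewrite (eq_bigr (fun x => FiniteModule.fmod abA g *+ #|<[g]> : Q :* x|)%R) => [|x Xx].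
  rewrite sumrMnr (sum_index_rcosets_cycle sQY Yg trX).
  move=> /(congr1 (@FiniteModule.fmval _ _ _)).
  rewrite FiniteModule.fmvalZ FiniteModule.fmodK // FiniteModule.fmval0.
  move/esym/eqP; rewrite -order_dvdn => dvd_g; rewrite inE -order_eq1 -dvdn1.
  have qg : q.-nat #[g] by apply: mem_p_elt Qg.
  by rewrite -(pnat_1 qg) // (pnat_dvd dvd_g).
have Yx := subsetP sXY x Xx; set k := #|_ : _|.
have Qgk : g ^+ k \in Q by rewrite groupX.
have Qgkx : (g ^+ k) ^ x^-1 \in Q.
  by rewrite conjgE invgK mulgA -mem_rcoset mulg_exp_card_rcosets.
rewrite (abelian_Sylow_fusion sylQ abQ cNQ Qgk _ Qgkx) ?groupV //=.
exact: FiniteModule.fmodX.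
Qed.

(** A self-centralising abelian normal subgroup of a Sylow subgroup [Q] is central in [Q], so [Q] is
    abelian. It is also central in its normaliser, and Burnside's criterion excludes every prime
    divisor of the order of the derived group. *)
Lemma central_abelian_normals (gT : finGroupType) (Y : {group gT}) :
  (forall L Z : {group gT}, L \subset Y -> Z <| L -> abelian Z -> L \subset 'C(Z)) ->
  abelian Y.
Proof.
move=> cY; suff Y1 : Y^`(1) = 1 by rewrite abelianE; apply/commG1P; rewrite -derg1.
apply/eqP; rewrite trivg_card1 eqn_leq cardG_gt0 andbT leqNgt.
apply/negP=> /pdivP[q pr_q q_dvd].
have [Q sylQ] := Sylow_exists q Y; have [sQY qQ _] := and3P sylQ.
have abQ : abelian Q.
  have [A [nsAQ abA sCA]] := nilpotent_self_centralising (pgroup_nil qQ).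
  apply: (abelianS _ abA); apply: subset_trans sCA.
  by rewrite subsetI subxx (cY _ _ sQY nsAQ abA).
have cNQ : 'N_Y(Q) \subset 'C(Q).
  by apply: cY; rewrite ?subsetIl // normalSG.
have := Sylow_central_der1 sylQ abQ cNQ.
by rewrite /pgroup p'natE // q_dvd.
Qed.

Section FaithfulLinear.

Variables (F : closedFieldType) (gT : finGroupType) (H : {group gT}) (n : nat).
Variable rH : mx_representation F H n.
Hypotheses (F'H : [pchar F]%R^'.-group H) (injH : mx_faithful rH).

Lemma faithful_weight_stabilisers (L Z : {group gT}) :
  L \subset H -> Z <| L -> abelian Z ->
  exists St : 'I_n -> {group gT},
    (forall i, St i \subset L /\ #|L : St i| <= n) /\
    L :&: \bigcap_i St i \subset 'C(Z).
Proof.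
move=> sLH nsZL abZ; have [sZL nZL] := andP nsZL.
have sZH := subset_trans sZL sLH.
have [St [StL StC]] := weight_stabilisers (subg_repr rH sLH) (pgroupS sZH F'H) nsZL abZ.
exists St; split=> //; apply/subsetP=> g /setIP[Lg /bigcapP Sg].
apply/centP=> z Zz; apply/esym/commgP/conjg_fixP.
have Lz := subsetP sZL z Zz; have Lzg : z ^ g \in L by rewrite groupJ.
have Hz := subsetP sLH _ Lz; have Hzg := subsetP sLH _ Lzg.
have rzg : rH (z ^ g) = rH z by apply: StC => // i; apply: Sg.
apply/eqP; rewrite eq_mulgV1 -in_set1; apply: (subsetP injH).
apply/rkerP; rewrite groupM ?groupV //; split=> //.
by rewrite repr_mxM ?groupV // rzg -repr_mxM ?groupV // mulgV repr_mx1.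
Qed.

(** A weight stabiliser has index at most [n], while all prime divisors of its index exceed [n].
    Thus all weights are fixed, and every abelian normal subgroup of a subgroup of [Y] is central in
    that subgroup. *)
Lemma faithful_large_primes_abelian (Y : {group gT}) :
  Y \subset H -> (forall q, prime q -> q %| #|Y| -> n < q) -> abelian Y.
Proof.
move=> sYH largeY; apply: central_abelian_normals => L Z sLY nsZL abZ.
have [St [StL sStC]] := faithful_weight_stabilisers (subset_trans sLY sYH) nsZL abZ.
apply: subset_trans sStC; rewrite subsetI subxx; apply/bigcapsP=> i _.
have [sStL le_n] := StL i; rewrite -indexg_eq1 eqn_leq indexg_gt0 andbT leqNgt.
apply/negP=> /pdivP[q pr_q q_dvd].
have qY : q %| #|Y|.
  exact: dvdn_trans (dvdn_trans q_dvd (dvdn_indexg _ _)) (cardSg sLY).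
have := largeY q pr_q qY; rewrite ltnNge => /negP[].
exact: leq_trans (dvdn_leq (indexg_gt0 _ _) q_dvd) le_n.
Qed.

Lemma faithful_index_cent (L Z : {group gT}) :
  L \subset H -> Z <| L -> abelian Z -> #|L : 'C_L(Z)| <= n ^ n.
Proof.
move=> sLH nsZL abZ.
have [St [StL sStC]] := faithful_weight_stabilisers sLH nsZL abZ.
apply: leq_trans (index_bigcap_leq StL); apply: dvdn_leq; first exact: indexg_gt0.
by apply: indexgS; rewrite subsetI subsetIl.
Qed.

(** The group [Y] is abelian, and its centraliser [H1] has index at most [n ^ n]. As [Y] is central
    in [H1], the latter is nilpotent and has a self-centralising abelian normal subgroup [A], again
    of index at most [n ^ n]. *)
Lemma faithful_abelian_index (Y : {group gT}) :
  Y <| H -> (forall q, prime q -> q %| #|Y| -> n < q) -> nilpotent (H / Y) ->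
  exists A : {group gT},
    [/\ Y \subset A, A \subset H, abelian A & #|H : A| <= (n ^ n) ^ 2].
Proof.
move=> nsYH largeY nilHY; have [sYH nYH] := andP nsYH.
have abY := faithful_large_primes_abelian sYH largeY.
pose H1 := 'C_H(Y)%G.
have sYH1 : Y \subset H1 by rewrite subsetI sYH.
have nsYH1 : Y <| H1 := normalS sYH1 (subsetIl _ _) nsYH.
have sYZ : Y \subset 'Z(H1) by rewrite subsetI sYH1 centsC subsetIr.
have nilH1 : nilpotent H1.
  rewrite -quotient_center_nil -(isog_nil (third_isog sYZ nsYH1 (center_normal _))).
  by rewrite quotient_nil // (nilpotentS _ nilHY) // quotientS ?subsetIl.
have [A [nsA abA sCA]] := nilpotent_self_centralising nilH1.
have sAH1 := normal_sub nsA.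
exists A; split=> //.
- apply: subset_trans sCA; rewrite subsetI sYH1 centsC (subset_trans sAH1) //.
  exact: subsetIr.
- exact: subset_trans sAH1 (subsetIl _ _).
rewrite -(Lagrange_index (subsetIl H 'C(Y)) sAH1) expnS expn1 leq_mul //.
  exact: faithful_index_cent.
apply: leq_trans (faithful_index_cent (subsetIl H 'C(Y)) nsA abA).
by apply: dvdn_leq; [apply: indexg_gt0 | apply: indexgS].
Qed.

End FaithfulLinear.

(** By coprime action, fixed points of [y] lift from each factor [U i.+1 / U i], on which [y] acts
    trivially. Going up the chain, [S] is the product of ['C_S(<[y]>)] and ['Phi(S)], hence equals
    the former. *)
Lemma coprime_stable_cent_Phi (gT : finGroupType) (p m : nat)
    (S : {group gT}) (U : nat -> {group gT}) y :
  p.-group S -> p^'.-elt y -> U 0%N \subset 'Phi(S) -> S \subset U m ->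
  (forall i, i <= m -> [/\ U i \subset S, S \subset 'N(U i) & y \in 'N(U i)]) ->
  (forall i, i < m -> [~: U i.+1, <[y]>] \subset U i) ->
  y \in 'C(S).
Proof.
move=> pS p'y U0 sSU US cU.
have coSA : coprime #|S| #|<[y]>| by apply: pnat_coprime pS p'y.
have sUC k : k <= m -> U k \subset 'C_S(<[y]>) * 'Phi(S).
  elim: k => [|k IHk] lekm.
    by apply: subset_trans U0 _; apply: mulG_subr.
  have [sUS nUS nUy] := US k (ltnW lekm); have [sU1S _ nU1y] := US k.+1 lekm.
  have nUA : <[y]> \subset 'N(U k) by rewrite cycle_subG.
  have sU1C : U k.+1 / U k \subset 'C_S(<[y]>) / U k.
    rewrite (coprime_quotient_cent sUS nUA coSA (pgroup_sol pS)).
    rewrite subsetI quotientS //= quotient_cents2 ?cU //.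
    exact: subset_trans sU1S nUS.
  have sU1 : U k.+1 \subset U k * 'C_S(<[y]>).
    rewrite -quotientSK //; exact: subset_trans sU1S nUS.
  apply: subset_trans sU1 _; apply: subset_trans (mulSg _ (IHk (ltnW lekm))) _.
  have nPhiC : 'C_S(<[y]>) \subset 'N('Phi(S)).
    by rewrite (subset_trans (subsetIl _ _)) ?gFnorm.
  by rewrite -mulgA -(normC nPhiC) mulgA mulGid.
have defS : 'C_S(<[y]>) = S.
  rewrite -[LHS]genGid; apply: Phi_nongen; apply/eqP.
  rewrite eqEsubset join_subG Phi_sub subsetIl /=.
  apply: subset_trans sSU _; apply: subset_trans (sUC m (leqnn m)) _.
  by rewrite mul_subG ?joing_subl ?joing_subr.
by rewrite -cycle_subG centsC -{1}defS subsetIr.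
Qed.

Lemma leq_exp_self n r : n <= r -> n ^ n <= r ^ r.
Proof.
case: r => [|r]; first by rewrite leqn0 => /eqP->.
move=> le_nr; apply: leq_trans (leq_pexp2l _ le_nr); rewrite ?leq_exp2r' //.
by case: n le_nr => // n; rewrite leq_exp2r.
Qed.

(** The quotient [N / 'C_N(V)] acts faithfully on [V], of dimension at most [r] over the prime
    field, and has order prime to [p]. Scalars are extended to an algebraic closure, where weights
    are available; [A] is the preimage of the abelian subgroup found there. *)
Lemma abelem_action_abelian (gT : finGroupType) (p r : nat)
    (N V Y : {group gT}) :
  prime p -> p.-abelem V -> V <| N -> #|V| <= p ^ r -> Y <| N ->
  p^'.-nat #|N : 'C_N(V)| ->
  (forall q, prime q -> q %| #|Y| -> r < q) -> nilpotent (N / Y) ->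
  exists A : {group gT}, [/\ Y \subset A, A \subset N,
    A^`(1) \subset 'C(V) & #|N : A| <= (r ^ r) ^ 2].
Proof.
move=> p_pr abV nsVN oV nsYN p'NC largeY nilNY.
have [V1|ntV] := eqVneq (V : {set gT}) 1.
  exists N; rewrite indexgg V1 cents1 normal_sub //; split=> //.
  by rewrite expn_gt0 expn_gt0; case: r {oV largeY}.
have nVN := normal_norm nsVN; pose rV := abelem_repr abV ntV nVN.
have [K [FtoK _]] := countable_algebraic_closure 'F_p.
pose rK := map_repr FtoK (kquo_repr rV).
have injK : mx_faithful rK by rewrite map_mx_faithful kquo_mx_faithful.
have dimr : 'dim V <= r.
  rewrite (dim_abelemE abV ntV) -(leq_exp2l _ _ (prime_gt1 p_pr)).
  by rewrite -(card_pgroup (abelem_pgroup abV)).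
pose C := rker_group rV; have defC : C = 'C_N(V) :> {set gT} := rker_abelem _ _ _.
have nsCN : C <| N by apply: rker_normal.
have [sCN nCN] := andP nsCN.
have F'H : [pchar K]%R^'.-group (N / C).
  rewrite (eq_pgroup _ (eq_negn (fmorph_pchar FtoK))).
  rewrite (eq_pgroup _ (eq_negn (pcharf_eq (pchar_Fp p_pr)))).
  by rewrite /pgroup card_quotient // defC.
have nsYC : Y / C <| N / C by apply: quotient_normal.
have largeYC q : prime q -> q %| #|Y / C| -> 'dim V < q.
  move=> pr_q q_dvd; apply: leq_ltn_trans dimr _; apply: largeY pr_q _.
  exact: dvdn_trans q_dvd (dvdn_quotient _ _).
have nCY := subset_trans (normal_sub nsYN) nCN.
have nsYCN : Y <*> C <| N by rewrite normalY.
have nilq : nilpotent ((N / C) / (Y / C)).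
  rewrite -(quotientYidr nCY) (isog_nil (third_isog (joing_subr _ _) nsCN nsYCN)).
  rewrite -(isog_nil (third_isog (joing_subl _ _) nsYN nsYCN)).
  exact: quotient_nil.
have [Ab [sYA sAN abA idxA]] := faithful_abelian_index F'H injK nsYC largeYC nilq.
have [A defA sCA sA] := inv_quotientS nsCN sAN.
have nCA := subset_trans sA nCN.
exists A; split=> //.
- by move: sYA; rewrite defA quotientSGK.
- apply: subset_trans (subsetIr N _); rewrite -defC.
  by apply: der1_min; rewrite -?defA.
rewrite -(index_quotient_eq _ sA nCN) -?defA.
  by apply: leq_trans idxA _; rewrite leq_exp2r // leq_exp_self.
by rewrite subIset ?sCA ?orbT.
Qed.

(** * Sylow normalisers *)

Section SylowNormaliser.

Variables (gT : finGroupType) (p r m : nat) (X0 X O S : {group gT}).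
Variable (W : nat -> {group gT}).
Hypotheses (p_pr : prime p) (nsO : O <| X0) (sylS : p.-Sylow(X0) S).
Hypotheses (sSO : S \subset O) (largeO : forall q, prime q -> q %| #|O| -> r < q).
Hypotheses (nilO : nilpotent (X0 / O)) (sX : X \subset X0).
Hypothesis indX : forall Z : {group gT}, O \subset Z -> Z \subset X0 ->
  #|X0 : Z| <= (r ^ r) ^ 2 -> X \subset Z.
Hypotheses (W0 : W 0%N \subset 'Phi(S)) (Wm : S \subset W m).
Hypothesis WS : forall i, i <= m -> W i \subset S /\ 'N_X0(S) \subset 'N(W i).
Hypothesis idxW : forall i, i < m ->
  W i \subset W i.+1 /\ #|W i.+1 : W i| <= p ^ r.

Let N := 'N_X0(S)%G.
(** Joining ['Phi(S)] makes the factors elementary abelian and does not increase the indices between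
    consecutive terms. *)
Let U i := (W i <*> 'Phi(S))%G.

Let sSX : S \subset X0. Proof. by case/and3P: sylS. Qed.
Let pS : p.-group S. Proof. by case/and3P: sylS. Qed.
Let sSN : S \subset N. Proof. by rewrite subsetI sSX normG. Qed.
Let nSN : N \subset 'N(S). Proof. exact: subsetIr. Qed.

Let US i : i <= m -> U i \subset S /\ N \subset 'N(U i).
Proof.
case/WS=> sWS nWN; split; first by rewrite join_subG sWS Phi_sub.
by rewrite normsY // (subset_trans nSN) // char_norms ?Phi_char.
Qed.

(** Since [S] acts trivially on the factor, [N] acts through a p'-group. This gives a subgroup [A]
    of bounded index in [N] that contains [N :&: O] and has trivially acting derived group. By the
    Frattini argument [X0 = O * N], so [A <*> O] satisfies the same index bound in [X0] and contains
    [X]. Dedekind's law then puts ['N_X(S)] inside [A]. *)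
Lemma der_Sylow_normaliser_step i :
  i < m -> [~: U i.+1, 'N_X(S)^`(1)] \subset U i.
Proof.
move=> lt_im; have [sUS nUN] := US (ltnW lt_im); have [sU1S nU1N] := US lt_im.
have [sWW idx] := idxW lt_im.
have nUS := subset_trans sSN nUN.
have sUU : U i \subset U i.+1 by rewrite /= genS // setSU.
have nsUN : U i <| N by rewrite /normal (subset_trans sUS).
have nUU := subset_trans sU1S nUS.
have abS : p.-abelem (S / U i).
  rewrite -(trivg_Phi (quotient_pgroup _ pS)) -(quotient_Phi pS nUS).
  by rewrite -subG1 quotient_sub1 ?joing_subr // (subset_trans (Phi_sub S)).
have abV : p.-abelem (U i.+1 / U i) := abelemS (quotientS _ sU1S) abS.
have nsVN : U i.+1 / U i <| N / U i.
  by rewrite quotient_normal // /normal (subset_trans sU1S).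
have oV : #|U i.+1 / U i| <= p ^ r.
  apply: leq_trans idx; rewrite card_quotient //.
  have -> : #|U i.+1 : U i| = #|W i.+1 : U i|.
    have nUW : W i.+1 \subset 'N(U i) by apply: subset_trans nUU; apply: joing_subl.
    rewrite -!card_quotient //; congr #|(_ : {set _})|.
    apply/eqP; rewrite eqEsubset; apply/andP; split; last by rewrite quotientS ?joing_subl.
    rewrite quotientY ?(subset_trans (Phi_sub S)) // join_subG subxx /=.
    have -> : 'Phi(S) / U i = 1; last exact: sub1G.
    by apply/trivgP; rewrite quotient_sub1 ?joing_subr // (subset_trans (Phi_sub S)).
  rewrite -indexgI; apply: dvdn_leq; first exact: indexg_gt0.
  by apply: indexgS; rewrite subsetI sWW joing_subl.
pose Y := (N :&: O)%G.
have sUY : U i \subset Y by rewrite subsetI (subset_trans sUS) //= (subset_trans sUS).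
have nON : N \subset 'N(O) := subset_trans (subsetIl _ _) (normal_norm nsO).
have nsYN : Y <| N by rewrite /normal subsetIl normsI ?normG.
have nsYUN : Y / U i <| N / U i by rewrite quotient_normal.
have p'NC : p^'.-nat #|N / U i : 'C_(N / U i)(U i.+1 / U i)|.
  have : p^'.-nat #|N / U i : S / U i|.
    have dv : #|N / U i : S / U i| %| #|N : S|.
      by apply: index_quotient; rewrite subIset ?nUN.
    apply: pnat_dvd dv _; by have /and3P[_ _] := pHall_subl sSN (subsetIl _ _) sylS.
  apply: pnat_dvd; apply: indexgS; rewrite subsetI quotientS //.
  by rewrite (subset_trans (abelem_abelian abS)) // centS // quotientS.
have largeY q : prime q -> q %| #|Y / U i| -> r < q.
  move=> pr_q q_dvd; apply: largeO => //; apply: dvdn_trans q_dvd _.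
  by apply: dvdn_trans (dvdn_quotient _ _) (cardSg (subsetIr _ _)).
have nilNY : nilpotent ((N / U i) / (Y / U i)).
  rewrite (isog_nil (third_isog sUY nsUN nsYN)) /= setIC.
  rewrite (isog_nil (second_isog nON)).
  by apply: nilpotentS nilO; rewrite quotientS ?subsetIl.
have [Ab [sYA sAN cA idxA]] :=
  abelem_action_abelian p_pr abV nsVN oV nsYUN p'NC largeY nilNY.
have [A defA sUA sA] := inv_quotientS nsUN sAN.
have nUA := subset_trans sA nUN.
have sYA' : Y \subset A.
  by move: sYA; rewrite defA quotientSGK // (subset_trans (normal_sub nsYN)).
have nOA := subset_trans sA nON.
pose Z := (A <*> O)%G.
have sZX : Z \subset X0.
  by rewrite join_subG (subset_trans sA) ?subsetIl // normal_sub.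
have sylSO : p.-Sylow(O) S := pHall_subl sSO (normal_sub nsO) sylS.
have defX0 : O * N = X0 := Frattini_arg nsO sylSO.
have idxZ : #|X0 : Z| <= (r ^ r) ^ 2.
  move: idxA; rewrite defA (index_quotient_eq _ sA nUN); last by rewrite subIset // sUA orbT.
  apply: leq_trans; apply: dvdn_leq; first exact: indexg_gt0.
  rewrite -(index_quotient_eq _ sZX (normal_norm nsO)); last first.
    by rewrite subIset // joing_subr orbT.
  rewrite quotientYidr //.
  have -> : X0 / O = N / O by rewrite -defX0 quotientMidl.
  by apply: index_quotient; rewrite subIset ?nON.
have sXZ := indX (joing_subr _ _) sZX idxZ.
have sDA : 'N_X(S) \subset A.
  have sNZ : 'N_X(S) \subset N :&: Z.
    by rewrite subsetI setSI //= (subset_trans (subsetIl _ _)).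
  apply: subset_trans sNZ _; rewrite setIC /= norm_joinEl // -group_modl //.
  by rewrite mul_subG // setIC.
have sD : 'N_X(S)^`(1) \subset A^`(1) := dergS 1 sDA.
have nUD := subset_trans (subset_trans (der_sub 1 _) sDA) nUA.
rewrite -quotient_cents2 //.
by rewrite centsC (subset_trans _ cA) // defA -quotient_der ?quotientS.
Qed.

Lemma der_Sylow_normaliser_cent y :
  y \in 'N_X(S)^`(1) -> p^'.-elt y -> y \in 'C(S).
Proof.
move=> Dy p'y; have Ny : y \in N.
  by have := subsetP (der_sub 1 _) y Dy; rewrite !inE => /andP[/(subsetP sX)->].
apply: (@coprime_stable_cent_Phi _ p m S U) => //.
- by rewrite join_subG W0 subxx.
- by rewrite (subset_trans Wm) ?joing_subl.
- move=> i /US[sUS nUN]; split=> //; first exact: subset_trans nUN.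
  exact: (subsetP nUN).
move=> i lt_im; apply: subset_trans (der_Sylow_normaliser_step lt_im).
by rewrite commgS // cycle_subG.
Qed.

End SylowNormaliser.

(** * Elements of the derived group in ['O_{p^', p}(X)] *)

Lemma p_nilpotent_der1 (gT : finGroupType) (p : nat) (C : {group gT}) :
  p^'.-group C^`(1) -> p_nilpotent p C.
Proof.
move=> p'C'; have sC'O : C^`(1) \subset 'O_p^'(C) by rewrite pcore_max ?der_normal.
have abC : abelian (C / 'O_p^'(C)) := sub_der1_abelian sC'O.
have := nilpotent_pcoreC p (abelian_nil abC).
rewrite trivg_pcore_quotient dprodg1 /p_nilpotent => defC.
by rewrite -[X in p.-group X]defC pcore_pgroup.
Qed.

(** It suffices that [y] centralises [T]. Indeed a Sylow p-subgroup of ['C_X(T)] lies in [T],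
    because [T] has p'-index, hence is central in ['C_X(T)]. By Burnside's criterion ['C_X(T)] is
    then p-nilpotent, and it is normal in [X]. *)
Lemma large_Sylow_der_sub (gT : finGroupType) (p q : nat) (X T : {group gT}) y :
  T <| X -> p^'.-nat #|X : T| ->
  (forall l, prime l -> l %| #|T| -> exists S : {group gT},
    [/\ l.-Sylow(X) S, S \subset 'O_q^'(X) &
        forall z, z \in 'N_X(S)^`(1) -> q.-elt z -> z \in 'C(S)]) ->
  y \in X^`(1) -> q.-elt y -> y \in 'O_{p^', p}(X).
Proof.
move=> nsTX p'XT SylT X'y qy.
have Xy := subsetP (der_sub 1 X) y X'y.
suff cTy : y \in 'C(T).
  have nsCX : 'C_X(T) <| X.
    by rewrite /normal subsetIl normsI ?normG // (subset_trans (normal_norm nsTX)) ?cent_norm.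
  have [P sylP] := Sylow_exists p 'C_X(T).
  have pnC : p_nilpotent p 'C_X(T).
    have [sPC pP _] := and3P sylP.
    have sPT : P \subset T.
      have nTP : P \subset 'N(T).
        by rewrite (subset_trans sPC) // (subset_trans (normal_sub nsCX)) ?normal_norm.
      rewrite -quotient_sub1 //; apply/trivgP/eqP; rewrite trivg_card1.
      have pPT : p.-group (P / T) := quotient_pgroup _ pP.
      apply/eqP; apply: (pnat_1 pPT); apply: pnat_dvd p'XT.
      rewrite -card_quotient ?normal_norm // cardSg // quotientS //.
      by rewrite (subset_trans sPC) ?subsetIl.
    have cPC : 'C_X(T) \subset 'C(P) by rewrite (subset_trans (subsetIr _ _)) ?centS.
    apply: p_nilpotent_der1; apply: (Sylow_central_der1 sylP).
      by rewrite /abelian (subset_trans sPC).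
    by rewrite (subset_trans (subsetIl _ _)).
  by apply: (subsetP (p_nilpotent_normal nsCX pnC)); rewrite inE Xy.
set B := 'O_q^'(X).
have nsBX : B <| X := pcore_normal _ _.
(* The Frattini argument gives [X = B * 'N_X(S)], so [y] lies in [B * D]. As [B] is a q'-group, a
   Sylow q-subgroup of [D] is one of [B * D] and contains a conjugate of [y], which centralises
   [S]. *)
have cSy l : prime l -> l %| #|T| -> exists2 S : {group gT}, l.-Sylow(X) S & y \in 'C(S).
  move=> pr_l l_dvd; have [S [sylS sSB cS]] := SylT l pr_l l_dvd.
  have sylSB : l.-Sylow(B) S := pHall_subl sSB (normal_sub nsBX) sylS.
  have defX : B * 'N_X(S) = X := Frattini_arg nsBX sylSB.
  pose D := ('N_X(S)^`(1))%G.
  have sDX : D \subset X := subset_trans (der_sub _ _) (subsetIl _ _).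
  have nBX := normal_norm nsBX; have nBD := subset_trans sDX nBX.
  have [Q sylQ] := Sylow_exists q D; have [sQD qQ q'DQ] := and3P sylQ.
  have defBD : B <*> D = B * D := norm_joinEr nBD.
  have sBDX : B <*> D \subset X by rewrite join_subG normal_sub.
  have yBD : y \in B <*> D.
    have sX'BD : X^`(1) \subset B * D.
      rewrite -quotientSK ?(subset_trans (der_sub _ _)) // !quotient_der //; last first.
        by rewrite (subset_trans (subsetIl _ _)).
      by rewrite -(quotientMidl _ 'N_X(S)) defX.
    by rewrite defBD (subsetP sX'BD).
  have sylQB : q.-Sylow(B <*> D) Q.
    rewrite /pHall (subset_trans sQD) ?joing_subr // qQ.
    rewrite -(Lagrange_index (joing_subr B D) sQD) pnatM q'DQ andbT.
    have -> : #|B <*> D : D| = #|B : D|.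
      have oBD : #|B <*> D| = (#|B : D| * #|D|)%N by rewrite defBD LagrangeMr.
      by rewrite -divgS ?joing_subr // [X in X %/ _]oBD mulnK ?cardG_gt0.
    by apply: pnat_dvd (dvdn_indexg _ _) (pcore_pgroup _ _).
  have sy : <[y]> \subset B <*> D by rewrite cycle_subG.
  have [x BDx] := Sylow_Jsub sylQB sy qy.
  rewrite -cycleJ cycle_subG => Qyx.
  have Xx := subsetP sBDX x BDx.
  exists (S :^ x^-1)%G; first by rewrite /= pHallJ ?groupV.
  have : y ^ x \in 'C(S) by apply: cS; rewrite ?p_eltJ // (subsetP sQD).
  by rewrite /= centJ mem_conjgV.
(* As [y] centralises a Sylow l-subgroup of [T] for each prime [l], no prime divides the index of
   ['C_T[y]] in [T]. *)
rewrite -sub_cent1; apply/setIidPl/eqP; rewrite eqEsubset subsetIl /=.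
rewrite -indexg_eq1 eqn_leq indexg_gt0 andbT leqNgt.
apply/negP=> /pdivP[l pr_l l_dvd].
have l_dvdT : l %| #|T| := dvdn_trans l_dvd (dvdn_indexg _ _).
have [S sylS cS] := cSy l pr_l l_dvdT.
have /and3P[_ _ l'TS] := Sylow_setI_normal nsTX sylS.
have : l^'.-nat #|T : 'C_T[y]|.
  apply: pnat_dvd l'TS; apply: indexgS; rewrite setIS //.
  by rewrite sub_cent1.
by rewrite p'natE // l_dvd.
Qed.

(** Modulo ['O_{p^', p}(X)], which contains ['F(X)], the element [y] equals some [d] of the derived
    group. Its image is a q-element, hence equals the image of the q-constituent of [d], and that is
    trivial by assumption. *)
Lemma der_Fitting_pcore2 (gT : finGroupType) (X : {group gT}) p q k y :
  prime p -> prime q ->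
  (forall d, d \in X^`(1) -> q.-elt d -> d \in 'O_{p^', p}(X)) ->
  y \in X^`(1) <*> 'F(X) -> y ^+ (q ^ k)%N \in 'O_{p^', p}(X) -> y \in 'O_{p^', p}(X).
Proof.
move=> p_pr q_pr derO; have nO : X \subset 'N('O_{p^', p}(X)) := gFnorm _ _.
have nX' : X^`(1) \subset 'N('F(X)).
  exact: subset_trans (der_sub 1 X) (gFnorm _ _).
rewrite norm_joinEl // => /mulsgP[d u Xd Fu ->]; have [Xu Ou] := proj1 (Fitting_pcore2 _ _) Fu.
have Nd : d \in 'N('O_{p^', p}(X)).
  by apply: (subsetP nO); exact: (subsetP (der_sub 1 X)).
have Nu : u \in 'N('O_{p^', p}(X)) by exact: (subsetP nO).
move=> /coset_id; rewrite groupMr ?Ou // morphX ?groupM // morphM //=.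
have -> : coset 'O_{p^', p}(X) u = 1 by apply: coset_id; exact: Ou.
rewrite mulg1 => z1; apply: coset_idr => //.
have qz : q.-elt (coset 'O_{p^', p}(X) d).
  by apply: (@pnat_dvd _ (q ^ k)%N); rewrite ?order_dvdn ?z1 // pnatX pnat_id.
rewrite -(constt_p_elt qz) -morph_constt //=; apply: coset_id.
by apply: derO; [exact: groupX | exact: p_elt_constt].
Qed.

From mathcomp Require Import boolp classical_sets functions cardinality.
From mathcomp Require Import filter constructive_ereal topology.

Local Open Scope classical_set_scope.
Local Open Scope group_scope.
Local Open Scope card_scope.

(** * Clopen neighbourhoods *)

Section ZeroDimensional.

Variable T : topologicalType.
Hypotheses (cptT : compact [set: T]) (hT : hausdorff_space T).
Implicit Types (x y : T) (A B C D : set T).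

Let clopen_at x := [set D : set T | D x /\ clopen D].

Let clopen_filter x : ProperFilter (filter_from (clopen_at x) id).
Proof.
apply: filter_from_proper; last by move=> D [Dx _]; exists x.
apply: filter_from_filter; first by exists setT; split => //; exact: clopenT.
by move=> A B [? ?] [? ?]; exists (A `&` B) => //; split=> //; exact: clopenI.
Qed.

(** Finitely many complements of clopen neighbourhoods of [x] cover the compact set [A]. The filter
    generated by the clopen neighbourhoods accounts for their finite intersections. *)
Lemma closed_clopen_separation x A :
  closed A -> (forall y, A y -> exists C, [/\ clopen C, C x & ~ C y]) ->
  exists C, [/\ clopen C, C x & A `<=` ~` C].
Proof.
move=> clA sep; have /compact_near_coveringP : compact A.
  exact: (subclosed_compact clA cptT).
have FF := clopen_filter x.
move=> /(_ _ _ setC (powerset_filter_from_filter FF))[].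
  move=> y Ay; have [C [[oC cC] Cx Cy]] := sep y Ay.
  exists (~` C, [set U | U `<=` C]); first split.
  - by apply: open_nbhs_nbhs; split => //; exact: closed_openC.
  - apply/near_powerset_filter_fromP; first by move=> ? ?; exact: subset_trans.
    by exists C => //; exists C.
  - by case=> i j [? /subsetC]; apply.
move=> D [DF _ [C DC]]/(_ _ DC) ADC.
by have [E [Ex cE] EC] := DF _ DC; exists E; split=> // y /ADC Cy /EC.
Qed.

Definition quasi_component x := \bigcap_(D in clopen_at x) D.

(** Normality gives an open [W0] around [A] whose closure misses [B]. The boundary of [W0] misses
    the quasi-component, so some clopen neighbourhood [C] of [x] misses this boundary. Then [W0]
    cuts [C] in a clopen set disjoint from [B]. *)
Lemma quasi_component_split x A B :
  closed A -> closed B -> A `&` B = set0 -> quasi_component x `<=` A `|` B ->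
  A x -> quasi_component x `<=` A.
Proof.
move=> clA clB AB0 QAB Ax.
have : set_nbhs A (~` B).
  apply/set_nbhsP; exists (~` B); split=> //; first exact: closed_openC.
  by apply/disjoints_subset.
case/(compact_normal hT cptT clA) => W /set_nbhsP[W0 [oW0 AW0 W0W]] cWB.
pose K := closure W0 `\` W0.
have [|y [cWy nWy]|C [[oC cC] Cx KC]] := @closed_clopen_separation x K.
- by apply: closedI; [exact: closed_closure | exact: open_closedC].
- have nQy : ~ quasi_component x y.
    move=> /QAB[/AW0 //|By]; apply: (cWB y) => //.
    by apply: closureS cWy.
  by move/existsNP : nQy => [C /not_implyP[[Cx cC] nCy]]; exists C.
have defD : C `&` W0 = C `&` closure W0.
  rewrite eqEsubset; split; first by apply: setIS; exact: subset_closure.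
  move=> y [Cy cWy]; split=> //; apply: contrapT => nWy.
  by have := KC y; apply.
have : clopen_at x (C `&` W0).
  split; first by split=> //; apply: AW0.
  split; first exact: openI.
  by rewrite defD; apply: closedI => //; exact: closed_closure.
move=> cD y Qy; have [_ W0y] := Qy _ cD; case: (QAB y Qy) => // By.
by exfalso; apply: (cWB y) => //; apply: subset_closure; exact: W0W.
Qed.

(** By [quasi_component_split], quasi-components of a compact Hausdorff space are connected, so here
    they are points. *)
Lemma totally_disconnected_zero_dimensional :
  totally_disconnected [set: T] -> zero_dimensional T.
Proof.
move=> tdT x y xy; apply: contrapT => nsep.
have Qx : quasi_component x x by move=> D [].
have Qy : quasi_component x y.
  by move=> D [Dx cD]; apply: contrapT => nDy; apply: nsep; exists D.
have clQ : closed (quasi_component x).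
  by apply: closed_bigI => D [_ []].
suff cQ : connected (quasi_component x).
  have : connected_component [set: T] x y by exists (quasi_component x).
  by rewrite tdT //= => yx; move: xy; rewrite yx eqxx.
move=> B [b Bb] [C1 oC1 defB1] [C2 cC2 defB2].
have clB : closed B by rewrite defB2; exact: closedI.
pose A := quasi_component x `&` ~` C1.
have clA : closed A by apply: closedI => //; exact: open_closedC.
have BA0 : B `&` A = set0.
  by rewrite -subset0 => z [+ [_ nC1]]; rewrite defB1 => -[_].
have QBA : quasi_component x `<=` B `|` A.
  move=> z Qz; have [C1z|nC1z] := pselect (C1 z); last by right.
  by left; rewrite defB1.
have BQ : B `<=` quasi_component x by rewrite defB1; exact: subIsetl.
rewrite eqEsubset; split=> //.
have [Bx|nBx] := pselect (B x); first exact: (quasi_component_split clB clA BA0 QBA).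
have Ax : A x by case: (QBA x Qx).
have QA : quasi_component x `<=` A.
  by apply: (quasi_component_split clA clB); rewrite 1?setIC 1?setUC.
exfalso; suff : set0 b by []; rewrite -BA0; split; [exact: Bb | exact: (QA _ (BQ _ Bb))].
Qed.

End ZeroDimensional.

Lemma clopen_base (T : topologicalType) (x : T) (U : set T) :
  compact [set: T] -> hausdorff_space T -> totally_disconnected [set: T] ->
  nbhs x U -> exists C, [/\ clopen C, C x & C `<=` U].
Proof.
move=> cptT hT tdT Ux.
have zT := totally_disconnected_zero_dimensional cptT hT tdT.
by have [C [Cx cC] CU] := zero_dimensional_cvg hT zT cptT Ux; exists C.
Qed.

(** * Topological groups *)

Section Subgroups.

Variable G : groupType.
Implicit Types (H N U : set G) (x y : G).

Lemma subgroup1 H : subgroup H -> H 1. Proof. by case. Qed.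

Lemma subgroupV H x : subgroup H -> H x -> H x^-1.
Proof. by case=> H1 HB Hx; rewrite -[x^-1]mul1g; exact: HB. Qed.

Lemma subgroupM H x y : subgroup H -> H x -> H y -> H (x * y).
Proof.
by move=> gH Hx Hy; rewrite -[y]invgK; case: (gH) => _ HB; apply: HB => //; exact: subgroupV.
Qed.

Lemma subgroupX H x n : subgroup H -> H x -> H (x ^+ n).
Proof.
move=> gH Hx; elim: n => [|n IHn]; first by rewrite expg0; exact: subgroup1.
by rewrite expgS; exact: subgroupM.
Qed.

Lemma subgroupI H N : subgroup H -> subgroup N -> subgroup (H `&` N).
Proof.
move=> [H1 HB] [N1 NB]; split=> // x y [Hx Nx] [Hy Ny].
by split; [exact: HB | exact: NB].
Qed.

Lemma subgroupT : subgroup [set: G]. Proof. by []. Qed.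

Lemma subgroupJ H x y : subgroup H -> H x -> H y -> H (x ^ y).
Proof. by move=> gH Hx Hy; rewrite conjgE; do 2?apply: subgroupM => //; exact: subgroupV. Qed.

End Subgroups.

Section TopologicalGroups.

Variable G : topologicalGroupType.
Implicit Types (H U V : set G) (x y : G).

Lemma cvgMg (T : Type) (F : set_system T) (FF : Filter F) (f g : T -> G) a b :
  f @ F --> a -> g @ F --> b -> (fun z => f z * g z) @ F --> a * b.
Proof.
move=> fa gb; apply: (@continuous2_cvg T G G G F FF f g (fun x y : G => x * y) a b _ fa gb).
exact: (@mulg_continuous G (a, b)).
Qed.

Lemma cvgVg (T : Type) (F : set_system T) (FF : Filter F) (f : T -> G) a :
  f @ F --> a -> (fun z => (f z)^-1) @ F --> a^-1.
Proof. by move=> fa; apply: (cvg_comp f (fun u : G => u^-1) fa); exact: invg_continuous. Qed.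

Lemma conjg_cvg (x g : G) : (fun z : G * G => z.2 ^ z.1) @ (x, g) --> g ^ x.
Proof.
rewrite (_ : (fun z : G * G => z.2 ^ z.1) = (fun z => z.1^-1 * (z.2 * z.1))); last first.
  by apply/funext=> z; rewrite conjgE.
rewrite conjgE.
apply: cvgMg; first by apply: cvgVg; exact: cvg_fst.
by apply: cvgMg; [exact: cvg_snd | exact: cvg_fst].
Qed.

Lemma mulgr_continuous y : continuous (fun x => x * y).
Proof. by move=> x; apply: cvgMg; [exact: cvg_id | exact: cvg_cst]. Qed.

Lemma mulgl_continuous y : continuous (fun x => y * x).
Proof. by move=> x; apply: cvgMg; [exact: cvg_cst | exact: cvg_id]. Qed.

Lemma conjg_continuous y : continuous (fun x => x ^ y).
Proof.
move=> x; rewrite (_ : (fun x : G => x ^ y) = (fun z => y^-1 * (z * y))); last first.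
  by apply/funext=> z; rewrite conjgE.
by apply: cvgMg; [exact: cvg_cst | exact: mulgr_continuous].
Qed.

Lemma subgroup_open H : subgroup H -> nbhs 1 H -> open H.
Proof.
move=> gH H1; rewrite openE => x Hx; rewrite /interior.
have : nbhs (x^-1 * x) H by rewrite mulVg.
move/(@mulgl_continuous x^-1 x); rewrite nbhs_simpl /=.
apply: filterS => y /= Hxy; rewrite -[y](mulVKg x).
by apply: subgroupM => //; rewrite mulVKg.
Qed.

(** The right stabiliser [H] of a clopen neighbourhood [C] of 1 is a subgroup inside [C], open
    because [C] is compact. Its normal core [V] is open because [G] is compact. *)
Lemma open_normal_base U : profinite G -> nbhs 1 U ->
  exists V, [/\ normal_subgroup V [set: G], open V & V `<=` U].
Proof.
case=> cptG hG tdG /(clopen_base cptG hG tdG)[C [[oC cC] C1 CU]].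
pose H := [set g | forall c, C c <-> C (c * g)].
have gH : subgroup H.
  split=> [c|x y Hx Hy c]; first by rewrite mulg1.
  rewrite (Hx c) (Hy (c * (x * y^-1))); by rewrite -!mulgA mulVg mulg1.
have nH : nbhs 1 H.
  have cptC : compact C := subclosed_compact cC cptG (@subsetT _ _).
  move/compact_near_coveringP : cptC => /(_ _ (nbhs (1 : G)) (fun g c => C (c * g)) _) covC.
  have nC : \forall g \near nbhs (1 : G), C `<=` (fun c => C (c * g)).
    apply: covC => c Cc.
    have : nbhs (c * 1) C by rewrite mulg1; apply: open_nbhs_nbhs.
    by move/(@mulg_continuous G (c, 1)).
  have nCV : nbhs (1 : G) [set g | forall c, C c -> C (c * g^-1)].
    have : nbhs (1^-1 : G) [set g | forall c, C c -> C (c * g)] by rewrite invg1.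
    by move/(@invg_continuous G).
  apply: filterS2 nC nCV => g Cg CgV c; split=> [/Cg //|/CgV].
  by rewrite mulgK.
have sHC : H `<=` C by move=> h /(_ 1); rewrite mul1g => -[/(_ C1)].
pose V := [set g | forall x, H (g ^ x)].
have nV : nbhs 1 V.
  move/compact_near_coveringP : cptG => /(_ _ (nbhs (1 : G)) (fun g x => H (g ^ x)) _) covG.
  have : \forall g \near nbhs (1 : G), [set: G] `<=` (fun x => H (g ^ x)).
    apply: covG => x _.
    have : nbhs (1 ^ x) H by rewrite conj1g.
    by move/(@conjg_cvg x 1).
  by apply: filterS => g Hg x; apply: Hg.
have gV : subgroup V.
  split=> [x|x y Vx Vy z]; first by rewrite conj1g; exact: subgroup1.
  by rewrite conjMg conjVg; case: (gH) => _; apply; [exact: Vx | exact: Vy].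
exists V; split.
- by split=> // x y _ Vy z; rewrite -conjgM; exact: Vy.
- exact: subgroup_open.
- by move=> x Vx; apply/CU/sHC; have := Vx 1; rewrite conjg1.
Qed.

End TopologicalGroups.

(** * Finite quotients *)

Section FiniteQuotients.

Variable G : topologicalGroupType.
Implicit Types (H L U V : set G) (x y : G) (gT : finGroupType).

(** The second clause amounts to continuity for the discrete topology on [gT], by [fhom_open]. *)
Definition fhom gT (f : G -> gT) : Prop :=
  (forall x y, f (x * y) = f x * f y) /\ open (f @^-1` [set 1]).

(* The generated subgroup makes [fimage f H] a group without hypotheses; when [f]
   and [H] are well-behaved it is just the image, see [fimageP]. *)
Definition fimage gT (f : G -> gT) H : {group gT} :=
  <<finset (fun y : gT => `[< exists2 x, H x & f x = y >])>>%G.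

Section Morphism.

Variables (gT : finGroupType) (f : G -> gT).
Hypothesis fh : fhom f.

Lemma fhomM x y : f (x * y) = f x * f y. Proof. exact: fh.1. Qed.

Lemma fhom1 : f 1 = 1.
Proof. by apply: (mulgI (f 1)); rewrite -fhomM !mulg1. Qed.

Lemma fhomV x : f x^-1 = (f x)^-1.
Proof. by apply: (mulgI (f x)); rewrite -fhomM !mulgV fhom1. Qed.

Lemma fhomX x n : f (x ^+ n) = f x ^+ n.
Proof. by elim: n => [|n IHn]; rewrite ?expg0 ?fhom1 // !expgS fhomM IHn. Qed.

Lemma fhomJ x y : f (x ^ y) = f x ^ f y.
Proof. by rewrite !conjgE !fhomM fhomV. Qed.

Lemma mem_fimage H x : H x -> f x \in fimage f H.
Proof. by move=> Hx; apply: mem_gen; rewrite inE; apply/asboolP; exists x. Qed.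

Lemma fimageP H (y : gT) : subgroup H -> reflect (exists2 x, H x & f x = y) (y \in fimage f H).
Proof.
move=> gH; apply: (iffP idP) => [|[x Hx <-]]; last exact: mem_fimage.
rewrite /fimage /= gen_set_id; first by rewrite inE => /asboolP.
apply/group_setP; split=> [|u v].
  by rewrite inE; apply/asboolP; exists 1; [exact: subgroup1 | exact: fhom1].
rewrite !inE => -[a Ha <-] [b Hb <-].
by exists (a * b); [exact: subgroupM | exact: fhomM].
Qed.

Lemma fimageS H L : H `<=` L -> fimage f H \subset fimage f L.
Proof.
move=> sHL; apply: genS; apply/fintype.subsetP=> y; rewrite !inE => -[x Hx <-].
by exists x => //; exact: sHL.
Qed.

Lemma fimage_normal H L : subgroup L -> normal_subgroup H L -> fimage f H <| fimage f L.
Proof.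
move=> gL [gH sHL nHL]; rewrite /normal fimageS //=.
apply/fintype.subsetP=> _ /(fimageP _ gL)[y Ly <-].
rewrite inE; apply/fintype.subsetP=> _ /imsetP[_ /(fimageP _ gH)[x Hx <-] ->].
by rewrite -fhomJ mem_fimage //; exact: nHL.
Qed.

Lemma fhom_open (P : set gT) : open (f @^-1` P).
Proof.
rewrite openE => x Px; rewrite /interior.
have : nbhs (x^-1 * x) (f @^-1` [set 1]).
  by rewrite mulVg; apply: open_nbhs_nbhs; split; [exact: fh.2 | exact: fhom1].
move/(@mulgl_continuous G x^-1 x) => nb.
have {nb} : nbhs x [set y | f (x^-1 * y) = 1] := nb.
apply: filterS => y /= fxy; suff -> : f y = f x by [].
by apply: (mulgI (f x^-1)); rewrite -!fhomM fxy mulVg fhom1.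
Qed.

Lemma fhom_closed (P : set gT) : closed (f @^-1` P).
Proof.
by rewrite -[f @^-1` P]setCK preimage_setC; apply: open_closedC; exact: fhom_open.
Qed.

Lemma fhom_subgroup (B : {group gT}) : subgroup (f @^-1` [set` B]).
Proof.
split=> [|x y /= Bx By]; first by rewrite /= fhom1 group1.
by rewrite fhomM fhomV groupM ?groupV.
Qed.

End Morphism.

Lemma fhom_pair gT1 gT2 (f1 : G -> gT1) (f2 : G -> gT2) :
  fhom f1 -> fhom f2 -> fhom (fun x => (f1 x, f2 x)).
Proof.
move=> h1 h2; split=> [x y|]; first by rewrite (fhomM h1) (fhomM h2).
have -> : (fun x => (f1 x, f2 x)) @^-1` [set 1] = f1 @^-1` [set 1] `&` f2 @^-1` [set 1].
  by apply/seteqP; split=> x /=; [case | case=> -> ->].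
by apply: openI; [exact: h1.2 | exact: h2.2].
Qed.

(** Here [c] numbers the right cosets of [U] and [r] picks representatives, so that [n] is the index
    of [U]. *)
Definition coset_system U n (c : G -> 'I_n) (r : 'I_n -> G) : Prop :=
  cancel r c /\ forall x y, c x = c y <-> U (x * y^-1).

Lemma coset_system_exists U :
  compact [set: G] -> subgroup U -> open U ->
  exists n (c : G -> 'I_n) r, coset_system U c r.
Proof.
move=> /compact_near_coveringP cptG gU oU.
(* Finite sequences are directed by inclusion of their sets of entries. Along this filter,
   compactness yields one sequence that meets every coset. *)
pose F : set_system (seq G) :=
  [set P | exists s0 : seq G, forall s : seq G, {subset s0 <= s} -> P s].
have FF : Filter F.
  split; first by exists [::].
    move=> P Q [s1 Ps1] [s2 Ps2]; exists (s1 ++ s2) => s ss; split.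
      by apply: Ps1 => x xs; apply: ss; rewrite mem_cat xs.
    by apply: Ps2 => x xs; apply: ss; rewrite mem_cat xs orbT.
  by move=> P Q PQ [s0 Ps0]; exists s0 => s /Ps0/PQ.
have [|s /(_ s (fun _ => id)) covs] :=
    cptG _ F (fun s x => exists2 d, d \in s & U (x * d^-1)) FF.
  move=> x _; exists ([set y | U (y * x^-1)], [set s : seq G | x \in s]); last first.
    by case=> y s /= [Uy xs]; exists x.
  split=> /=; last by exists [:: x] => s; apply; rewrite mem_head.
  have : nbhs (x * x^-1) U.
    by rewrite mulgV; apply: open_nbhs_nbhs; split=> //; exact: subgroup1.
  exact: (@mulgr_continuous G x^-1 x).
pose e x := find (fun d => `[< U (x * d^-1) >]) s.
have es x : e x < size s.
  rewrite -has_find; have [d sd Ux] := covs x I; apply/hasP; exists d => //.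
  exact/asboolP.
have eU x : U (x * (nth 1 s (e x))^-1).
  by have := es x; rewrite -has_find => /(nth_find 1)/asboolP.
have eqe x y : U (x * y^-1) -> e x = e y.
  move=> Uxy; apply: eq_find => d; apply: asbool_equiv_eq; split=> Ud.
    rewrite (_ : y * d^-1 = (x * y^-1)^-1 * (x * d^-1)); last first.
      by rewrite invMg invgK !mulgA mulgKV.
    by apply: subgroupM => //; exact: subgroupV.
  rewrite (_ : x * d^-1 = (x * y^-1) * (y * d^-1)); last by rewrite !mulgA mulgKV.
  exact: subgroupM.
pose e' x : 'I_(size s) := Ordinal (es x).
(* Several entries of [s] may lie in one coset; only the first of each is kept. *)
pose P := [pred i : 'I_(size s) | e' (nth 1 s i) == i].
have Pe x : P (e' x).
  apply/eqP/val_inj => /=; apply: eqe; rewrite -[_ * _]invgK.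
  by apply: subgroupV => //; rewrite invMg invgK; exact: eU.
pose T : finType := {i : 'I_(size s) | P i}.
exists #|T|, (fun x => enum_rank (exist _ (e' x) (Pe x) : T)).
exists (fun i : 'I_#|T| => nth 1 s (val (val (enum_val i : T)))); split.
  move=> i; apply: (canLR enum_valK); apply/val_inj.
  by have /eqP := valP (enum_val i).
move=> x y; split=> [/enum_rank_inj/(congr1 val)/(congr1 val) /= exy|Uxy].
  have := eU y; rewrite -exy => Uy.
  rewrite (_ : x * y^-1 = (x * (nth 1 s (e x))^-1) * (y * (nth 1 s (e x))^-1)^-1); last first.
    by rewrite invMg invgK !mulgA mulgKV.
  by case: (gU) => _; apply.
by congr enum_rank; apply/val_inj/val_inj => /=; exact: eqe.
Qed.

End FiniteQuotients.

(** * Permutation actions on cosets *)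

Section PermutationRepresentation.

Variable G : topologicalGroupType.
Implicit Types (H L U V : set G) (x y g : G).

(** Right multiplication permutes the cosets. The kernel is the intersection of finitely many
    conjugates of [U], hence open. *)
Lemma coset_action_exists U n (c : G -> 'I_n) r :
  subgroup U -> open U -> coset_system U c r ->
  exists phi : G -> 'S_n, [/\ fhom phi, forall g, phi g = 1 -> U g &
    normal_subgroup U [set: G] -> forall g, U g -> phi g = 1].
Proof.
move=> gU oU [rK cE].
have cr x g : c (r (c x) * g) = c (x * g).
  by apply/cE; rewrite invMg mulgA mulgK; apply/cE; rewrite rK.
have inj g : injective (fun i => c (r i * g)).
  by move=> i j /cE; rewrite invMg mulgA mulgK => /cE; rewrite !rK.
pose phi g := perm (inj g); exists phi.
have phiE g i : phi g i = c (r i * g) by rewrite permE.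
have phi_fix g i : phi g i = i <-> U (g ^ (r i)^-1).
  rewrite phiE -{2}(rK i) cE conjgE invgK mulgA //.
split.
- split=> [x y|]; first by apply/permP=> i; rewrite permM !phiE cr mulgA.
  have -> : phi @^-1` [set 1] = [set g | forall i, U (g ^ (r i)^-1)].
    apply/seteqP; split=> g /=.
      by move=> g1 i; apply/phi_fix; rewrite g1 perm1.
    by move=> Ug; apply/permP=> i; rewrite perm1; apply/phi_fix.
  rewrite openE => g Ug; rewrite /interior.
  apply: filter_forall => i.
  have : nbhs (g ^ (r i)^-1) U by apply: open_nbhs_nbhs; split=> //; exact: Ug.
  exact: (@conjg_continuous G (r i)^-1 g).
- move=> g g1; have /phi_fix : phi g (c 1) = c 1 by rewrite g1 perm1.
  have Ur : U (r (c 1)) by have := (cE (r (c 1)) 1).1 (rK _); rewrite invg1 mulg1.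
  by move=> Ugr; have := subgroupJ gU Ugr Ur; rewrite -conjgM mulVg conjg1.
- case=> _ _ nU g Ug; apply/permP=> i; rewrite perm1; apply/phi_fix; exact: nU.
Qed.

Lemma fhom_exists V :
  compact [set: G] -> normal_subgroup V [set: G] -> open V ->
  exists (gT : finGroupType) (f : G -> gT), fhom f /\ forall x, f x = 1 <-> V x.
Proof.
move=> cptG nV oV; have [gV _ _] := nV.
have [n [c [r cs]]] := coset_system_exists cptG gV oV.
have [phi [hphi phi1 phiV]] := coset_action_exists gV oV cs.
by exists _, phi; split=> // x; split; [exact: phi1 | exact: phiV].
Qed.

(** Some coset of an open normal subgroup [V] contains [x] and misses [H]; the map with kernel [V]
    separates them. *)
Lemma fhom_separates H x :
  profinite G -> closed_subgroup H -> ~ H x ->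
  exists (gT : finGroupType) (f : G -> gT), fhom f /\ f x \notin fimage f H.
Proof.
move=> pG [cH gH] nHx.
have n1 : nbhs 1 [set v | ~ H (x * v)].
  have : nbhs (x * 1) (~` H).
    by rewrite mulg1; apply: open_nbhs_nbhs; split=> //; exact: closed_openC.
  exact: (@mulgl_continuous G x 1).
have [V [nV oV VH]] := open_normal_base pG n1.
have [cptG _ _] := pG.
have [gT [f [fh fV]]] := fhom_exists cptG nV oV.
exists gT, f; split=> //; apply/negP=> /(fimageP fh _ gH)[h Hh fhx].
have /fV/VH : f (x^-1 * h) = 1 by rewrite (fhomM fh) (fhomV fh) fhx mulVg.
by rewrite /= mulVKg.
Qed.

Lemma fhom_open_kernel U :
  profinite G -> nbhs 1 U ->
  exists (gT : finGroupType) (f : G -> gT), fhom f /\ forall x, f x = 1 -> U x.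
Proof.
move=> pG /(open_normal_base pG)[V [nV oV VU]]; have [cptG _ _] := pG.
have [gT [f [fh fV]]] := fhom_exists cptG nV oV.
by exists gT, f; split=> // x /fV/VU.
Qed.

Lemma card_left_cosets U n (c : G -> 'I_n) r :
  subgroup U -> coset_system U c r -> left_cosets U #= `I_n.
Proof.
move=> gU [rK cE]; rewrite card_eq_sym; apply/card_set_bijP.
(* Inversion exchanges right and left cosets, whence the inverse of the representative. Indices from
   [n] on get a default value. *)
exists (fun k => if insub k is Some i then [set (r (i : 'I_n))^-1 * u | u in U] else set0).
split.
- by move=> k /= lt_kn; rewrite insubT; exists (r (Ordinal lt_kn))^-1.
- move=> k l; rewrite !inE /= => lt_k lt_l; rewrite !insubT /= => E.
  have : [set (r (Ordinal lt_l))^-1 * u | u in U] (r (Ordinal lt_k))^-1.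
    by rewrite -E; exists 1; rewrite ?mulg1 //; exact: subgroup1.
  case=> u Uu defu; have : c (r (Ordinal lt_k)) = c (r (Ordinal lt_l)).
    apply/cE; rewrite -[r (Ordinal lt_k)]invgK -defu invMg invgK mulgK.
    exact: subgroupV.
  by rewrite !rK => /(congr1 val).
- move=> _ [x _ <-]; exists (val (c x^-1)); first exact: ltn_ord.
  rewrite (valK (c x^-1)).
  have Ux : U (r (c x^-1) * x).
    by rewrite -[x]invgK; apply/cE; rewrite rK invgK.
  apply/seteqP; split=> _ [u Uu <-].
    exists ((r (c x^-1) * x)^-1 * u); first by apply: subgroupM => //; exact: subgroupV.
    by rewrite invMg !mulgA mulgV mul1g.
  exists (r (c x^-1) * x * u); first exact: subgroupM.
  by rewrite !mulgA mulVg mul1g.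
Qed.

Lemma card_fimage_index (gT : finGroupType) (f : G -> gT) (B : {group gT}) n
    (c : G -> 'I_n) r :
  fhom f -> B \subset fimage f setT -> coset_system (f @^-1` [set` B]) c r ->
  #|fimage f setT : B| = n.
Proof.
move=> fh sB [rK cE].
have -> : #|fimage f setT : B| = #|[set B :* f (r i) | i : 'I_n]|.
  apply: eq_card => C; apply/rcosetsP/imsetP.
    case=> y /(fimageP fh _ (@subgroupT G))[x _ <-] ->; exists (c x) => //.
    apply: rcoset_eqP; rewrite mem_rcoset -(fhomV fh) -(fhomM fh).
    by apply/(cE x (r (c x))); rewrite rK.
  by case=> i _ ->; exists (f (r i)) => //; exact: mem_fimage.
rewrite card_imset ?card_ord // => i j /rcoset_eqP.
rewrite mem_rcoset -(fhomV fh) -(fhomM fh) => Bij.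
by rewrite -(rK i) -(rK j); apply/cE.
Qed.

End PermutationRepresentation.

Lemma pro_p_exp (G : topologicalGroupType) (p : nat) (S U : set G) x :
  subgroup S -> pro_p p S -> normal_subgroup U S -> open (U : set (subspace S)) -> S x ->
  exists k, U (x ^+ (p ^ k)%N).
Proof.
move=> gS ppS nU oU Sx; have [Q [f [[fM _ fU] pQ]]] := ppS U nU oU.
have f1 : f 1 = 1.
  by apply: (mulgI (f 1)); rewrite -fM ?mulg1 //; exact: subgroup1.
have fX n : f (x ^+ n) = f x ^+ n.
  elim: n => [|n IHn]; first by rewrite !expg0.
  by rewrite !expgS fM ?IHn //; exact: subgroupX.
have [k oQ] := p_natP pQ; exists k; rewrite -fU; split; first exact: subgroupX.
by rewrite /= fX -oQ; apply: expg_cardG; rewrite finset.in_setT.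
Qed.

Lemma fhom_kernel_normal (G : topologicalGroupType) (gT : finGroupType) (f : G -> gT)
    (S : set G) (B : {group gT}) :
  fhom f -> subgroup S -> fimage f S \subset 'N(B) ->
  normal_subgroup (S `&` f @^-1` [set` B]) S.
Proof.
move=> fh gS nB; split.
- by apply: subgroupI => //; exact: fhom_subgroup.
- by move=> x [].
- move=> x y Sx [Sy /= fy]; split; first exact: subgroupJ.
  by rewrite /= (fhomJ fh) memJ_norm // (fintype.subsetP nB) // mem_fimage.
Qed.

(** * Finite images of Sylow subgroups *)

Section Sylow.

Variables (G : topologicalGroupType) (p : nat) (S : set G).
Hypotheses (p_pr : prime p) (pG : profinite G) (sylS : sylow_subgroup p S).

Lemma fimage_pro_p (gT : finGroupType) (f : G -> gT) : fhom f -> p.-group (fimage f S).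
Proof.
move=> fh; have [[_ gS] ppS _] := sylS.
have nU := fhom_kernel_normal (B := 1%G) fh gS (norms1 _).
have oU : open (S `&` f @^-1` [set` (1%G : {group gT})] : set (subspace S)).
  by rewrite open_subspaceTI; apply: open_subspaceW; exact: fhom_open.
apply/pgroupP=> q q_pr /(Cauchy q_pr)[_ /(fimageP fh _ gS)[x Sx <-] ox].
have [k [_ /= fx]] := pro_p_exp gS ppS nU oU Sx.
move: fx; rewrite (fhomX fh) => /set1gP/eqP; rewrite -order_dvdn ox => q_dvd.
have := Euclid_dvdX p k q_pr; rewrite q_dvd => /esym/andP[].
by rewrite dvdn_prime2 // => /eqP-> _; rewrite inE.
Qed.

(** The preimage of [fimage f S] is an open subgroup containing [S], and its index in [G] is the
    index of [fimage f S] in the whole image. *)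
Lemma fimage_sylow (gT : finGroupType) (f : G -> gT) :
  fhom f -> p.-Sylow(fimage f setT) (fimage f S).
Proof.
move=> fh; have [[_ gS] ppS idxS] := sylS; have [cptG _ _] := pG.
have sS : fimage f S \subset fimage f setT by apply: fimageS.
rewrite /pHall sS fimage_pro_p //=; pose U := f @^-1` [set` fimage f S].
have gU : subgroup U := fhom_subgroup fh _.
have oU : open U by apply: fhom_open.
have [n [c [r cs]]] := coset_system_exists cptG gU oU.
rewrite (card_fimage_index fh sS cs) p'natE //.
apply: (idxS U n gU oU); last exact: (card_left_cosets gU cs).
by move=> x Sx; exact: mem_fimage.
Qed.

End Sylow.

Lemma fimage_quotient_map (G : topologicalGroupType) (gT : finGroupType) (f : G -> gT)
    (S : set G) (D : {group gT}) :
  fhom f -> subgroup S -> D <| fimage f S ->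
  quotient_map S (S `&` f @^-1` [set` D])
    (fun x => subg (fimage f S / D)%G (coset D (f x))).
Proof.
move=> fh gS /andP[_ nD]; set Q := (fimage f S / D)%G.
have NS x : S x -> f x \in 'N(D).
  by move=> Sx; apply: (fintype.subsetP nD); exact: mem_fimage.
have QS x : S x -> coset D (f x) \in Q by move=> Sx; exact/mem_quotient/mem_fimage.
split=> [x y Sx Sy||].
- by rewrite (fhomM fh) morphM ?NS // morphM ?QS.
- apply/seteqP; split=> // e _.
  have /morphimP[_ _ /(fimageP fh _ gS)[x Sx <-] defe] := subgP e.
  by exists x => //; rewrite -[coset _ _]/(coset D (f x)) -defe sgvalK.
apply/seteqP; split=> x [Sx fx]; split=> //=.
  by apply: coset_idr; [exact: NS | rewrite -(@subgK _ Q _ (QS x Sx)) fx].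
by rewrite coset_id // morph1.
Qed.

(** * Frattini quotients of Sylow subgroups *)

Lemma index_Phi_leq (gT : finGroupType) (p n : nat) (P : {group gT}) (D : {set gT}) :
  prime p -> p.-group P -> P \subset <<D>> -> D \subset P -> #|D| <= n ->
  #|P : 'Phi(P)| <= p ^ n.
Proof.
move=> p_pr pP sPD sDP leDn.
have nPhi : P \subset 'N('Phi(P)) := gFnorm _ _.
have abE := Phi_quotient_abelem pP.
rewrite -card_quotient // (card_pgroup (abelem_pgroup abE)) leq_pexp2l ?prime_gt0 //.
rewrite -(rank_abelem abE) -(grank_abelian (abelem_abelian abE)).
have defP : P = <<D>> :> {set gT} by apply/eqP; rewrite finset.eqEsubset sPD gen_subG.
rewrite /=; have -> : P / 'Phi(P) = <<D / 'Phi(P)>>.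
  by rewrite -quotient_gen ?(fintype.subset_trans sDP) // -defP.
by apply: leq_trans (grank_min _) _; apply: leq_trans leDn; apply: leq_morphim.
Qed.

Section Pairs.

Variables (G : topologicalGroupType) (gT1 gT2 : finGroupType).
Variables (f1 : G -> gT1) (f2 : G -> gT2) (H : set G).
Hypotheses (h1 : fhom f1) (h2 : fhom f2) (gH : subgroup H).

Let h x := (f1 x, f2 x).
Let hh : fhom h := fhom_pair h1 h2.

Lemma fst_fimage : fst @* fimage h H = fimage f1 H.
Proof.
apply/setP=> y; apply/morphimP/(fimageP h1 _ gH).
  by case=> _ _ /(fimageP hh _ gH)[x Hx <-] ->; exists x.
by case=> x Hx <-; exists (h x); rewrite ?finset.in_setT //; exact: mem_fimage.
Qed.

Lemma snd_fimage : snd @* fimage h H = fimage f2 H.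
Proof.
apply/setP=> y; apply/morphimP/(fimageP h2 _ gH).
  by case=> _ _ /(fimageP hh _ gH)[x Hx <-] ->; exists x.
by case=> x Hx <-; exists (h x); rewrite ?finset.in_setT //; exact: mem_fimage.
Qed.

End Pairs.

Section FrattiniQuotient.

Variables (G : topologicalGroupType) (p : nat) (S : set G).
Hypotheses (p_pr : prime p) (pG : profinite G) (sylS : sylow_subgroup p S).
Hypothesis (fgS : finitely_generated S).

Let gS : subgroup S. Proof. by case: sylS => -[]. Qed.

Lemma fimage_generated (gT : finGroupType) (f : G -> gT) (X : set G) :
  fhom f -> generates X S -> fimage f S \subset fimage f X.
Proof.
move=> fh genX; apply/fintype.subsetP=> _ /(fimageP fh _ gS)[x Sx <-].
suff : S `<=` f @^-1` [set` fimage f X] by move/(_ x Sx).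
rewrite -genX; apply: smallest_sub.
  by split; [exact: fhom_closed | exact: fhom_subgroup].
by move=> y Xy; exact: mem_fimage.
Qed.

Lemma index_Phi_fimage_bounded :
  exists n, forall (gT : finGroupType) (f : G -> gT), fhom f ->
    #|fimage f S : 'Phi(fimage f S)| <= p ^ n.
Proof.
have [n [X [cX genX]]] := fgS; exists n => gT f fh.
have sXS : X `<=` S by rewrite -genX; exact: sub_gen_smallest.
apply: (@index_Phi_leq _ _ _ _ (finset (fun y : gT => `[< exists2 x, X x & f x = y >]))) => //.
- exact: (fimage_pro_p p_pr sylS).
- exact: fimage_generated.
- apply/fintype.subsetP=> y; rewrite inE => /asboolP[x Xx <-]; apply: mem_fimage; exact: sXS.
move: cX; rewrite card_eq_sym => cX; have /unsquash b := elimT card_eqP cX.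
have bi (i : 'I_n) : (i : nat) \in (`I_n : set nat) by apply/mem_set/ltn_ord.
rewrite -[n in leqRHS]card_ord.
apply: leq_trans (leq_imset_card (fun i : 'I_n => f (val (b (SigSub (bi i))))) _).
apply/subset_leq_card/fintype.subsetP=> y; rewrite inE => /asboolP[x Xx <-].
have [k _ bk] := @surj _ _ _ _ b (SigSub (mem_set Xx)) I.
have lt_kn : val k < n by exact: (set_mem (valP k)).
apply/imsetP; exists (Ordinal lt_kn) => //=.
by rewrite (_ : SigSub _ = k) ?bk //; exact: val_inj.
Qed.

(** The Frattini quotient of the image of [S] under [f0] has maximal order among all finite images.
    By [frattiniP] it is then the Frattini quotient of [S] itself. *)
Definition frattini_stable (gT0 : finGroupType) (f0 : G -> gT0) : Prop :=
  fhom f0 /\ forall (gT : finGroupType) (f : G -> gT), fhom f ->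
    #|fimage f S : 'Phi(fimage f S)| <= #|fimage f0 S : 'Phi(fimage f0 S)|.

Lemma frattini_stable_exists : exists (gT0 : finGroupType) (f0 : G -> gT0), frattini_stable f0.
Proof.
have [n le_n] := index_Phi_fimage_bounded.
pose P k := `[< exists (gT : finGroupType) (f : G -> gT),
  fhom f /\ #|fimage f S : 'Phi(fimage f S)| = k >].
have exP : exists k, P k.
  have [gT [f [fh _]]] := fhom_open_kernel pG (filterT : nbhs (1 : G) setT).
  by exists #|fimage f S : 'Phi(fimage f S)|; apply/asboolP; exists gT, f.
have ubP k : P k -> k <= p ^ n by move/asboolP => [gT [f [fh <-]]]; exact: le_n.
case: (ex_maxnP exP ubP) => _ /asboolP[gT0 [f0 [fh0 <-]]] maxk.
exists gT0, f0; split=> // gT f fh; apply: maxk.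
by apply/asboolP; exists gT, f.
Qed.

Variables (gT0 : finGroupType) (f0 : G -> gT0).
Hypothesis st0 : frattini_stable f0.

Let fh0 : fhom f0 := st0.1.

(* Tate's theorem in the image of [(f, f0)], whose kernel on the second factor
   meets the Sylow subgroup inside its Frattini subgroup. *)
Lemma frattini_stable_p_nilpotent (gT : finGroupType) (f : G -> gT) :
  fhom f -> p_nilpotent p (fimage f (f0 @^-1` [set 1])).
Proof.
move=> fh; pose h x := (f x, f0 x); have hh : fhom h := fhom_pair fh fh0.
pose X := fimage h setT; have sylX := fimage_sylow p_pr pG sylS hh.
pose s := snd_morphism gT gT0.
have nK : p_nilpotent p ('ker_X s)%G.
  apply: (p_nilpotent_ker p_pr (finset.subsetT X) sylX).
  by rewrite [s @* _](snd_fimage fh fh0 gS); exact: st0.2.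
apply: p_nilpotentS (p_nilpotent_morphim (fst_morphism gT gT0) (finset.subsetT _) nK).
apply/fintype.subsetP=> y; have gK : subgroup (f0 @^-1` [set 1]).
  have := fhom_subgroup fh0 1%G; rewrite (_ : [set` 1%G] = [set 1]) //.
  by apply/seteqP; split=> z /= /set1gP.
case/(fimageP fh _ gK) => x /= fx1 <-; apply/morphimP.
exists (h x); rewrite ?finset.in_setT //.
by rewrite !inE mem_fimage //= fx1 eqxx.
Qed.

(** In the image [P] of the pair, maximality forces the kernel of the second projection into
    ['Phi(P)]. So ['Phi(P)] is the full preimage of the Frattini subgroup on the second factor, and
    it projects into the one on the first. *)
Lemma frattini_stable_Phi (gT : finGroupType) (f : G -> gT) x :
  fhom f -> S x -> f0 x \in 'Phi(fimage f0 S) -> f x \in 'Phi(fimage f S).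
Proof.
move=> fh Sx Phix; pose h x := (f x, f0 x); have hh : fhom h := fhom_pair fh fh0.
pose P := fimage h S; have pP : p.-group P := fimage_pro_p p_pr sylS hh.
pose s := snd_morphism gT gT0; pose t := fst_morphism gT gT0.
have sP : s @* P = fimage f0 S := snd_fimage fh fh0 gS.
have tP : t @* P = fimage f S := fst_fimage fh fh0 gS.
suff Phihx : h x \in 'Phi(P).
  rewrite -tP -(morphim_Phi t pP (finset.subsetT P)); apply/morphimP.
  by exists (h x); rewrite ?finset.in_setT.
have sPhiP : 'Phi(P) \subset P := Phi_sub P.
have := index_morphim_ker s sPhiP (finset.subsetT P).
rewrite (morphim_Phi s pP (finset.subsetT P)) sP => idx.
have := st0.2 _ h hh; rewrite -/P -idx -[leqRHS]muln1 leq_pmul2l ?indexg_gt0 // => le1.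
have sK : 'ker_P s \subset 'Phi(P) by rewrite -indexg_eq1 eqn_leq indexg_gt0 le1.
move: Phix; rewrite -sP -(morphim_Phi s pP (finset.subsetT P)) => /morphimP[u _ Phiu /= defx].
have : h x * u^-1 \in 'ker_P s.
  rewrite !inE groupM ?groupV ?(fintype.subsetP sPhiP u) ?mem_fimage //=.
  by rewrite defx mulgV.
by move/(fintype.subsetP sK); rewrite groupMr // groupV.
Qed.

End FrattiniQuotient.

(** * Subgroups of bounded index *)

Lemma card_eq_seq (T : choiceType) (X : set T) n :
  X #= `I_n -> exists s : seq T, forall x, X x <-> x \in s.
Proof.
move=> cX; have /finite_setP/finite_seqP[s ->] : exists n, X #= `I_n by exists n.
by exists s.
Qed.

Section BoundedIndex.

Variable G : topologicalGroupType.
Hypothesis pG : profinite G.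
Hypothesis fgSyl : forall p, prime p ->
  exists S : set G, sylow_subgroup p S /\ finitely_generated S.

Lemma Sylow_generators b : exists s : seq G, forall q, prime q -> q < b ->
  exists2 S : set G, sylow_subgroup q S &
    forall H, closed_subgroup H -> (forall x, x \in s -> H x) -> S `<=` H.
Proof.
elim: b => [|b [s IHs]]; first by exists [::].
have [pr_b|npr_b] := boolP (prime b); last first.
  exists s => q pr_q; rewrite ltnS leq_eqVlt => /predU1P[eq_qb|]; last exact: IHs.
  by rewrite -eq_qb pr_q in npr_b.
have [S [sylS [n [X [cX genX]]]]] := fgSyl pr_b.
have [s' Xs'] := card_eq_seq cX.
exists (s' ++ s) => q pr_q; rewrite ltnS leq_eqVlt => /predU1P[->|lt_qb].
  exists S => // H clH sH; rewrite -genX; apply: smallest_sub => // x /Xs' s'x.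
  by apply: sH; rewrite mem_cat s'x.
have [S' sylS' genS'] := IHs q pr_q lt_qb; exists S' => // H clH sH.
by apply: genS' => // x sx; apply: sH; rewrite mem_cat sx orbT.
Qed.

(* A Sylow q-subgroup with [q > #|T|] has trivial image in [T], so homomorphisms
   to [T] which agree on generators of the other Sylow subgroups are equal. *)
Lemma fhom_to_group_bound (T : finGroupType) :
  exists (gT : finGroupType) (F : G -> gT), fhom F /\
    forall phi : G -> T, fhom phi -> forall g, F g = 1 -> phi g = 1.
Proof.
have [cptG _ _] := pG; have [s genS] := Sylow_generators #|T|.+1.
have ext (phi psi : G -> T) : fhom phi -> fhom psi ->
    (forall x, x \in s -> phi x = psi x) -> forall x, phi x = psi x.
  move=> h1 h2 eqs; pose h x := (phi x, psi x); have hh : fhom h := fhom_pair h1 h2.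
  pose U := [set x | phi x = psi x].
  have gU : subgroup U.
    split=> [|x y /= ex ey]; first by rewrite /U /= (fhom1 h1) (fhom1 h2).
    by rewrite /U /= (fhomM h1) (fhomM h2) (fhomV h1) (fhomV h2) ex ey.
  have defU : U = h @^-1` [set u | u.1 = u.2] by [].
  have oU : open U by rewrite defU; exact: fhom_open.
  have cU : closed U by rewrite defU; exact: fhom_closed.
  have [n [c [r cs]]] := coset_system_exists cptG gU oU.
  have SU q : prime q -> exists2 S, sylow_subgroup q S & S `<=` U.
    move=> pr_q; have [lt_q|le_q] := ltnP q #|T|.+1.
      by have [S sylS gS] := genS q pr_q lt_q; exists S => //; apply: gS.
    have [S [sylS _]] := fgSyl pr_q; exists S => // x Sx.
    have q1 (chi : G -> T) : fhom chi -> chi x = 1.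
      move=> h3; have := fimage_pro_p pr_q sylS h3 => qS.
      have qx : q.-elt (chi x) by apply: mem_p_elt qS _; exact: mem_fimage.
      apply/eqP; rewrite -order_eq1; apply: contraLR le_q; rewrite -ltnNge => nt.
      have nt1 : <[chi x]> != 1 by rewrite cycle_eq1 -order_eq1.
      have [_ q_dvd _] := pgroup_pdiv qx nt1.
      by apply: leq_ltn_trans (dvdn_leq _ q_dvd) _; rewrite ?cardG_gt0 // ltnS max_card.
    by rewrite /U /= !q1.
  (* The open subgroup [U] on which the two maps agree contains a Sylow subgroup for each prime, so
     no prime divides its index. *)
  have n1 : n = 1%N.
    have n_gt0 : 0 < n by case: (n) (c 1) => [[]|].
    apply/eqP; rewrite eqn_leq n_gt0 andbT leqNgt; apply/negP=> /pdivP[q pr_q q_dvd].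
    have [S [_ _ idxS] sSU] := SU q pr_q.
    by have := idxS U n gU oU sSU (card_left_cosets gU cs); rewrite q_dvd.
  move=> x; have [_ cE] := cs; have : U (x * 1^-1).
    apply/cE/val_inj; case: (c x) (c 1) => [i Hi] [j Hj] /=; move: Hi Hj.
    by rewrite n1 !ltnS !leqn0 => /eqP-> /eqP->.
  by rewrite invg1 mulg1.
(* A map is determined by the tuple [t] of its values on [s]. [F t] is the map with these values, or
   the trivial one if there is none, so that all kernels contain the finite intersection [V]. *)
pose ok (t : (size s).-tuple T) (phi : G -> T) := fhom phi /\ map phi s = t.
pose F t : G -> T :=
  if pselect (exists phi, ok t phi) is left ex then projT1 (cid ex) else (fun=> 1).
have hF t : fhom (F t).
  rewrite /F; case: pselect => [ex|_]; first by case: cid => phi [].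
  split=> [x y|]; first by rewrite mulg1.
  have -> : (fun=> 1 : T) @^-1` [set 1] = [set: G] by apply/seteqP; split.
  exact: openT.
pose V := [set g | forall t, F t g = 1].
have nV : normal_subgroup V [set: G].
  split=> // [|x y _ Vy t]; last by rewrite (fhomJ (hF t)) Vy conj1g.
  split=> [t|x y Vx Vy t]; first exact: (fhom1 (hF t)).
  by rewrite (fhomM (hF t)) (fhomV (hF t)) Vx Vy invg1 mulg1.
have oV : open V.
  apply: subgroup_open; first by case: nV.
  apply: filter_forall => t; apply: open_nbhs_nbhs; split; first exact: (hF t).2.
  exact: (fhom1 (hF t)).
have [gT [f [fh fV]]] := fhom_exists cptG nV oV.
exists gT, f; split=> // phi hphi g /fV Vg.
pose t := map_tuple phi (in_tuple s).
have okt : exists phi, ok t phi by exists phi.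
have := Vg t; rewrite /F; case: pselect => // ex; case: cid => psi [hpsi eqpsi] /= <-.
apply: ext => // x sx; have := congr1 (fun u => nth 1 u (index x s)) eqpsi.
by rewrite /= !(nth_map 1) ?index_mem // nth_index.
Qed.

Lemma fhom_to_perm_bound n :
  exists (gT : finGroupType) (F : G -> gT), fhom F /\
    forall m, m <= n -> forall phi : G -> 'S_m, fhom phi -> forall g, F g = 1 -> phi g = 1.
Proof.
elim: n => [|n [gT1 [F1 [h1 F1P]]]].
  have [gT [F [hF FP]]] := fhom_to_group_bound {perm 'I_0}.
  by exists gT, F; split=> // m; rewrite leqn0 => /eqP->.
have [gT2 [F2 [h2 F2P]]] := fhom_to_group_bound {perm 'I_n.+1}.
exists _, (fun x => (F1 x, F2 x)); split; first exact: fhom_pair.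
move=> m; rewrite leq_eqVlt => /predU1P[->|lt_mn] phi hphi g [g1 g2].
  exact: F2P.
exact: (F1P m).
Qed.

(** The index of [U] is bounded through a map [c] that separates its cosets and has at most [n]
    values. The action on these cosets has degree at most [n], and its kernel lies in [U]. *)
Lemma open_index_bound n :
  exists (gT : finGroupType) (F : G -> gT), fhom F /\
    forall (T : finType) (D : {set T}) (c : G -> T) (U : set G), (forall x, c x \in D) ->
      #|D| <= n -> subgroup U -> open U ->
      (forall x y, c x = c y -> U (x * y^-1)) -> forall g, F g = 1 -> U g.
Proof.
have [cptG _ _] := pG; have [gT [F [hF FP]]] := fhom_to_perm_bound n.
exists gT, F; split=> // T D c U cD leD gU oU cU g Fg.
have [m [c' [r cs]]] := coset_system_exists cptG gU oU.
have [phi [hphi phiU _]] := coset_action_exists gU oU cs.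
apply: phiU; apply: (FP m _ _ hphi) => //.
have [rK cE] := cs; apply: leq_trans leD.
have inj_cr : injective (c \o r) by move=> i j /= /cU/cE; rewrite !rK.
rewrite -[m]card_ord -(card_imset _ inj_cr); apply: subset_leq_card.
by apply/fintype.subsetP=> _ /imsetP[i _ ->]; exact: cD.
Qed.

End BoundedIndex.

(** * Normalisers of Sylow subgroups *)

(** The preimage [M] of [f @* P] in [X] is normalised by [u]. The Frattini argument writes
    [u = z * n] with [z] in [M] and [n] normalising [P], and [z] may be replaced by an element of
    [P] with the same image. *)
Lemma Frattini_lift (gT rT : finGroupType) (p : nat) (D X P : {group gT})
    (f : {morphism D >-> rT}) u :
  X \subset D -> p.-Sylow(X) P -> u \in X -> f u \in 'N(f @* P) ->
  exists2 n, n \in 'N_X(P) & f n = f u.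
Proof.
move=> sXD sylP Xu Nfu; have [sPX _ _] := and3P sylP.
pose M := (X :&: f @*^-1 (f @* P))%G.
have sPD := fintype.subset_trans sPX sXD.
have sPM : P \subset M by rewrite finset.subsetI sPX /= morphimK // mulG_subr.
have sylPM := pHall_subl sPM (finset.subsetIl _ _) sylP.
have NMu : u \in 'N_X(M).
  rewrite finset.in_setI Xu inE; apply/fintype.subsetP=> _ /imsetP[z /setIP[Xz /morphpreP[Dz fz]] ->].
  have Dzu : z ^ u \in D by rewrite groupJ // (fintype.subsetP sXD).
  rewrite finset.in_setI groupJ //=; apply/morphpreP; split=> //.
  by rewrite morphJ ?(fintype.subsetP sXD) // memJ_norm.
have nsM : M <| 'N_X(M) by rewrite /normal finset.subsetIr finset.subsetI finset.subsetIl normG.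
move: NMu; rewrite -(Frattini_arg nsM sylPM) => /mulsgP[z n /setIP[Xz /morphpreP[Dz fz]] Nn ->].
have [v Dv Pv fzv] := morphimP fz.
have {Nn} Nn : n \in 'N_X(P).
  by have := Nn; rewrite !finset.in_setI -andbA => /and3P[-> _ ->].
exists (v * n).
  by rewrite groupM // finset.in_setI (fintype.subsetP sPX) //= (fintype.subsetP (normG P)).
have Dn : n \in D by rewrite (fintype.subsetP sXD) //; case/setIP: Nn.
by rewrite !morphM // -fzv.
Qed.

Section SylowNormaliserLift.

Variables (G : topologicalGroupType) (p : nat) (S : set G).
Hypotheses (p_pr : prime p) (pG : profinite G) (sylS : sylow_subgroup p S).

Let gS : subgroup S. Proof. by case: sylS => -[]. Qed.
Let clS : closed_subgroup S. Proof. by case: sylS. Qed.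

Lemma fimage_normalises (gT : finGroupType) (h : G -> gT) g :
  fhom h -> reflect (forall y, S y -> h (y ^ g) \in fimage h S) (h g \in 'N(fimage h S)).
Proof.
move=> hh; apply: (iffP idP) => [Ng y Sy|Sg].
  by rewrite (fhomJ hh) memJ_norm // mem_fimage.
rewrite inE; apply/fintype.subsetP=> _ /imsetP[_ /(fimageP hh _ gS)[y Sy <-] ->].
by rewrite -(fhomJ hh); apply: Sg.
Qed.

(** For each finite image, [Frattini_lift] yields elements with the value [f x] that normalise the
    image of [S]. These sets are clopen and form a filter base by pairing of maps, so compactness
    provides a common element. It normalises [S] because the closed subgroup [S] is determined by
    its finite images. *)
Lemma normaliser_lift (gT : finGroupType) (f : G -> gT) x :
  fhom f -> f x \in 'N(fimage f S) ->
  exists2 g, f g = f x & forall y, S y <-> S (y ^ g).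
Proof.
move=> fh Nfx.
pose C (rT : finGroupType) (h : G -> rT) := [set g | f g = f x /\ h g \in 'N(fimage h S)].
pose F : set_system G :=
  [set P | exists (rT : finGroupType) (h : G -> rT), fhom h /\ C rT h `<=` P].
have C0 (rT : finGroupType) (h : G -> rT) : fhom h -> exists g, C rT h g.
  move=> hh; pose k y := (f y, h y); have hk : fhom k := fhom_pair fh hh.
  have sylk := fimage_sylow p_pr pG sylS hk.
  have [|n /setIP[/(fimageP hk _ (@subgroupT G))[g _ <-] Ng] /= fg] :=
    Frattini_lift (f := fst_morphism gT rT) (finset.subsetT _) sylk (@mem_fimage _ _ k setT x I).
    by rewrite [_ @* _](fst_fimage fh hh gS).
  exists g; split=> //; rewrite -(snd_fimage fh hh gS).
  apply: (fintype.subsetP (morphim_norm (snd_morphism gT rT) _) (snd (k g))).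
  exact: (mem_morphim (snd_morphism gT rT) (finset.in_setT (k g)) Ng).
have FF : ProperFilter F.
  apply: Build_ProperFilter_ex.
    by move=> P [rT [h [hh CP]]]; have [g Cg] := C0 rT h hh; exists g; apply: CP.
  split.
  - by exists gT, f; split.
  - move=> P Q [rT1 [h1 [hh1 CP]]] [rT2 [h2 [hh2 CQ]]].
    have hk := fhom_pair hh1 hh2; exists _, (fun y => (h1 y, h2 y)); split=> // g [fg].
    move/(fimage_normalises _ hk) => Ng; split.
      apply: CP; split=> //; apply/fimage_normalises => // y /Ng/(fimageP hk _ gS)[z Sz] [<- _].
      exact: mem_fimage.
    apply: CQ; split=> //; apply/fimage_normalises => // y /Ng/(fimageP hk _ gS)[z Sz] [_ <-].
    exact: mem_fimage.
  - by move=> P Q PQ [rT [h [hh CP]]]; exists rT, h; split=> // g /CP/PQ.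
have [cptG _ _] := pG; have [g [_ clg]] := cptG F FF (filterT (F := F)).
have Cg (rT : finGroupType) (h : G -> rT) : fhom h -> C rT h g.
  move=> hh; have FC : F (C rT h) by exists rT, h; split.
  have hk := fhom_pair fh hh.
  have : nbhs g ((fun y => (f y, h y)) @^-1` [set (f g, h g)]).
    by apply: open_nbhs_nbhs; split=> //; exact: fhom_open.
  case/(clg _ _ FC) => y [[fy Ny] [eqf eqh]].
  by split; [rewrite -eqf | rewrite -eqh].
have Sg g' : (forall (rT : finGroupType) (h : G -> rT), fhom h -> h g' \in 'N(fimage h S)) ->
    forall y, S y -> S (y ^ g').
  move=> Ng y Sy; apply: contrapT => /(fhom_separates pG clS)[rT [h [hh]]].
  by have /(fimage_normalises _ hh)/(_ y Sy) -> := Ng _ h hh.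
exists g; first by have [] := Cg _ f fh.
move=> y; split; first by apply: Sg => rT h hh; have [] := Cg _ h hh.
have Sgi := Sg g^-1 _; move/Sgi; rewrite -conjgM mulgV conjg1; apply.
by move=> rT h hh; rewrite (fhomV hh) groupV; have [] := Cg _ h hh.
Qed.

End SylowNormaliserLift.

(** * Frattini subgroups *)

Section ClosedSubgroups.

Variable G : topologicalGroupType.
Hypothesis pG : profinite G.
Implicit Types (S M L : set G).

Lemma closed_subgroup_fimage S L (gT : finGroupType) (h : G -> gT) (B : {group gT}) :
  closed_subgroup S -> fhom h -> closed_subgroup (S `&` h @^-1` [set` B]).
Proof.
case=> clS gS hh; split; first by apply: closedI => //; exact: fhom_closed.
by apply: subgroupI => //; exact: fhom_subgroup.
Qed.

Lemma fimage_preimage S (gT : finGroupType) (h : G -> gT) (B : {group gT}) :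
  subgroup S -> fhom h -> B \subset fimage h S ->
  fimage h (S `&` h @^-1` [set` B]) = B.
Proof.
move=> gS hh sB; apply/group_inj/eqP; rewrite finset.eqEsubset.
have gP : subgroup (S `&` h @^-1` [set` B]).
  by apply: subgroupI => //; exact: fhom_subgroup.
apply/andP; split; apply/fintype.subsetP=> y; first by case/(fimageP hh _ gP) => x [_ /= Bx] <-.
move=> By; have /(fimageP hh _ gS)[x Sx defy] := fintype.subsetP sB y By.
by rewrite -defy; apply: mem_fimage; split; rewrite //= defy.
Qed.

(** Let [h] separate some [y] of [S] from [M]. For every [k] with smaller kernel, the preimage in
    [S] of [fimage k M] is a proper closed subgroup containing [M], hence equals [M]. *)
Lemma maximal_subgroup_fimage S M : closed_subgroup S -> maximal_subgroup M S ->
  exists (gT : finGroupType) (h : G -> gT), fhom h /\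
    forall (rT : finGroupType) (k : G -> rT), fhom k ->
      (forall x, k x = 1 -> h x = 1) ->
      maximal_eq (fimage k M) (fimage k S) /\
      forall x, S x -> (M x <-> k x \in fimage k M).
Proof.
move=> clS [clM [sMS nSM] maxM]; have [clS' gS] := clS; have [clM' gM] := clM.
have /existsNP[y /not_implyP[Sy nMy]] := nSM.
have [gT [h [hh nhy]]] := fhom_separates pG clM nMy.
exists gT, h; split=> // rT k hk ker_k.
have nky : k y \notin fimage k M.
  apply: contra nhy => /(fimageP hk _ gM)[m Mm eqk].
  apply/(fimageP hh _ gM); exists m => //; apply/eqP; rewrite eq_mulgV1.
  by rewrite -(fhomV hh) -(fhomM hh); apply/eqP/ker_k; rewrite (fhomM hk) (fhomV hk) eqk mulgV.
have MB (B : {group rT}) : fimage k M \subset B -> B \subset fimage k S ->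
    B = fimage k M \/ B = fimage k S.
  move=> sMB sBS; pose L := S `&` k @^-1` [set` B].
  have clL : closed_subgroup L by apply: closed_subgroup_fimage.
  have sML : M `<=` L.
    move=> x Mx; split; first exact: sMS.
    by apply: (fintype.subsetP sMB); exact: mem_fimage.
  rewrite -(fimage_preimage gS hk sBS) -/L.
  have [SL|nSL] := pselect (S `<=` L).
    right; congr fimage; apply/seteqP; split=> // x; by case.
  by left; congr fimage; apply: maxM => //; split=> // x [].
split=> [|x Sx].
  apply/maximal_eqP; split; first exact: fimageS.
  by move=> B sMB sBS; case: (MB B sMB sBS) => ->; [left | right].
split=> [|kx]; first exact: mem_fimage.
suff <- : S `&` k @^-1` [set` fimage k M] = M by [].
apply: maxM; first exact: closed_subgroup_fimage.
  by move=> z Mz; split; [exact: sMS | exact: mem_fimage].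
split; first by move=> z [].
by move=> /(_ y Sy)[_ /= ky]; rewrite ky in nky.
Qed.

Lemma maximal_subgroup_preimage S (gT : finGroupType) (h : G -> gT) (B : {group gT}) :
  closed_subgroup S -> fhom h -> maximal B (fimage h S) ->
  maximal_subgroup (S `&` h @^-1` [set` B]) S.
Proof.
move=> clS hh maxB; have [_ gS] := clS; have [sBS _] := andP (maxgroupp maxB).
have /properP[_ [_ /(fimageP hh _ gS)[y Sy <-] nBy]] := maxgroupp maxB.
split; first exact: closed_subgroup_fimage.
  split; first by move=> x [].
  by move=> /(_ y Sy)[_ /= By]; rewrite By in nBy.
move=> L [clL gL] sML [sLS nSL].
have kerL x : S x -> h x \in fimage h L -> L x.
  move=> Sx /(fimageP hh _ gL)[l Ll eqh].
  rewrite -[x](mulgKV l); apply: subgroupM => //; apply: sML; split.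
    by case: (gS) => _; apply=> //; exact: sLS.
  by rewrite /= (fhomM hh) (fhomV hh) eqh mulgV group1.
have sBL : B \subset fimage h L.
  rewrite -(fimage_preimage gS hh sBS); exact: fimageS.
have : B \subset fimage h L -> fimage h L = B.
  move=> _; apply/group_inj/eqP; rewrite finset.eqEsubset sBL andbT.
  have /maxgroupP[_ maxB'] := maxB.
  apply: contraT => nLB; have LS : fimage h L \proper fimage h S.
    rewrite finset.properEneq fimageS // andbT; apply/eqP=> eqLS; case: nSL => x Sx.
    by apply: kerL => //; rewrite -[_ \in _]/(h x \in gval (fimage h L)) eqLS mem_fimage.
  by rewrite (maxB' _ LS sBL) subxx in nLB.
move/(_ sBL) => eqLB; apply/seteqP; split=> x.
  by move=> Lx; split; [exact: sLS | rewrite /= -eqLB mem_fimage].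
by move=> [Sx /=]; rewrite -eqLB; exact: kerL.
Qed.

End ClosedSubgroups.

Section FrattiniSubgroup.

Variables (G : topologicalGroupType) (p : nat) (S : set G).
Hypotheses (p_pr : prime p) (pG : profinite G) (sylS : sylow_subgroup p S).
Variables (gT0 : finGroupType) (f0 : G -> gT0).
Hypothesis st0 : frattini_stable S f0.

Let fh0 : fhom f0 := st0.1.
Let clS : closed_subgroup S. Proof. by case: sylS. Qed.
Let gS : subgroup S. Proof. by case: clS. Qed.

Lemma frattini_fimage (gT : finGroupType) (h : G -> gT) x :
  fhom h -> frattini S x -> h x \in 'Phi(fimage h S).
Proof.
move=> hh [Sx Phix]; apply/finset.bigcapP=> B /predU1P[->|maxB]; first exact: mem_fimage.
by have [] := Phix _ (maximal_subgroup_preimage clS hh maxB).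
Qed.

(** A maximal subgroup [M] is a preimage from the image under some [h], and may be tested in the
    image of [h] and [f0] together, where [frattini_stable_Phi] applies. *)
Lemma frattiniP x : S x -> frattini S x <-> f0 x \in 'Phi(fimage f0 S).
Proof.
move=> Sx; split=> [|Phix]; first exact: frattini_fimage.
split=> // M maxM.
have [gT [h [hh hP]]] := maximal_subgroup_fimage pG clS maxM.
have hk := fhom_pair hh fh0.
have [|maxk kM] := hP _ (fun x => (h x, f0 x)) hk; first by move=> y [].
apply/(kM x Sx).
have /finset.bigcapP/(_ (fimage (fun x => (h x, f0 x)) M)) :=
  frattini_stable_Phi p_pr sylS st0 hk Sx Phix.
exact.
Qed.

(** Preimages of maximal subgroups under [a] are maximal. Compactness makes the images under [a] of
    closed subgroups closed. *)
Lemma frattini_automorphism a x : automorphism S a -> frattini S x -> frattini S (a x).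
Proof.
move=> [[aS inja surja] aM ca] [Sx Phix]; split; first exact: aS.
move=> M [[clM gM] [sMS nSM] maxM].
have a1 : a 1 = 1.
  by apply: (mulgI (a 1)); rewrite -aM ?mulg1 //; exact: subgroup1.
have aV y : S y -> a y^-1 = (a y)^-1.
  by move=> Sy; apply: (mulgI (a y)); rewrite -aM ?mulgV //; exact: subgroupV.
pose Ma := S `&` a @^-1` M.
suff maxMa : maximal_subgroup Ma S by have [] := Phix _ maxMa.
have [cptG hG _] := pG.
split.
- split.
    have /closed_subspaceP[V clV VS] : closed (a @^-1` M : set (subspace S)).
      by move/continuous_closedP : ca; apply.
    by rewrite /Ma classical_sets.setIC -VS; apply: closedI => //; case: clS.
  split; first by split; [exact: subgroup1 | rewrite /= a1; exact: subgroup1].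
  move=> y z [Sy /= My] [Sz /= Mz]; split; first by case: gS => _; apply.
  have Sz' := subgroupV gS Sz; rewrite /= aM // aV //; case: gM => _; exact.
- split; first by move=> y [].
  move=> SMa; apply: nSM => y Sy; have [z Sz <-] := surja y Sy.
  by have [] := SMa z Sz.
move=> L [clL gL] sML [sLS nSL].
have cptL : compact L := subclosed_compact clL cptG (@classical_sets.subsetT _ _).
have claL : closed_subgroup (a @` L).
  split; first apply: compact_closed => //.
    by apply: continuous_compact cptL; exact: continuous_subspaceW ca.
  split; first by exists 1; rewrite ?a1 //; exact: subgroup1.
  move=> _ _ [y Ly <-] [z Lz <-]; exists (y * z^-1).
    by case: gL => _; apply.
  have Sy := sLS y Ly; have Sz := sLS z Lz; have Sz' := subgroupV gS Sz.
  by rewrite aM // aV.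
have sMaL : M `<=` a @` L.
  move=> y My; have [z Sz eqy] := surja y (sMS y My).
  by exists z => //; apply: sML; split=> //=; rewrite eqy.
have LS y : S y -> (a @` L) (a y) -> L y.
  move=> Sy [z Lz eqa]; rewrite -(inja z y _ _ eqa) //; apply/mem_set => //.
  exact: sLS.
have eqaL : a @` L = M.
  apply: maxM => //; split; first by move=> _ [y Ly <-]; apply/aS/sLS.
  by move=> SaL; apply: nSL => y Sy; apply: LS => //; exact/SaL/aS.
apply/seteqP; split=> y.
  by move=> Ly; split; [exact: sLS | rewrite /= -eqaL; exists y].
by move=> [Sy /=]; rewrite -eqaL; exact: LS.
Qed.

End FrattiniSubgroup.

(** * Chains in Sylow subgroups *)

(** Each next term is a minimal subgroup satisfying [P] strictly above the current one. *)
Lemma composition_series (E : finGroupType) (P : {group E} -> Prop) (V : {group E}) :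
  P [set: E]%G -> P V ->
  exists m (W : nat -> {group E}), [/\ W 0%N = V, W m = [set: E]%G,
    forall i, (i <= m)%N -> P (W i) &
    forall i, (i < m)%N -> W i \proper W i.+1 /\
      forall L : {group E}, P L -> W i \subset L -> L \subset W i.+1 ->
        L = W i \/ L = W i.+1].
Proof.
move=> PT; have [n] := ubnP (#|E| - #|V|); elim: n V => // n IHn V le_n PV.
have [defV|ntV] := eqVneq V [set: E]%G; first by exists 0%N, (fun=> V); split.
pose Q (L : {group E}) := `[< P L >] && (V \proper L).
have QT : Q [set: E]%G.
  rewrite /Q; apply/andP; split; first exact/asboolP.
  rewrite finset.properEneq finset.subsetT andbT; apply: contraNneq ntV => VT.
  by apply/eqP/group_inj.
have [L /mingroupP[/andP[/asboolP PL VL] minL] _] := mingroup_exists QT.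
have [|m [W [W0 Wm PW irrW]]] := IHn L _ PL.
  have := proper_card VL; have := max_card L; move: le_n; rewrite !ltnS.
  move=> le_n leL ltVL; rewrite (leq_trans _ le_n) // ltn_sub2l //.
  exact: leq_trans ltVL leL.
exists m.+1, (fun i => if i is j.+1 then W j else V); split=> //.
  by case.
case=> [_|i]; last exact: irrW.
rewrite W0; split=> // K PK sVK sKL.
have [eqVK|neVK] := eqVneq (V : {set E}) K; first by left; apply: group_inj.
right; apply: group_inj; apply: minL => //.
by rewrite /Q finset.properEneq neVK sVK !andbT; apply/asboolP.
Qed.

Section FrattiniRank.

Variables (G : topologicalGroupType) (p : nat) (S : set G).
Hypotheses (p_pr : prime p) (pG : profinite G) (sylS : sylow_subgroup p S).
Hypothesis fgS : finitely_generated S.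

Let clS : closed_subgroup S. Proof. by case: sylS. Qed.
Let gS : subgroup S. Proof. by case: clS. Qed.

Lemma is_c_of_exists : exists r, is_c_of S r.
Proof.
have [gT0 [f0 st0]] := frattini_stable_exists p_pr pG sylS fgS.
have fh0 : fhom f0 := st0.1.
pose P := fimage f0 S; pose Q := (P / 'Phi(P))%G.
pose E : finGroupType := subg_of Q.
pose f x : E := subg Q (coset 'Phi(P) (f0 x)).
have qf : quotient_map S (frattini S) f.
  have -> : frattini S = S `&` f0 @^-1` [set` 'Phi(P)].
    apply/seteqP; split=> x [Sx Phix]; split=> //.
      by apply/(frattiniP p_pr pG sylS st0 Sx).
    by case: (proj2 (frattiniP p_pr pG sylS st0 Sx) Phix).
  exact: fimage_quotient_map fh0 gS (Phi_normal _).
have f1 x : S x -> f x = 1 <-> frattini S x.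
  have [_ _ <-] := qf => Sx; split=> [fx1|[] //]; by split.
have inv1 : aut_invariant S f 1%G.
  move=> a auta x Sx; rewrite !inE => /eqP/(f1 x Sx) Phix.
  have Phiax := frattini_automorphism pG sylS auta Phix.
  by apply/eqP/f1; case: Phiax.
have invT : aut_invariant S f [set: E]%G by move=> *; rewrite finset.in_setT.
have [m [W [W0 Wm PW irrW]]] := composition_series invT inv1.
by exists (\max_(i < m) 'r(W i.+1 / W i))%N, E, f, m, W; split.
Qed.

(** By [frattiniP], [f] factors through the Frattini quotient of the finite p-group [P]. *)
Lemma quotient_frattini_abelem (E : finGroupType) (f : G -> E) :
  quotient_map S (frattini S) f -> p.-abelem [set: E]%G.
Proof.
move=> [fM fS fker].
have [gT0 [f0 st0]] := frattini_stable_exists p_pr pG sylS fgS.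
have fh0 : fhom f0 := st0.1.
pose P := fimage f0 S; have pP : p.-group P := fimage_pro_p p_pr sylS fh0.
have nP : P \subset 'N('Phi(P)) := gFnorm _ _.
have [abQ expQ] := elimT (abelemP p_pr) (Phi_quotient_abelem pP).
have f1 x : S x -> f0 x \in 'Phi(P) -> f x = 1.
  by move=> Sx /(frattiniP p_pr pG sylS st0 Sx); rewrite -fker => -[].
have PS x : S x -> f0 x \in P by exact: mem_fimage.
have NS x : S x -> f0 x \in 'N('Phi(P)) by move/PS; exact: (fintype.subsetP nP).
have QS x : S x -> coset 'Phi(P) (f0 x) \in P / 'Phi(P) by move=> Sx; exact/mem_quotient/PS.
have onto e : exists2 x, S x & f x = e.
  have : [set: E] e by []. 
  by rewrite -fS => -[x Sx <-]; exists x.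
have fone : f 1 = 1 by apply: f1; [exact: subgroup1 | rewrite (fhom1 fh0) group1].
have fX x n : S x -> f (x ^+ n) = f x ^+ n.
  move=> Sx; elim: n => [|n IHn]; first by rewrite !expg0.
  by rewrite !expgS fM ?IHn //; exact: subgroupX.
apply/(abelemP p_pr); split.
  apply/centsP=> e1 _ e2 _; have [[x Sx <-] [y Sy <-]] := (onto e1, onto e2).
  have Sxy := subgroupM gS Sx Sy; have Syx := subgroupM gS Sy Sx.
  have Sc : S ((x * y) * (y * x)^-1) by case: gS => _; exact.
  rewrite /commute -!fM // -[x * y](mulgKV (y * x)) (fM _ (y * x)) //.
  rewrite f1 ?mul1g //; apply: coset_idr; first exact: NS.
  have [Nx Ny] := (NS x Sx, NS y Sy); have [Nxy Nyx] := (groupM Nx Ny, groupM Ny Nx).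
  rewrite (fhomM fh0) (fhomV fh0) !(fhomM fh0) morphM ?groupV // morphV // !morphM //=.
  by rewrite (centsP abQ _ (QS x Sx) _ (QS y Sy)) mulgV.
move=> e _; have [x Sx <-] := onto e; rewrite -fX // f1 //; first exact: subgroupX.
apply: coset_idr; first by apply: NS; exact: subgroupX.
by rewrite (fhomX fh0) morphX ?NS //= expQ // QS.
Qed.

Lemma conj_automorphism g : (forall y, S y <-> S (y ^ g)) -> automorphism S (fun y => y ^ g).
Proof.
move=> Sg; split.
- split; first by move=> y /Sg.
    by move=> y z _ _; exact: conjg_inj.
  move=> y Sy; exists (y ^ g^-1); last by rewrite -conjgM mulVg conjg1.
  by apply/Sg; rewrite -conjgM mulVg conjg1.
- by move=> x y _ _; rewrite conjMg.
- by apply: continuous_subspaceT; exact: conjg_continuous.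
Qed.

(** The term [W i] is the image under [h] of the preimage of [V i] in [S]. An element normalising
    the image of [S] lifts by [normaliser_lift] to one normalising [S]; conjugation by it is an
    automorphism of [S] and preserves [V i]. *)
Lemma Sylow_chain r R (gT : finGroupType) (h : G -> gT) :
  is_c_of S r -> (r <= R)%N -> fhom h ->
  exists m (W : nat -> {group gT}),
    [/\ W 0%N \subset 'Phi(fimage h S), fimage h S \subset W m,
      forall i, (i <= m)%N ->
        W i \subset fimage h S /\ 'N_(fimage h setT)(fimage h S) \subset 'N(W i) &
      forall i, (i < m)%N -> W i \subset W i.+1 /\ (#|W i.+1 : W i| <= p ^ R)%N].
Proof.
move=> [E [f [m [V [qf [V0 Vm] invV irrV defr]]]]] le_rR hh.
have abE := quotient_frattini_abelem qf; have [fM fS fker] := qf.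
have f1 : f 1 = 1.
  by apply: (mulgI (f 1)); rewrite -fM ?mulg1 //; exact: subgroup1.
have fV x : S x -> f x^-1 = (f x)^-1.
  by move=> Sx; apply: (mulgI (f x)); rewrite -fM ?mulgV //; exact: subgroupV.
pose A i := [set x | S x /\ f x \in V i].
have gA i : subgroup (A i).
  split; first by split; [exact: subgroup1 | rewrite f1 group1].
  move=> x y [Sx Vx] [Sy Vy]; split; first by case: gS => _; apply.
  by rewrite fM ?fV ?groupM ?groupV //; exact: subgroupV.
exists m, (fun i => fimage h (A i)); split.
- apply/fintype.subsetP=> u /(fimageP hh _ (gA 0%N))[x [Sx]]; rewrite V0 => /set1gP fx <-.
  by apply: (frattini_fimage sylS hh); rewrite -fker.
- by apply: fimageS => x Sx; split; rewrite // Vm finset.in_setT.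
- move=> i le_im /=; split; first by apply: fimageS => x [].
  apply/fintype.subsetP=> _ /setIP[/(fimageP hh _ (@subgroupT G))[x _ <-] Nx].
  have [g <- Sg] := normaliser_lift p_pr pG sylS hh Nx.
  rewrite inE; apply/fintype.subsetP=> _ /imsetP[_ /(fimageP hh _ (gA i))[y [Sy Vy] <-] ->].
  rewrite -(fhomJ hh); apply: mem_fimage; split; first exact: (Sg y).1.
  exact: (invV i le_im _ (conj_automorphism Sg)).
move=> i lt_im; have [sVV _] := irrV i lt_im; have {}sVV := proper_sub sVV.
have sAA : A i `<=` A i.+1 by move=> x [Sx Vx]; split=> //; exact: (fintype.subsetP sVV).
split; first exact: fimageS.
have abV : p.-abelem (V i.+1 / V i) := quotient_abelem _ (abelemS (finset.subsetT _) abE).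
have nVV : V i.+1 \subset 'N(V i).
  have abT := abelem_abelian abE; apply: cents_norm.
  apply: fintype.subset_trans (fintype.subset_trans abT _); rewrite ?finset.subsetT //.
  by rewrite centS ?finset.subsetT.
have ltr : (#|V i.+1 / V i| <= p ^ R)%N.
  rewrite (card_pgroup (abelem_pgroup abV)) leq_pexp2l ?prime_gt0 //.
  rewrite -(rank_abelem abV) (leq_trans _ le_rR) // defr.
  exact: (leq_bigmax (F := fun i : 'I_m => 'r(V i.+1 / V i)) (Ordinal lt_im)).
(* Through chosen preimages, the cosets of [V i] in [V i.+1] separate those of [W i] in [W i.+1]. *)
pose a u := xget 1 [set x | A i.+1 x /\ h x = u].
have aP u : u \in fimage h (A i.+1) -> A i.+1 (a u) /\ h (a u) = u.
  move=> /(fimageP hh _ (gA i.+1))[x Ax hx]; apply: (@xgetPex _ 1 [set x | A i.+1 x /\ h x = u]).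
  by exists x.
have sW : fimage h (A i) \subset fimage h (A i.+1) by apply: fimageS.
apply: leq_trans (index_leq_card (c := fun u => coset (V i) (f (a u))) sW _) _.
  move=> u v /aP[[Su Vu] hu] /aP[[Sv Vv] hv] eqc.
  rewrite -hu -hv -(fhomV hh) -(fhomM hh); apply: mem_fimage; split.
    by case: gS => _; apply.
  rewrite fM ?fV //; last exact: subgroupV.
  rewrite -mem_rcoset; apply/rcoset_kercosetP => //.
  - exact: (fintype.subsetP nVV).
  - exact: (fintype.subsetP nVV).
apply: leq_trans ltr; apply/subset_leq_card/fintype.subsetP=> _ /imsetP[u /aP[[Su Vu] _] ->].
exact: mem_quotient.
Qed.

End FrattiniRank.

(** * A uniform bound from [c_star] *)

Lemma supremum_unbounded (A : set \bar int) :
  A !=set0 -> (forall M : nat, exists2 a, A a & ~ (a <= (Posz M)%:E)%E) ->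
  supremum 0%:E%E A = +oo%E.
Proof.
move=> [a0 Aa0] unb; rewrite /supremum; case: ifPn => [/eqP A0|_].
  by rewrite A0 in Aa0.
have supP : supremums A +oo%E.
  split; first by move=> a _; exact: leey.
  move=> y uby; suff -> : y = +oo%E by [].
  case: y uby => // [z|] uby; exfalso.
    have [a Aa] := unb `|z|%N; apply; apply: Order.POrderTheory.le_trans (uby a Aa) _.
    rewrite lee_fin; exact: ssrint.lez_abs.
  have [a Aa] := unb 0%N; apply; apply: Order.POrderTheory.le_trans (uby a Aa) _.
  exact: leNye.
exact: xget_subset1 supP (@is_subset1_supremums _ _ _).
Qed.

Lemma c_star_bound (G : topologicalGroupType) :
  profinite G -> (c_star G < +oo)%E ->
  exists R : nat, forall p, prime p -> exists (S : set G) (r : nat),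
    [/\ sylow_subgroup p S, finitely_generated S, is_c_of S r & (r <= R)%N].
Proof.
move=> pG c_fin.
have [R cR] : exists R : nat, forall p, prime p -> (c_p p G <= (Posz R)%:E)%E.
  apply: contrapT => /forallNP unb; move: c_fin; rewrite /c_star supremum_unbounded //.
    by exists (c_p 2 G), 2.
  move=> M; have /existsNP[p /not_implyP[pr_p nle]] := unb M.
  by exists (c_p p G) => //; exists p.
exists R => p pr_p; have := cR p pr_p; rewrite /c_p; case: pselect => [ex|nex].
  case: (cid ex) => S [sylS fgS] /=; rewrite lee_fin => le_cR; exists S, (c_of S); split=> //.
  have [r cr] := is_c_of_exists pr_p pG sylS fgS.
  exact: (xgetPex 0%N (ex_intro _ r cr)).
(* Without a finitely generated Sylow subgroup, [d_p] is the infimum of the empty set, whose value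
   is [+oo], against the finite bound. *)
rewrite /d_p (_ : [set n | _] = set0); last first.
  rewrite -subset0 => n [S [sylS gS]]; apply: nex; exists S; split=> //.
  by exists n.
by rewrite image_set0 /infimum eqxx.
Qed.

(** * Large primes *)

Lemma p_nilpotent_p'elt (gT : finGroupType) (p : nat) (M : {group gT}) x :
  p_nilpotent p M -> x \in M -> p^'.-elt x -> x \in 'O_p^'(M).
Proof.
move=> nilM Mx p'x; have Nx : x \in 'N('O_p^'(M)).
  by apply: fintype.subsetP Mx; exact: gFnorm.
apply: coset_idr => //; apply/eqP; rewrite -order_eq1 -dvdn1.
have px : p.-elt (coset 'O_p^'(M) x) by apply: mem_p_elt nilM _; exact: mem_quotient.
by rewrite -(pnat_1 px (morph_p_elt _ _ p'x)).
Qed.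

Section Kernels.

Variable G : topologicalGroupType.

Lemma fhom_kernel (gT : finGroupType) (f : G -> gT) :
  fhom f -> normal_subgroup (f @^-1` [set 1]) [set: G].
Proof.
move=> fh; split=> // [|x y _ /= fy]; last by rewrite /= (fhomJ fh) fy conj1g.
by split=> [|x y /= fx fy]; rewrite /= ?(fhom1 fh) // (fhomM fh) (fhomV fh) fx fy invg1 mulg1.
Qed.

Lemma normal_subgroupI (K L : set G) : normal_subgroup K [set: G] ->
  normal_subgroup L [set: G] -> normal_subgroup (K `&` L) [set: G].
Proof.
move=> [gK _ nK] [gL _ nL]; split=> //; first exact: subgroupI.
by move=> x y Gx [Ky Ly]; split; [exact: nK | exact: nL].
Qed.

End Kernels.

Section LargePrimes.

Variables (G : topologicalGroupType) (R : nat).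
Hypothesis pG : profinite G.
Hypothesis sylG : forall p, prime p -> exists (S : set G) (r : nat),
  [/\ sylow_subgroup p S, finitely_generated S, is_c_of S r & r <= R].

Definition p_nilpotent_kernel (p : nat) (gT0 : finGroupType) (f0 : G -> gT0) :=
  fhom f0 /\ forall (gT : finGroupType) (f : G -> gT), fhom f ->
    p_nilpotent p (fimage f (f0 @^-1` [set 1])).

Lemma p_nilpotent_kernel_exists p : prime p ->
  exists (gT0 : finGroupType) (f0 : G -> gT0), p_nilpotent_kernel p f0.
Proof.
move=> p_pr; have [S [r [sylS fgS _ _]]] := sylG p_pr.
have [gT0 [f0 st0]] := frattini_stable_exists p_pr pG sylS fgS.
exists gT0, f0; split=> [|gT f fh]; first exact: st0.1.
exact: (frattini_stable_p_nilpotent p_pr pG sylS st0).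
Qed.

Lemma p_nilpotent_kernel_bound b :
  exists (gT0 : finGroupType) (f0 : G -> gT0), fhom f0 /\
    forall s, prime s -> s <= b -> p_nilpotent_kernel s f0.
Proof.
elim: b => [|b [gT1 [f1 [h1 nil1]]]].
  have [gT [f [fh _]]] := fhom_open_kernel pG (filterT : nbhs (1 : G) setT).
  by exists gT, f; split=> // s /prime_gt0; case: s.
have [pr_b|npr_b] := boolP (prime b.+1); last first.
  exists gT1, f1; split=> // s pr_s; rewrite leq_eqVlt => /predU1P[eq_s|]; last exact: nil1.
  by rewrite -eq_s pr_s in npr_b.
have [gT2 [f2 [h2 nil2]]] := p_nilpotent_kernel_exists pr_b.
pose h x := (f1 x, f2 x); have hh : fhom h := fhom_pair h1 h2.
exists _, h; split=> // s pr_s le_s; split=> // gT f fh.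
move: le_s; rewrite leq_eqVlt => /predU1P[->|lt_s].
  by apply: p_nilpotentS (nil2 _ f fh); apply: fimageS => x [].
by apply: p_nilpotentS ((nil1 s pr_s lt_s).2 _ f fh); apply: fimageS => x [].
Qed.

(** The elements of [K0] mapped into [Z] form an open subgroup of index at most [#|gT0| * n] in [G],
    and [open_index_bound] treats all such subgroups at once. *)
Lemma finite_index_bound (gT0 : finGroupType) (f0 : G -> gT0) n : fhom f0 ->
  exists (gT1 : finGroupType) (f1 : G -> gT1), fhom f1 /\
    forall (gT : finGroupType) (f : G -> gT) (Z : {group gT}), fhom f ->
      Z \subset fimage f (f0 @^-1` [set 1]) ->
      #|fimage f (f0 @^-1` [set 1]) : Z| <= n ->
      fimage f (f0 @^-1` [set 1] `&` f1 @^-1` [set 1]) \subset Z.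
Proof.
move=> h0; have fgSyl p : prime p -> exists S : set G, sylow_subgroup p S /\ finitely_generated S.
  by move/sylG=> [S [r [sylS fgS _ _]]]; exists S.
have [gT1 [f1 [h1 bound]]] := open_index_bound pG fgSyl (#|gT0| * n)%N.
exists gT1, f1; split=> // gT f Z fh sZX idxZ.
set K0 := f0 @^-1` [set 1] in sZX idxZ *; set X0 := fimage f K0 in sZX idxZ.
have [gK0 _ _] : normal_subgroup K0 [set: G] by exact: fhom_kernel.
have [gK _ _] : normal_subgroup (f1 @^-1` [set 1]) [set: G] by exact: fhom_kernel.
apply/fintype.subsetP=> _ /(fimageP fh _ (subgroupI gK0 gK))[g [K0g f1g] <-].
(* With [t] choosing representatives modulo [K0], the map [c] records the coset of [x] modulo [K0]
   and the coset of [Z] of the remaining factor in [K0]. *)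
pose t (u : gT0) : G := xget 1 [set y | f0 y = u].
have f0t x : f0 (t (f0 x)) = f0 x.
  by apply: (@xgetPex _ 1 [set y | f0 y = f0 x]); exists x.
pose c x := (f0 x, Z :* f (x * (t (f0 x))^-1)).
suff [] : (K0 `&` f @^-1` [set` Z]) g by [].
apply: (bound _ (finset.setX [set: gT0]%SET (rcosets Z X0)) c _ _ _ _ _ _ g f1g).
- move=> x; rewrite finset.in_setX finset.in_setT /= mem_rcosets.
  by rewrite mulSGid // mem_fimage //= /K0 /= (fhomM h0) (fhomV h0) f0t mulgV.
- by rewrite cardsX cardsT leq_mul2l idxZ orbT.
- by apply: subgroupI => //; exact: fhom_subgroup.
- by apply: openI; [exact: h0.2 | exact: fhom_open].
move=> x y [eq0 eqZ]; split; first by rewrite /K0 /= (fhomM h0) (fhomV h0) eq0 mulgV.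
move/rcoset_eqP: eqZ; rewrite mem_rcoset eq0 -(fhomV fh) -(fhomM fh).
by rewrite invMg invgK !mulgA mulgKV.
Qed.

Definition large_Sylow_controlled (K : set G) (L : nat) : Prop :=
  forall l, prime l -> L <= l -> forall (gT : finGroupType) (f : G -> gT), fhom f ->
  exists S : {group gT}, l.-Sylow(fimage f K) S /\
    forall y, y \in 'N_(fimage f K)(S)^`(1) -> l^'.-elt y -> y \in 'C(S).

Lemma large_Sylow_controlled_exists :
  exists (K : set G) (L : nat),
    [/\ normal_subgroup K [set: G], open K, closed K & large_Sylow_controlled K L].
Proof.
have [gT0 [f0 [h0 nil0]]] := p_nilpotent_kernel_bound R.
have [gT1 [f1 [h1 idx1]]] := finite_index_bound ((R ^ R) ^ 2) h0.
pose K0 := f0 @^-1` [set 1]; pose K := K0 `&` f1 @^-1` [set 1].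
have nK0 : normal_subgroup K0 [set: G] by exact: fhom_kernel.
have nK : normal_subgroup K [set: G] by apply: normal_subgroupI => //; exact: fhom_kernel.
have [[gK0 _ _] [gK _ _]] := (nK0, nK).
(* Beyond [#|gT0|] and [#|gT1|], a Sylow l-subgroup has trivial image under [f0] and [f1], hence
   lies in [K]. Beyond [R], its images in [X0] lie in the core for the primes above [R]. *)
exists K, (maxn R (maxn #|gT0| #|gT1|)).+1; split=> //.
- by apply: openI; [exact: h0.2 | exact: h1.2].
- by apply: closedI; exact: fhom_closed.
move=> l pr_l; rewrite !gtn_max => /and3P[lt_R lt_0 lt_1] gT f fh.
have [S' [r [sylS' fgS' cS' le_r]]] := sylG pr_l.
have [[_ gS'] _ _] := sylS'.
have S'1 (rT : finGroupType) (h : G -> rT) x : fhom h -> #|rT| < l -> S' x -> h x = 1.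
  move=> hh lt_l S'x; have := fimage_pro_p pr_l sylS' hh => lS.
  have lx : l.-elt (h x) by apply: mem_p_elt lS _; exact: mem_fimage.
  apply/eqP; rewrite -order_eq1; apply: contraLR lt_l; rewrite -leqNgt => nt.
  have nt1 : <[h x]> != 1 by rewrite cycle_eq1 -order_eq1.
  have [_ l_dvd _] := pgroup_pdiv lx nt1.
  by apply: leq_trans (dvdn_leq _ l_dvd) _; rewrite ?cardG_gt0 // max_card.
have sS'K : S' `<=` K by move=> x S'x; split; apply: S'1 S'x.
set X0 := fimage f K0; set X := fimage f K; set S := fimage f S'.
have sylS : l.-Sylow(fimage f setT) S := fimage_sylow pr_l pG sylS' fh.
have sSX : S \subset X by exact: fimageS.
have sXX0 : X \subset X0 by apply: fimageS; exact: subIsetl.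
have sX0T : X0 \subset fimage f setT by exact: fimageS.
have sylSX0 : l.-Sylow(X0) S := pHall_subl (fintype.subset_trans sSX sXX0) sX0T sylS.
exists S; split; first exact: pHall_subl sSX sXX0 sylSX0.
pose pi : nat_pred := [pred q | prime q && (q <= R)].
have nilX0 s : s \in pi -> p_nilpotent s X0.
  by case/andP=> pr_s le_s; exact: (nil0 s pr_s le_s).2.
have [m [W [W0 Wm WS idxW]]] := Sylow_chain pr_l pG sylS' fgS' cS' le_r fh.
move=> y; apply: (@der_Sylow_normaliser_cent gT l R m X0 X 'O_pi^'(X0)%G S W) => //.
- exact: pcore_normal.
- apply/fintype.subsetP=> x Sx; rewrite /= -bigcap_p'core.
  have X0x : x \in X0 by apply: fintype.subsetP Sx; exact: fintype.subset_trans sXX0.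
  rewrite finset.in_setI X0x; apply/finset.bigcapP=> i pi_i.
  apply: p_nilpotent_p'elt => //; first exact: nilX0.
  apply: sub_in_pnat (mem_p_elt (pHall_pgroup sylS) Sx) => q _ /eqP->.
  by apply: contraL lt_R => /eqP->; case/andP: pi_i; rewrite -leqNgt.
- move=> q pr_q q_dvd; have : q \in negn pi.
    by apply: (pnatPpi (pcore_pgroup (negn pi) X0)); rewrite mem_primes pr_q cardG_gt0.
  by rewrite !inE /= pr_q /= -ltnNge.
- exact: nilpotent_quo_pcore.
- by move=> Z _ sZX0 idxZ; exact: idx1.
- move=> i /WS[sWS nWN]; split=> //; apply: fintype.subset_trans nWN.
  exact: finset.setSI.
Qed.

Variable K : set G.
Hypothesis nK : normal_subgroup K [set: G].
Let gK : subgroup K. Proof. by case: nK. Qed.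

Lemma p_nilpotent_kernel_pcore (p : nat) (gT0 gT : finGroupType) (f0 : G -> gT0) (f : G -> gT) :
  p_nilpotent_kernel p f0 -> fhom f ->
  fimage f (K `&` f0 @^-1` [set 1]) <| fimage f K /\
  p_nilpotent p (fimage f (K `&` f0 @^-1` [set 1])).
Proof.
move=> [h0 nil0] fh; split.
  have [gI _ nI] := normal_subgroupI nK (fhom_kernel h0).
  apply: fimage_normal => //; split=> //.
  by move=> x y _; exact: nI.
by apply: p_nilpotentS (nil0 _ f fh); apply: fimageS => x [].
Qed.

(** For [p] larger than [#|gT0|], a p-element of the image generates the same cyclic group as its
    power of exponent [#[f0 g]], which comes from the kernel of [f0]. So it lies in a normal
    l-nilpotent subgroup, and, being an l'-element, in the l'-core. *)
Lemma large_prime_elements l : prime l -> exists b, forall p, prime p -> b <= p ->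
  forall (gT : finGroupType) (f : G -> gT), fhom f ->
  forall x, x \in fimage f K -> p.-elt x -> x \in 'O_l^'(fimage f K).
Proof.
move=> pr_l; have [gT0 [f0 nil0]] := p_nilpotent_kernel_exists pr_l.
exists (maxn l #|gT0|).+1 => p pr_p; rewrite gtn_max => /andP[lt_lp lt_p] gT f fh.
move=> _ /(fimageP fh _ gK)[g Kg <-] pfg.
have [nsM nilM] := p_nilpotent_kernel_pcore nil0 fh; set M := fimage f _ in nsM nilM.
have copn : coprime #[f g] #[f0 g].
  have /p_natP[k ->] := pfg; apply: coprimeXl; rewrite prime_coprime //.
  apply: contraL lt_p => /(dvdn_leq (order_gt0 _)) le_p; rewrite -leqNgt.
  by apply: leq_trans le_p _; rewrite /order max_card.
have Mx : f g \in M.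
  have : generator <[f g]> (f g ^+ #[f0 g]) by rewrite generator_coprime.
  move/eqP=> eq_fg; rewrite -cycle_subG eq_fg cycle_subG -(fhomX fh).
  apply: mem_fimage; split; first exact: subgroupX.
  by rewrite /= (fhomX nil0.1) expg_order.
have OM : f g \in 'O_l^'(M).
  apply: p_nilpotent_p'elt => //; apply: sub_in_pnat pfg => q _ /eqP->.
  by rewrite !inE neq_ltn lt_lp orbT.
apply: fintype.subsetP OM; apply: pcore_max; first exact: pcore_pgroup.
by apply: gFnormal_trans.
Qed.

Variable L : nat.
Hypothesis ctlK : large_Sylow_controlled K L.

Lemma large_prime_der q : prime q -> exists b, forall p, prime p -> b <= p ->
  forall (gT : finGroupType) (f : G -> gT), fhom f ->
  forall y, y \in (fimage f K)^`(1) -> q.-elt y -> y \in 'O_{p^', p}(fimage f K).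
Proof.
move=> pr_q; have [bq bqP] := large_prime_elements pr_q.
(* For primes [l] from [L1] on, Sylow normalisers are controlled, Sylow l-subgroups lie in the
   q'-core, and [l] differs from [q]. The bound [b] then places p-elements in the l'-core for all
   smaller [l], which makes the index of ['O_pi^'(X)] prime to [p]. *)
pose L1 := maxn L (maxn bq q.+1).
have [b bP] : exists b, forall l, prime l -> l < L1 -> forall p, prime p -> b <= p ->
    forall (gT : finGroupType) (f : G -> gT), fhom f ->
    forall x, x \in fimage f K -> p.-elt x -> x \in 'O_l^'(fimage f K).
  elim: L1 => [|n [b IHb]]; first by exists 0.
  have [pr_n|npr_n] := boolP (prime n); last first.
    exists b => l pr_l; rewrite ltnS leq_eqVlt => /predU1P[eq_l|]; last exact: IHb.
    by rewrite -eq_l pr_l in npr_n.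
  have [bn bnP] := large_prime_elements pr_n.
  exists (maxn b bn) => l pr_l; rewrite ltnS leq_eqVlt => lt_l p pr_p.
  rewrite geq_max => /andP[le_b le_bn]; case/predU1P: lt_l => [->|lt_l]; first exact: bnP.
  exact: IHb.
exists b => p pr_p le_bp gT f fh y; set X := fimage f K.
pose pi : nat_pred := [pred l | prime l && (l < L1)].
apply: (@large_Sylow_der_sub gT p q X 'O_pi^'(X)%G); first exact: pcore_normal.
  have [P sylP] := Sylow_exists p X.
  have sPO : P \subset 'O_pi^'(X).
    apply/fintype.subsetP=> x Px; rewrite /= -bigcap_p'core.
    have Xx : x \in X by apply: fintype.subsetP Px; case/andP: sylP.
    rewrite finset.in_setI Xx; apply/finset.bigcapP=> i /andP[pr_i lt_i].
    by apply: (bP i pr_i lt_i p pr_p le_bp) => //; exact: mem_p_elt (pHall_pgroup sylP) Px.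
  apply: (@pnat_dvd _ #|X : P|); first exact: indexgS.
  by case/and3P: sylP.
move=> l pr_l l_dvd.
have : l \in negn pi.
  by apply: (pnatPpi (pcore_pgroup (negn pi) X)); rewrite mem_primes pr_l cardG_gt0 l_dvd.
rewrite !inE /= pr_l /= -leqNgt !geq_max => /and3P[le_L le_bq lt_q].
have [S [sylS centS]] := ctlK pr_l le_L fh; exists S; split=> //.
  apply/fintype.subsetP=> x Sx; apply: (bqP l pr_l le_bq) => //.
    by apply: fintype.subsetP Sx; case/andP: sylS.
  exact: mem_p_elt (pHall_pgroup sylS) Sx.
move=> z Nz qz; apply: centS => //; apply: sub_in_pnat qz => i _ /eqP->.
by rewrite !inE neq_ltn lt_q.
Qed.

End LargePrimes.

(** * Quotient groups *)

(* The hypotheses are bundled so that the canonical structures of the type of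
   cosets can depend on them. *)
Record quotient_data := QuotientData {
  quo_group : topologicalGroupType;
  quo_top : set quo_group;
  quo_ker : set quo_group;
  quo_topP : subgroup quo_top;
  quo_kerP : normal_subgroup quo_ker quo_top
}.

Section CosetSpace.

Variable d : quotient_data.

Local Notation G := (quo_group d).
Local Notation H := (@quo_top d).
Local Notation N := (@quo_ker d).
Let gH : subgroup H := quo_topP d.
Let gN : subgroup N. Proof. by case: (quo_kerP d). Qed.
Let sNH : N `<=` H. Proof. by case: (quo_kerP d). Qed.
Let nNH x y : H x -> N y -> N (y ^ x). Proof. by case: (quo_kerP d) => _ _; exact. Qed.

(** On [H], the set of candidates depends only on the coset, so [xget] makes the same choice
    throughout it. *)
Definition coset_rep (x : G) : G := xget 1 [set y | H y /\ N (x^-1 * y)].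

Lemma coset_repP x : H x -> H (coset_rep x) /\ N (x^-1 * coset_rep x).
Proof.
move=> Hx; apply: (@xgetPex _ 1 [set y | H y /\ N (x^-1 * y)]); exists x; split=> //.
by rewrite mulVg; exact: subgroup1.
Qed.

Lemma coset_rep_eq x y : N (x^-1 * y) -> coset_rep x = coset_rep y.
Proof.
move=> Nxy; congr xget; apply/seteqP; split=> z [Hz Nz]; split=> //.
  rewrite -[y^-1](mulgKV x^-1) invgK -mulgA -[y^-1 * x]invgK.
  by apply: subgroupM => //; apply: subgroupV => //; rewrite invMg invgK.
by rewrite -[x^-1](mulgK y) -mulgA; apply: subgroupM.
Qed.

Lemma coset_rep_id x : H x -> coset_rep (coset_rep x) = coset_rep x.
Proof. by move=> Hx; apply/esym/coset_rep_eq; case: (coset_repP Hx). Qed.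

Definition coset_space := {x : G | `[< H x /\ coset_rep x = x >]}.

HB.instance Definition _ := Choice.on coset_space.

Lemma coset_proj_proof x : `[< H (if `[< H x >] then coset_rep x else coset_rep 1) /\
  coset_rep (if `[< H x >] then coset_rep x else coset_rep 1) =
  (if `[< H x >] then coset_rep x else coset_rep 1) >].
Proof.
apply/asboolP; case: asboolP => Hx; first by rewrite coset_rep_id //; case: (coset_repP Hx).
by have H1 := subgroup1 gH; rewrite coset_rep_id //; case: (coset_repP H1).
Qed.

(** Elements outside [H] are sent to the trivial coset. *)
Definition coset_proj (x : G) : coset_space :=
  exist (fun y : G => is_true `[< H y /\ coset_rep y = y >]) _ (coset_proj_proof x).

Lemma val_coset_proj x : H x -> val (coset_proj x) = coset_rep x.
Proof. by move=> Hx; rewrite /=; case: asboolP. Qed.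

Lemma coset_projP (a : coset_space) : H (val a) /\ coset_proj (val a) = a.
Proof.
have /asboolP[Ha ra] := valP a; split=> //; apply: val_inj.
by rewrite val_coset_proj.
Qed.

Lemma coset_proj_eq x y : H x -> H y -> coset_proj x = coset_proj y <-> N (x^-1 * y).
Proof.
move=> Hx Hy; split=> [/(congr1 val)|Nxy]; last first.
  by apply: val_inj; rewrite !val_coset_proj //; exact: coset_rep_eq.
rewrite !val_coset_proj // => eq_r.
have [_ Nx] := coset_repP Hx; have [_ Ny] := coset_repP Hy.
rewrite (_ : x^-1 * y = x^-1 * coset_rep x * (y^-1 * coset_rep y)^-1); last first.
  by rewrite eq_r invMg invgK !mulgA mulgK.
by case: gN => _; apply.
Qed.

Lemma coset_proj_mul x y : H x -> H y ->
  coset_proj (val (coset_proj x) * val (coset_proj y)) = coset_proj (x * y).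
Proof.
move=> Hx Hy; have [Hrx Nx] := coset_repP Hx; have [Hry Ny] := coset_repP Hy.
rewrite !val_coset_proj //; apply/esym/coset_proj_eq; try exact: subgroupM.
rewrite (_ : _^-1 * _ = (x^-1 * coset_rep x) ^ y * (y^-1 * coset_rep y)); last first.
  by rewrite conjgE invMg !mulgA mulgK.
by apply: subgroupM => //; exact: nNH.
Qed.

Definition coset_one : coset_space := coset_proj 1.
Definition coset_mul (a b : coset_space) : coset_space := coset_proj (val a * val b).
Definition coset_inv (a : coset_space) : coset_space := coset_proj (val a)^-1.

Lemma coset_mulE x y : H x -> H y ->
  coset_mul (coset_proj x) (coset_proj y) = coset_proj (x * y).
Proof. exact: coset_proj_mul. Qed.

Lemma coset_invE x : H x -> coset_inv (coset_proj x) = coset_proj x^-1.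
Proof.
move=> Hx; have [Hrx Nx] := coset_repP Hx; rewrite /coset_inv val_coset_proj //.
apply/coset_proj_eq; try exact: subgroupV.
rewrite invgK (_ : _ * x^-1 = (x^-1 * coset_rep x) ^ x^-1); last first.
  by rewrite conjgE invgK !mulgA mulgV mul1g.
by apply: nNH => //; exact: subgroupV.
Qed.

Lemma coset_mulA : associative coset_mul.
Proof.
move=> a b c; have [Ha <-] := coset_projP a; have [Hb <-] := coset_projP b.
have [Hc <-] := coset_projP c.
by do ?rewrite coset_mulE //; try exact: subgroupM; rewrite mulgA.
Qed.

Lemma coset_mul1g : left_id coset_one coset_mul.
Proof.
move=> a; have [Ha <-] := coset_projP a.
by rewrite coset_mulE ?mul1g //; exact: subgroup1.
Qed.

Lemma coset_mulVg : left_inverse coset_one coset_inv coset_mul.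
Proof.
move=> a; have [Ha <-] := coset_projP a.
by rewrite coset_invE // coset_mulE ?mulVg //; exact: subgroupV.
Qed.

Lemma coset_mulg1 : right_id coset_one coset_mul.
Proof.
move=> a; have [Ha <-] := coset_projP a.
by rewrite coset_mulE ?mulg1 //; exact: subgroup1.
Qed.

Lemma coset_mulgV : right_inverse coset_one coset_inv coset_mul.
Proof.
move=> a; have [Ha <-] := coset_projP a.
by rewrite coset_invE // coset_mulE ?mulgV //; exact: subgroupV.
Qed.

HB.instance Definition _ := isGroup.Build coset_space
  coset_mulA coset_mul1g coset_mulg1 coset_mulVg coset_mulgV.

Definition coset_open (O : set coset_space) := open (coset_proj @^-1` O : set (subspace H)).

Lemma coset_openT : coset_open setT.
Proof. by rewrite /coset_open preimage_setT; exact: openT. Qed.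

Lemma coset_openI A B : coset_open A -> coset_open B -> coset_open (A `&` B).
Proof. by rewrite /coset_open preimage_setI => oA oB; exact: openI. Qed.

Lemma coset_open_bigcup (I : Type) (f : I -> set coset_space) :
  (forall i, coset_open (f i)) -> coset_open (\bigcup_i f i).
Proof.
by move=> oF; rewrite /coset_open preimage_bigcup; apply: bigcup_open => i _; exact: oF.
Qed.

HB.instance Definition _ := isOpenTopological.Build coset_space
  coset_openT coset_openI coset_open_bigcup.

Lemma open_cosetE (O : set coset_space) :
  open O = open (coset_proj @^-1` O : set (subspace H)).
Proof. by []. Qed.

Lemma open_coset_lift (O : set coset_space) : open O ->
  exists2 V : set G, open V & forall x, H x -> V x <-> O (coset_proj x).
Proof.
rewrite open_cosetE => /open_subspaceP[V oV eV]; exists V => // x Hx.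
move/seteqP: eV => [sVO sOV].
by split=> [Vx|Ox]; [case: (sVO x) | case: (sOV x)].
Qed.

(** The preimage in [H] of the image of [A] is cut out by a union of translates of [A] by elements
    of [N]. *)
Lemma coset_proj_open (A : set G) : open A -> open [set coset_proj x | x in A `&` H].
Proof.
move=> oA; rewrite open_cosetE; apply/open_subspaceP.
exists (\bigcup_(n in N) [set g | A (g * n)]).
  apply: bigcup_open => n _; apply: open_comp => // x _; exact: mulgr_continuous.
apply/seteqP; split=> g [/= Ag Hg]; split=> //.
  case: Ag => n Nn Agn; have Hn := sNH Nn; exists (g * n).
    by split=> //; exact: subgroupM.
  apply/coset_proj_eq => //; first exact: subgroupM.
  by rewrite invMg mulgKV; exact: subgroupV.
case: Ag => x [Ax Hx] /esym/(coset_proj_eq Hg Hx) Nn; exists (g^-1 * x) => //=.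
by rewrite mulVKg.
Qed.

Lemma coset_mul_continuous :
  continuous (fun p : coset_space * coset_space => p.1 * p.2).
Proof.
move=> [a b] O nO.
have [O' [oO' abO'] sO'] : exists2 B, open_nbhs (a * b) B & B `<=` O by move: nO; rewrite nbhsE.
have [Ha pa] := coset_projP a; have [Hb pb] := coset_projP b.
have [V oV VO] := open_coset_lift oO'.
have Vab : V (val a * val b).
  by apply/VO; [exact: subgroupM | rewrite -coset_mulE // pa pb].
have : nbhs (val a * val b) V by apply: open_nbhs_nbhs.
move/(@mulg_continuous G (val a, val b)) => -[[A B] /= [nA nB] sAB].
rewrite nbhsE in nA; rewrite nbhsE in nB.
have [A' [oA' aA'] sA'] := nA; have [B' [oB' bB'] sB'] := nB.
exists ([set coset_proj x | x in A' `&` H], [set coset_proj x | x in B' `&` H]).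
  split=> /=; apply: open_nbhs_nbhs; split; try exact: coset_proj_open.
    by exists (val a).
  by exists (val b).
move=> [_ _] /= [[x [Ax Hx] <-] [y [By Hy] <-]]; apply: sO'.
have -> : coset_proj x * coset_proj y = coset_proj (x * y) by exact: coset_mulE.
apply/VO; first exact: subgroupM.
by apply: (sAB (x, y)); split; [exact: sA' | exact: sB'].
Qed.

Lemma coset_inv_continuous : continuous (fun a : coset_space => a^-1).
Proof.
move=> a O nO.
have [O' [oO' aO'] sO'] : exists2 B, open_nbhs a^-1 B & B `<=` O by move: nO; rewrite nbhsE.
have [Ha pa] := coset_projP a; have [V oV VO] := open_coset_lift oO'.
have Va : V (val a)^-1.
  by apply/VO; [exact: subgroupV | rewrite -coset_invE // pa].
have : nbhs (val a)^-1 V by apply: open_nbhs_nbhs.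
move/(@invg_continuous G (val a)) => nA; rewrite nbhs_simpl /= nbhsE in nA.
have [A [oA aA] sA] := nA.
rewrite nbhs_simpl /= nbhsE; exists [set coset_proj x | x in A `&` H].
  by split; [exact: coset_proj_open | exists (val a)].
move=> _ [x [Ax Hx] <-] /=; apply: sO'.
have -> : (coset_proj x)^-1 = coset_proj x^-1 by exact: coset_invE.
by apply/VO; [exact: subgroupV | exact: sA].
Qed.

HB.instance Definition _ := Topological_isTopologicalGroup.Build coset_space
  coset_mul_continuous coset_inv_continuous.

Lemma coset_quotient_map : quotient_map H N coset_proj.
Proof.
split=> [x y Hx Hy||]; first by have := coset_mulE Hx Hy => /esym.
  apply/seteqP; split=> // a _; have [Ha pa] := coset_projP a.
  by exists (val a).
apply/seteqP; split=> [x [Hx /= /esym x1]|x Nx].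
  by move/(coset_proj_eq (subgroup1 gH) Hx) : x1; rewrite invg1 mul1g.
have Hx := sNH Nx; split=> //=; apply/esym/(coset_proj_eq (subgroup1 gH) Hx).
by rewrite invg1 mul1g.
Qed.

End CosetSpace.

Lemma quotient_group_exists (G : topologicalGroupType) (H N : set G) :
  subgroup H -> normal_subgroup N H ->
  exists (Q : topologicalGroupType) (f : G -> Q), quotient_map H N f /\
    forall O : set Q, open O <-> open (f @^-1` O : set (subspace H)).
Proof.
move=> gH nNH; pose d := QuotientData gH nNH.
exists (coset_space d : topologicalGroupType), (@coset_proj d).
by split=> //; exact: (coset_quotient_map d).
Qed.

(** * Sylow-finite quotients *)

Section FittingPreimages.

Variables (G : topologicalGroupType) (K : set G).
Hypotheses (pG : profinite G) (gK : subgroup K) (clK : closed K).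

(* For a functorial [D], the inverse limit of the subgroups [D (f K)]. *)
Definition fimage_preim (D : forall gT : finGroupType, {group gT} -> {group gT}) : set G :=
  [set g | K g /\ forall (gT : finGroupType) (f : G -> gT), fhom f ->
    f g \in D gT (fimage f K)].

Implicit Type D : forall gT : finGroupType, {group gT} -> {group gT}.

Lemma fimage_preim_normal D : (forall gT (X : {group gT}), D gT X <| X) ->
  closed (fimage_preim D) /\ normal_subgroup (fimage_preim D) K.
Proof.
move=> nsD; split.
  move=> g clg; split=> [|gT f fh].
    by apply: clK; apply: closureS clg => x [].
  suff : (f @^-1` [set` D _ (fimage f K)]) g by [].
  apply: (fhom_closed fh).
  by apply: closureS clg => x [_ Dx]; exact: Dx.
split; last 1 first.
- move=> x y Kx [Ky Dy]; split=> [|gT f fh]; first exact: subgroupJ.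
  rewrite (fhomJ fh) memJ_norm ?Dy //; apply: fintype.subsetP (mem_fimage f Kx).
  exact: normal_norm.
- split=> [|x y [Kx Dx] [Ky Dy]].
    by split=> [|gT f fh]; [exact: subgroup1 | rewrite (fhom1 fh)].
  split=> [|gT f fh]; first by case: gK => _; exact.
  by rewrite (fhomM fh) (fhomV fh) groupM ?groupV ?Dx ?Dy.
by move=> x [].
Qed.

Lemma fimage_preim_sub D (gT : finGroupType) (f : G -> gT) :
  fhom f -> (forall gT (X : {group gT}), D gT X <| X) ->
  fimage f (fimage_preim D) \subset D gT (fimage f K).
Proof.
move=> fh nsD; have [_ [gD _ _]] := fimage_preim_normal nsD.
by apply/fintype.subsetP=> _ /(fimageP fh _ gD)[x [_ Dx] <-]; exact: Dx.
Qed.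

End FittingPreimages.

(** An open normal subgroup [U] of [N] contains the part of [N] killed by some [f]. Hence it is the
    full preimage of its image, and [N / U] is a quotient of a nilpotent finite image. *)
Lemma pronilpotent_fimage (G : topologicalGroupType) (N : set G) :
  profinite G -> subgroup N ->
  (forall (gT : finGroupType) (f : G -> gT), fhom f -> nilpotent (fimage f N)) ->
  pronilpotent N.
Proof.
move=> pG gN nilN U nU oU; have [gU sUN _] := nU.
have /open_subspaceP[V oV defV] := oU.
have nV : nbhs 1 V.
  apply: open_nbhs_nbhs; split=> //; have : (U `&` N) 1.
    by split; exact: subgroup1.
  by rewrite -defV => -[].
have [gT [f [fh fV]]] := fhom_open_kernel pG nV.
have nsU : fimage f U <| fimage f N := fimage_normal fh gN nU.
exists (subg_of (fimage f N / fimage f U)%G), (fun x => subg _ (coset (fimage f U) (f x))).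
split; last first.
  rewrite /= -(isog_nil (isog_subg _)); exact/quotient_nil/nilN.
have defU : U = N `&` f @^-1` [set` fimage f U].
  apply/seteqP; split=> [x Ux|x [Nx /(fimageP fh _ gU)[u Uu fux]]].
    by split; [exact: sUN | exact: mem_fimage].
  rewrite -[x](mulgKV u); apply: subgroupM => //.
  suff : (V `&` N) (x * u^-1) by rewrite defV => -[].
  split; first by apply: fV; rewrite (fhomM fh) (fhomV fh) fux mulgV.
  by case: gN => _; apply => //; exact: sUN.
by have := fimage_quotient_map fh gN nsU; rewrite -defU.
Qed.

Lemma quotient_satisfies_abelian (G : topologicalGroupType) (K A : set G) :
  subgroup K -> normal_subgroup A K ->
  (forall x y, K x -> K y -> A [~ x, y]) -> quotient_satisfies K A abelian_group.
Proof.
move=> gK nA abA; have [Q [f [qf topQ]]] := quotient_group_exists gK nA.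
exists Q, f; split=> //; have [fM fK fA] := qf.
have onto a : exists2 x, K x & f x = a.
  by have := (I : [set: Q] a); rewrite -fK => -[x Kx <-]; exists x.
move=> a b.
have [[x Kx <-] [y Ky <-]] := (onto a, onto b).
rewrite /commute -!fM // commgC fM; try exact: subgroupM.
  suff -> : f [~ x, y] = 1 by rewrite mulg1.
  by have := abA x y Kx Ky; rewrite -fA => -[].
by case: nA => _ sAK _; apply/sAK/abA.
Qed.

Section SylowFinite.

Variables (G : topologicalGroupType) (R L : nat) (K : set G).
Hypotheses (pG : profinite G) (nK : normal_subgroup K [set: G]) (oK : open K) (clK : closed K).
Hypothesis sylG : forall p, prime p -> exists (S : set G) (r : nat),
  [/\ sylow_subgroup p S, finitely_generated S, is_c_of S r & r <= R].
Hypothesis ctlK : large_Sylow_controlled K L.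

Let gK : subgroup K. Proof. by case: nK. Qed.

Definition Fitting_preim : set G := fimage_preim K (fun gT (X : {group gT}) => 'F(X)%G).

Definition der_Fitting_preim : set G :=
  fimage_preim K (fun gT (X : {group gT}) => (X^`(1) <*> 'F(X))%G).

Local Notation N := Fitting_preim.
Local Notation A := der_Fitting_preim.

Lemma Fitting_preim_normal : closed N /\ normal_subgroup N K.
Proof. by apply: fimage_preim_normal => // gT X; exact: Fitting_normal. Qed.

Lemma der_Fitting_preim_normal : closed A /\ normal_subgroup A K.
Proof.
apply: fimage_preim_normal => // gT X.
by rewrite normalY ?der_normal ?Fitting_normal.
Qed.

Lemma Fitting_preim_sub : N `<=` A.
Proof.
move=> g [Kg Fg]; split=> // gT f fh.
by apply: fintype.subsetP (Fg gT f fh); exact: joing_subr.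
Qed.

Lemma Fitting_preimP g : K g ->
  N g <-> forall p, prime p -> forall (gT : finGroupType) (f : G -> gT), fhom f ->
    f g \in 'O_{p^', p}(fimage f K).
Proof.
move=> Kg; split=> [[_ Fg] p p_pr gT f fh|Og].
  by have [_] := proj1 (Fitting_pcore2 _ _) (Fg gT f fh); exact.
split=> // gT f fh; apply/Fitting_pcore2; split; first exact: mem_fimage.
by move=> p p_pr; exact: Og.
Qed.

Let nA : normal_subgroup A K. Proof. by case: der_Fitting_preim_normal. Qed.
Let gA : subgroup A. Proof. by case: nA. Qed.
Let sAK : A `<=` K. Proof. by case: nA. Qed.

Let nNA : normal_subgroup N A.
Proof.
have [_ [gN _ nN]] := Fitting_preim_normal; split=> //; first exact: Fitting_preim_sub.
by move=> x y /sAK; exact: nN.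
Qed.

(* Its image in [A / N] is finite: within it, [N] is cut out by the conditions
   on the finitely many primes [p < b], each of which holds on an open subgroup. *)
Let large_part b : set G := [set g | A g /\ forall p, prime p -> b <= p ->
  forall (gT : finGroupType) (f : G -> gT), fhom f -> f g \in 'O_{p^', p}(fimage f K)].

Let large_part_normal b : normal_subgroup (large_part b) A.
Proof.
split; [|by move=> g []|].
  split=> [|x y [Ax Ox] [Ay Oy]].
    by split=> [|p p_pr le_p gT f fh]; [exact: subgroup1 | rewrite (fhom1 fh)].
  split=> [|p p_pr le_p gT f fh]; first by case: gA => _; exact.
  rewrite (fhomM fh) (fhomV fh); apply: groupM; first exact: Ox.
  by rewrite groupV; exact: Oy.
move=> x y Ax [Ay Oy]; split=> [|p p_pr le_p gT f fh]; first exact: subgroupJ.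
rewrite (fhomJ fh) memJ_norm; first exact: Oy.
by apply: fintype.subsetP (mem_fimage f (sAK Ax)); exact: gFnorm.
Qed.

Let large_part_finite (Q : topologicalGroupType) (phi : G -> Q) b :
  quotient_map A N phi -> finite_set (phi @` large_part b).
Proof.
move=> [phiM phiA phiN]; have [gT0 [f0 [h0 nil0]]] := p_nilpotent_kernel_bound pG sylG b.
have [gL sLA _] := large_part_normal b.
(* One element is chosen for each value of [f0]. Two elements of the large part with the same value
   differ by an element of [N]. *)
pose rep u := phi (xget 1 [set g | large_part b g /\ f0 g = u]).
apply: (@sub_finite_set _ _ (rep @` [set: gT0])); last exact/finite_image/finite_finset.
move=> _ [g Lg <-]; exists (f0 g) => //; rewrite /rep; set x := xget 1 _.
have [Lx f0x] : large_part b x /\ f0 x = f0 g.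
  by apply: (@xgetPex _ 1 [set y | large_part b y /\ f0 y = f0 g]); exists g.
have LB : large_part b (x * g^-1) by case: gL => _; exact.
suff : N (x * g^-1).
  rewrite -phiN => -[_ /= phi1]; rewrite -[x](mulgKV g) phiM ?phi1 ?mul1g //; exact: sLA.
apply/Fitting_preimP; first exact/sAK/sLA.
move=> p p_pr gT f fh; have [lt_p|le_p] := ltnP p b; last by case: LB => _; exact.
have [nsM nilM] := p_nilpotent_kernel_pcore nK (nil0 p p_pr (ltnW lt_p)) fh.
apply: fintype.subsetP (p_nilpotent_normal nsM nilM) _ _; apply: mem_fimage.
split; first exact/sAK/sLA.
by rewrite /= (fhomM h0) (fhomV h0) f0x mulgV.
Qed.

(** With [b] from [large_prime_der], the image of [large_part b] contains every Sylow q-subgroup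
    [S]. For [p >= b], a representative of an element of [S] has a q-power in the preimage of
    ['O_{p^', p}], since [S] is pro-q, and [der_Fitting_pcore2] removes the exponent. *)
Lemma der_Fitting_Sylow_finite : quotient_satisfies A N Sylow_finite.
Proof.
have [Q [phi [qphi topQ]]] := quotient_group_exists gA nNA.
exists Q, phi; split=> // q S q_pr [[clS gS] ppS _].
have [b bP] := large_prime_der pG sylG nK ctlK q_pr.
exists (phi @` large_part b); have [phiM phiA phiN] := qphi.
have phi1 : phi 1 = 1.
  by apply: (mulgI (phi 1)); rewrite -phiM ?mulg1 //; exact: subgroup1.
have phiV x : A x -> phi x^-1 = (phi x)^-1.
  by move=> Ax; apply: (mulgI (phi x)); rewrite -phiM ?mulgV //; exact: subgroupV.
have phiX x n : A x -> phi (x ^+ n) = phi x ^+ n.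
  by move=> Ax; elim: n => // n IHn; rewrite !expgS phiM ?IHn //; exact: subgroupX.
have phiJ x y : A x -> A y -> phi (x ^ y) = phi x ^ phi y.
  move=> Ax Ay; have AV := subgroupV gA Ay.
  by rewrite !conjgE !phiM ?phiV //; exact: subgroupM.
have onto a : exists2 x, A x & phi x = a.
  by have := (I : [set: Q] a); rewrite -phiA => -[x Ax <-]; exists x.
have phi_normal (M : set G) : normal_subgroup M A -> normal_subgroup (phi @` M) [set: Q].
  move=> [gM sMA nM]; split=> //.
    split=> [|_ _ [x Mx <-] [y My <-]]; first by exists 1 => //; exact: subgroup1.
    exists (x * y^-1); first by case: gM => _; exact.
    have [Ax Ay] := (sMA x Mx, sMA y My).
    by rewrite phiM ?phiV //; exact: subgroupV.
  move=> a _ _ [y My <-]; have [x Ax <-] := onto a.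
  by exists (y ^ x); [exact: nM | rewrite phiJ //; exact: sMA].
split; first exact: phi_normal (large_part_normal b).
  exact: large_part_finite.
move=> a Sa; have [g Ag phig] := onto a; exists g => //; split=> // p p_pr le_p gT f fh.
set O := 'O_{p^', p}(fimage f K).
have nO : fimage f A \subset 'N(O).
  by apply: fintype.subset_trans (fimageS f sAK) _; exact: gFnorm.
have nM := fhom_kernel_normal (B := 'O_{p^', p}(fimage f K)%G) fh gA nO.
set M := A `&` _ in nM; have [gM sMA _] := nM.
have sNM : N `<=` M.
  move=> x Nx; have Ax := Fitting_preim_sub Nx; split=> //=.
  by have [H _] := Fitting_preimP (sAK Ax); exact: H.
(* As [M] contains [N], the preimage in [A] of its image is [M] itself, which is open in [A]. *)
have oM : open (phi @` M).
  apply/topQ; apply/open_subspaceP; exists (f @^-1` [set` 'O_{p^', p}(fimage f K)%G]).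
    exact: fhom_open.
  apply/seteqP; split=> x [] /= => [Ox|[y My eq_xy]] Ax; split=> //.
    by exists x.
  have : N (x * y^-1).
    have Ay := sMA _ My; have AV := subgroupV gA Ay.
    rewrite -phiN; split; first exact: subgroupM.
    by rewrite /= phiM ?phiV // eq_xy mulgV.
  move/sNM => Mxy; have : M (x * y^-1 * y) by exact: subgroupM.
  by rewrite mulgKV => -[].
have nSM : normal_subgroup (S `&` phi @` M) S.
  have [gphiM _ nphiM] := phi_normal M nM; split; first exact: subgroupI.
    by move=> x [].
  by move=> x y Sx [Sy My]; split; [exact: subgroupJ | exact: nphiM].
have oSM : open (S `&` phi @` M : set (subspace S)).
  by rewrite open_subspaceTI; exact: open_subspaceW.
have [k [_ [x Mx phix]]] := pro_p_exp gS ppS nSM oSM Sa.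
have MX : M (g ^+ (q ^ k)%N).
  have Ax := sMA _ Mx; have AV := subgroupV gA Ax; have AX := subgroupX (q ^ k)%N gA Ag.
  have : N (g ^+ (q ^ k)%N * x^-1).
    rewrite -phiN; split; first exact: subgroupM.
    by rewrite /= phiM ?phiV ?phiX // phix phig mulgV.
  move/sNM => Mgx; have : M (g ^+ (q ^ k)%N * x^-1 * x) by exact: subgroupM.
  by rewrite mulgKV.
apply: (@der_Fitting_pcore2 gT (fimage f K) p q k) => //.
- exact: bP.
- by have [_] := Ag; exact.
by rewrite -(fhomX fh); case: MX.
Qed.

End SylowFinite.

(** * Assembly of the series from the inverse limits *)

Theorem theoremC (G : topologicalGroupType) :
  profinite G ->
  (c_star G < +oo)%E ->
  exists K A N : set G,
    [/\ subgroup K /\ open K,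
        closed_subgroup N /\ closed_subgroup A,
        N `<=` A,
        normal_subgroup N K /\ normal_subgroup A K &
        [/\ pronilpotent N,
            quotient_satisfies A N Sylow_finite &
            quotient_satisfies K A abelian_group]].
Proof.
move=> pG cG; have [R sylG] := c_star_bound pG cG.
have [K [L [nK oK clK ctlK]]] := large_Sylow_controlled_exists pG sylG.
have [gK _ _] := nK.
have [clN nN] := Fitting_preim_normal nK clK.
have [clA nA] := der_Fitting_preim_normal nK clK.
have [[gN _ _] [gA _ _]] := (nN, nA).
exists K, (der_Fitting_preim K), (Fitting_preim K); split=> //.
  exact: Fitting_preim_sub.
split; last 1 first.
- apply: quotient_satisfies_abelian => // x y Kx Ky.
  have Kxy : K [~ x, y].
    by rewrite commgEl; apply: subgroupM => //; [exact: subgroupV | exact: subgroupJ].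
  split=> // gT f fh; apply: fintype.subsetP (joing_subl _ _) _ _.
  have -> : f [~ x, y] = [~ f x, f y] by rewrite !commgEl (fhomM fh) (fhomV fh) (fhomJ fh).
  by apply: mem_commg; exact: mem_fimage.
- apply: pronilpotent_fimage => // gT f fh.
  apply: nilpotentS (Fitting_nil (fimage f K)).
  by apply: (@fimage_preim_sub _ _ gK clK) => // rT X; exact: Fitting_normal.
exact: (der_Fitting_Sylow_finite pG nK clK sylG ctlK).
Qed.
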